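(* Let $r\ge 3$ be a fixed integer and $p\in(0,1)$ a fixed constant. Fix $0<\tau<\min\left(\frac{1}{2r},\frac1{12}\right)$. Let $f_r$ be the number of $r$-cliques in $G(n,p)$, let $\mu=\mathbb{E}[f_r]$, $\sigma^2=\mathrm{Var}(f_r)$, $\mathcal{K}:=(f_r-\mu)/\sigma$, and let $\varphi_{\mathcal{K}}(t)=\mathbb{E}[e^{it\mathcal{K}}]$ be the characteristic function of $\mathcal{K}$. Then $$\int_{-\pi\sigma}^{\pi\sigma}\left|\varphi_{\mathcal{K}}(t)-e^{-\frac{t^2}{2}}\right|dt=O\left(n^{-\frac12+2\tau}\right).$$
   Context: $G(n,p)$ is the random graph on vertex set $[n]$ in which each of the $\binom n2$ possible edges is present independently with probability $p$; $f_r$ counts copies of the complete graph $K_r$. Asymptotics are as $n\to\infty$; the implied constant depends only on $r,p,\tau$. *)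

(* Defs.v *)
From HB Require Import structures.
From mathcomp Require Import all_boot all_order all_algebra complex.
From mathcomp Require Import all_classical all_reals all_analysis.

Set Implicit Arguments.
Unset Strict Implicit.
Unset Printing Implicit Defensive.

Import Order.TTheory GRing.Theory Num.Theory.
Import numFieldNormedType.Exports.

Local Open Scope ring_scope.
Local Open Scope complex_scope.

Definition edge (n : nat) := {e : {set 'I_n} | #|e| == 2}.

(* A simple graph on the vertex set 'I_n is identified with its edge set. *)
Definition graph (n : nat) := {set edge n}.

Definition is_clique (n : nat) (G : graph n) (A : {set 'I_n}) : bool :=
  [forall e : edge n, (val e \subset A) ==> (e \in G)].

(* Copies of K_r in G are counted as r-element vertex subsets. *)
Definition clique_count (r n : nat) (G : graph n) : nat :=
  #|[set A : {set 'I_n} | (#|A| == r) && is_clique G A]|.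

Section Gnp.
Variables (R : realType) (n : nat) (p : R).

(* Probability of the outcome G in G(n,p): the product over all potential edges
   of independent Bernoulli(p) weights. *)
Definition gnp_prob (G : graph n) : R :=
  \prod_(e : edge n) (if e \in G then p else 1 - p).

Definition gnp_expectation (X : graph n -> R) : R :=
  \sum_(G : graph n) gnp_prob G * X G.

Definition gnp_variance (X : graph n -> R) : R :=
  gnp_expectation (fun G => (X G - gnp_expectation X) ^+ 2).

Definition gnp_stddev (X : graph n -> R) : R := Num.sqrt (gnp_variance X).

(* When the standard deviation is 0, division by zero makes this 0. *)
Definition gnp_standardize (X : graph n -> R) (G : graph n) : R :=
  (X G - gnp_expectation X) / gnp_stddev X.

End Gnp.

(* Euler: e^{i x} for real x *)
Definition expi (R : realType) (x : R) : R[i] := cos x +i* sin x.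

Definition gnp_charfun (R : realType) (n : nat) (p : R) (X : graph n -> R)
    (t : R) : R[i] :=
  \sum_(G : graph n) (gnp_prob p G)%:C * expi (t * X G).

Definition cliques (R : realType) (r n : nat) (G : graph n) : R :=
  (clique_count r G)%:R.

(* Main.v *)
Require Import Defs.
From mathcomp Require Import all_classical all_reals all_analysis.
From mathcomp Require Import all_boot all_order all_algebra complex.
From mathcomp Require Import ring lra zify.
Set Implicit Arguments.
Unset Strict Implicit.
Unset Printing Implicit Defensive.
Import Order.TTheory GRing.Theory Num.Theory.
Import numFieldNormedType.Exports.
Local Open Scope ring_scope.
Local Open Scope complex_scope.

(** The standard deviation sigma of the clique count f is of order n^(r-1). The integral is cut at
    |t| = n^tau.

    Below the cut, f - E f is split, in the manner of Hoeffding, into a linear form in the centred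
    edge indicators and a remainder orthogonal to every function of a single edge. Two r-sets
    interact through the remainder only if they share two edges, hence three vertices, so the
    remainder has variance O(n^(2r-3)), a factor n below sigma^2. The characteristic function of the
    linear form is a product, compared with the Gaussian factor by factor. The error is O(|t| / sqrt
    n) while t^4 <= n ([charfun_cliques_gauss]), which integrates to O(n^(-1/2 + 2 tau)).

    Above the cut both functions are at most n^(-r) ([charfun_cliques_tail], [gauss_tail]) on an
    interval of length O(n^(r-1)), which contributes O(1/n). This rests on [charfun_small]: E
    e^(isf) is at most n^(-r) once |s| <= pi and |s| n^(r-1) >= n^a, for any fixed a > 0 and n
    large.

    For that estimate all edges outside a sparse set S are frozen. If the phase is nearly linear in
    the edges of S, with coefficients in [-pi, pi], the mean decays like a product of Bernoulli
    characteristic functions, exp(-c times the sum of the squared coefficients); the nonlinear part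
    is absorbed by a Taylor expansion and McDiarmid's inequality ([charfun_nearly_linear],
    [charfun_local_sum]). An edge lies in about n^(r-2) potential cliques, so for larger s the
    coefficients leave [-pi, pi]. They are reduced by decoupling ([decouple]): d disjoint vertex
    blocks are fixed outside a large vertex set AA, and Cauchy-Schwarz differencing in the edges
    between AA and each block cancels every r-set that misses a block. If the block sizes multiply
    to N, an edge inside AA then has derivative at most N n^k with k = r - 2 - d, and d is chosen
    according to the size of s.

    The derivatives must also be large on average. Testing against Riesz products gives a mean of
    order sqrt(N) n^k ([Ex_incr_lower]), provided N cliques meet each block exactly once; such
    families exist with overwhelming probability ([transversal_bound]). All parameters are measured
    by an integer w with w^M <= n <= (2w)^M, so that e^(-cw), or a high enough power of 1/w, beats
    any fixed power of n ([structured_small]). [charfun_small_root] combines the values of d to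
    cover all s. *)

Local Notation pi := trigo.pi.

(** * Resampling part of the coordinates *)

Section Mix.
Variable T : finType.
Implicit Types (U V G H F : {set T}).

(* The outcome that agrees with [G] on [U] and with [H] off [U]. *)
Definition mix U G H : {set T} := (G :&: U) :|: (H :\: U).

Lemma in_mix U G H x : (x \in mix U G H) = if x \in U then x \in G else x \in H.
Proof. by rewrite !inE; case: (x \in U); rewrite ?andbT ?andbF ?orbF. Qed.

Lemma mix0 G H : mix set0 G H = H.
Proof. by apply/setP => x; rewrite in_mix inE. Qed.

Lemma mixid U G : mix U G G = G.
Proof. by apply/setP => x; rewrite in_mix if_same. Qed.

Lemma mixK U G H : mix U (mix U G H) (mix U H G) = G.
Proof. by apply/setP => x; rewrite !in_mix; case: (x \in U). Qed.

Lemma mix_absorb U G G' H : mix U G (mix U G' H) = mix U G H.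
Proof. by apply/setP => x; rewrite !in_mix; case: (x \in U). Qed.

(** [F] is a function of the coordinates in [U] alone, phrased as invariance under replacing all the
    others. *)
Definition dep (A : Type) U (F : {set T} -> A) := forall G H, F (mix U G H) = F G.

Lemma dep_sub (A : Type) U V (F : {set T} -> A) : U \subset V -> dep U F -> dep V F.
Proof.
move=> UV dF G H; rewrite -(dF _ H) -(dF G H); congr F.
apply/setP => x; rewrite !in_mix; case: ifP => // xU.
by rewrite (subsetP UV).
Qed.

Lemma dep_mix (A : Type) U V (F : {set T} -> A) G H :
  dep V F -> [disjoint U & V] -> F (mix U G H) = F H.
Proof.
move=> dF UV; rewrite -(dF _ H) -(dF H H); congr F.
apply/setP => x; rewrite !in_mix; case: ifP => // xV.
by rewrite (disjointFl UV xV).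
Qed.

Lemma dep_op2 (A B C : Type) (op : A -> B -> C) U
    (F1 : {set T} -> A) (F2 : {set T} -> B) :
  dep U F1 -> dep U F2 -> dep U (fun G => op (F1 G) (F2 G)).
Proof. by move=> d1 d2 G H; rewrite d1 d2. Qed.

Lemma dep_op1 (A C : Type) (op : A -> C) U (F1 : {set T} -> A) :
  dep U F1 -> dep U (fun G => op (F1 G)).
Proof. by move=> d1 G H; rewrite d1. Qed.

Lemma dep_mem U (x : T) : x \in U -> dep U (fun G => x \in G).
Proof. by move=> xU G H; rewrite in_mix xU. Qed.
End Mix.

(** * Expectations under product Bernoulli weights *)

Section Bernoulli.
Variables (K : comNzRingType) (T : finType) (p : K).
Implicit Types (U V G H : {set T}) (F : {set T} -> K).

(** The weight takes values in any commutative ring, so that one set of lemmas serves real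
    expectations (at [p]) and complex ones (at [p%:C]). *)
Definition bw G : K := \prod_e (if e \in G then p else 1 - p).
Definition Ex F : K := \sum_G bw G * F G.

Lemma Ex_prod (phi : T -> bool -> K) :
  Ex (fun G => \prod_e phi e (e \in G)) =
  \prod_e (p * phi e true + (1 - p) * phi e false).
Proof.
rewrite bigA_distr /Ex; apply: eq_bigr => G _.
by rewrite /bw -big_split /=; apply: eq_bigr => e _; case: ifP.
Qed.

Lemma bw_sum : \sum_G bw G = 1.
Proof.
transitivity (Ex (fun G => \prod_(e : T) 1)).
  by apply: eq_bigr => G _; rewrite big1_eq mulr1.
by rewrite (Ex_prod (fun _ _ => 1)) big1 // => e _; rewrite !mulr1 addrC subrK.
Qed.

Lemma eq_Ex F1 F2 : F1 =1 F2 -> Ex F1 = Ex F2.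
Proof. by move=> h; apply: eq_bigr => G _; rewrite h. Qed.

Lemma Ex_cst c : Ex (fun _ => c) = c.
Proof. by rewrite /Ex -mulr_suml bw_sum mul1r. Qed.

Lemma ExD F1 F2 : Ex (fun G => F1 G + F2 G) = Ex F1 + Ex F2.
Proof. by rewrite /Ex -big_split; apply: eq_bigr => G _; rewrite mulrDr. Qed.

Lemma ExZ c F : Ex (fun G => c * F G) = c * Ex F.
Proof. by rewrite /Ex mulr_sumr; apply: eq_bigr => G _; rewrite mulrCA. Qed.

Lemma ExZr c F : Ex (fun G => F G * c) = Ex F * c.
Proof. by rewrite mulrC -ExZ; apply: eq_Ex => G; rewrite mulrC. Qed.

Lemma ExN F : Ex (fun G => - F G) = - Ex F.
Proof. by rewrite -mulN1r -ExZ; apply: eq_Ex => G; rewrite mulN1r. Qed.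

Lemma ExB F1 F2 : Ex (fun G => F1 G - F2 G) = Ex F1 - Ex F2.
Proof. by rewrite ExD ExN. Qed.

Lemma Ex_sum (I : Type) (r : seq I) (P : pred I) (F : I -> {set T} -> K) :
  Ex (fun G => \sum_(i <- r | P i) F i G) = \sum_(i <- r | P i) Ex (F i).
Proof.
by rewrite /Ex exchange_big; apply: eq_bigr => G _; rewrite mulr_sumr.
Qed.

Lemma Ex_swap (F : {set T} -> {set T} -> K) :
  Ex (fun G => Ex (F G)) = Ex (fun H => Ex (F^~ H)).
Proof.
rewrite /Ex; under eq_bigr do rewrite mulr_sumr.
rewrite exchange_big; apply: eq_bigr => H _; rewrite mulr_sumr.
by apply: eq_bigr => G _; rewrite mulrCA.
Qed.

(** Exchanging the [U]-coordinates of two independent copies only permutes the factors of their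
    joint weight; this makes resampling measure preserving. *)
Lemma bw_mix U G H : bw (mix U G H) * bw (mix U H G) = bw G * bw H.
Proof.
rewrite /bw -!big_split; apply: eq_bigr => e _ /=; rewrite !in_mix.
by case: (e \in U) => //; rewrite mulrC.
Qed.

(* Resampling the coordinates in [U] does not change the distribution. *)
Lemma Ex_resample U F : Ex F = Ex (fun H => Ex (fun G => F (mix U G H))).
Proof.
transitivity (\sum_(x : {set T} * {set T}) bw x.1 * bw x.2 * F x.1).
  rewrite -(pair_bigA _ (fun G H => bw G * bw H * F G)) /=; apply: eq_bigr => G _.
  by rewrite -mulr_suml -mulr_sumr bw_sum mulr1.
rewrite (reindex_onto (fun x => (mix U x.1 x.2, mix U x.2 x.1))
                      (fun x => (mix U x.1 x.2, mix U x.2 x.1))) /=; last first.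
  by move=> [G H] _ /=; rewrite !mixK.
rewrite (eq_bigl predT); last by move=> [G H] /=; rewrite !mixK eqxx.
rewrite -(pair_bigA _ (fun G H => bw (mix U G H) * bw (mix U H G) * F (mix U G H))) /=.
rewrite exchange_big; apply: eq_bigr => H _; rewrite /Ex mulr_sumr.
by apply: eq_bigr => G _; rewrite bw_mix mulrA (mulrC (bw G)).
Qed.

Lemma Ex_indep U F1 F2 : dep U F1 -> dep (~: U) F2 ->
  Ex (fun G => F1 G * F2 G) = Ex F1 * Ex F2.
Proof.
move=> d1 d2; rewrite (Ex_resample U).
transitivity (Ex (fun H => Ex F1 * F2 H)); last by rewrite ExZ.
apply: eq_Ex => H; rewrite -ExZr; apply: eq_Ex => G.
by rewrite d1 (dep_mix _ _ d2) // -setI_eq0 setICr.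
Qed.

(** Orthogonality: integrating out the coordinates in [U] kills [F1], while [F2] is constant along
    them. *)
Lemma Ex_avg0 U F1 F2 : (forall H, Ex (fun G => F1 (mix U G H)) = 0) ->
  dep (~: U) F2 -> Ex (fun G => F1 G * F2 G) = 0.
Proof.
move=> h d2; rewrite (Ex_resample U) -(Ex_cst 0); apply: eq_Ex => H.
transitivity (Ex (fun G => F1 (mix U G H) * F2 H)); last by rewrite ExZr h mul0r.
apply: eq_Ex => G; by rewrite (dep_mix _ _ d2) // -setI_eq0 setICr.
Qed.

Lemma Ex_two (e : T) F : Ex (fun G => F (mix [set e] G set0)) =
  p * F [set e] + (1 - p) * F set0.
Proof.
pose ph x (b : bool) := if x == e then (if b then F [set e] else F set0) else 1.
transitivity (Ex (fun G => \prod_x ph x (x \in G))).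
  apply: eq_Ex => G; rewrite (bigD1 e) //= big1 ?mulr1; last first.
    by move=> x xe; rewrite /ph (negPf xe).
  rewrite /ph eqxx; case: ifP => eG; congr F; apply/setP => x;
  rewrite in_mix !inE; case: eqP => // ->; by rewrite eG.
rewrite Ex_prod (bigD1 e) //= big1 /ph ?eqxx ?mulr1 // => x xe.
by rewrite (negPf xe) !mulr1 addrC subrK.
Qed.

Lemma Ex_one (e : T) F H : Ex (fun G => F (mix [set e] G H)) =
  p * F (e |: H) + (1 - p) * F (H :\ e).
Proof.
have := Ex_two e (fun G => F (mix [set e] G H)).
rewrite (_ : mix [set e] [set e] H = e |: H); last first.
  by apply/setP => x; rewrite in_mix !inE; case: eqP.
rewrite (_ : mix [set e] set0 H = H :\ e); last first.
  by apply/setP => x; rewrite in_mix !inE; case: eqP.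
move=> <-; apply: eq_Ex => G; congr F; apply/setP => x.
by rewrite !in_mix; case: (x \in [set e]).
Qed.

Lemma Ex_mono (A : {set T}) : Ex (fun G => (A \subset G)%:R) = p ^+ #|A|.
Proof.
pose ph x (b : bool) : K := if x \in A then b%:R else 1.
transitivity (Ex (fun G => \prod_x ph x (x \in G))).
  apply: eq_Ex => G; rewrite /ph.
  case: (boolP (A \subset G)) => [/subsetP AG|/subsetPn [x xA xG]].
    by rewrite big1 // => x _; case: ifP => // /AG ->.
  by rewrite (bigD1 x) //= xA (negPf xG) mul0r.
rewrite Ex_prod (bigID (mem A)) /= [X in _ * X]big1 ?mulr1; last first.
  by move=> x xA; rewrite /ph (negPf xA) !mulr1 addrC subrK.
rewrite -prodr_const; apply: eq_bigr => x xA.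
by rewrite /ph xA mulr1 mulr0 addr0.
Qed.
End Bernoulli.

Notation nc := ComplexField.Normc.normc.

(** * Exponential moments under bounded differences *)

Section RealBernoulli.
Variables (R : realType) (T : finType) (p : R).
Hypotheses (p0 : 0 <= p) (p1 : p <= 1).
Implicit Types (U V G H : {set T}) (F : {set T} -> R).

Lemma bw_ge0 G : 0 <= bw p G.
Proof. by apply: prodr_ge0 => e _; case: ifP => _; rewrite ?subr_ge0. Qed.

Lemma ler_Ex F1 F2 : (forall G, F1 G <= F2 G) -> Ex p F1 <= Ex p F2.
Proof. by move=> h; apply: ler_sum => G _; rewrite ler_wpM2l ?bw_ge0. Qed.

Lemma Ex_ge0 F : (forall G, 0 <= F G) -> 0 <= Ex p F.
Proof. by move=> h; apply: sumr_ge0 => G _; rewrite mulr_ge0 ?bw_ge0. Qed.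

Lemma Ex_le_cst F c : (forall G, F G <= c) -> Ex p F <= c.
Proof. by move=> h; rewrite -[leRHS](Ex_cst T p); apply: ler_Ex. Qed.

Lemma norm_Ex F : `|Ex p F| <= Ex p (fun G => `|F G|).
Proof.
apply: le_trans (ler_norm_sum _ _ _) _; apply: ler_sum => G _.
by rewrite normrM (ger0_norm (bw_ge0 _)).
Qed.

Lemma Ex_sqr F : Ex p F ^+ 2 <= Ex p (fun G => F G ^+ 2).
Proof.
have : 0 <= Ex p (fun G => (F G - Ex p F) ^+ 2) by apply: Ex_ge0 => G; exact: sqr_ge0.
rewrite (@eq_Ex _ _ _ _ (fun G => F G ^+ 2 - (2 * Ex p F) * F G + Ex p F ^+ 2)); last first.
  by move=> G; ring.
rewrite ExD ExB ExZ Ex_cst; set a := Ex p F; set b := Ex p _ => h.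
by rewrite -subr_ge0; apply: le_trans h _; rewrite le_eqVlt; apply/orP; left; apply/eqP; ring.
Qed.

(** For a centred variable the linear term averages out, which leaves a sub-Gaussian moment bound.
    On |x| < 1/2 the inequality comes from e^x <= 1/(1-x) <= 1 + x + 2x^2. *)
Lemma expR_le_expR_sqr (x : R) : expR x <= x + expR (2 * x ^+ 2).
Proof.
have h2 := expR_ge1Dx (2 * x ^+ 2).
have h0 := sqr_ge0 x; rewrite expr2 in h0 h2 *.
have [xs|xs] := lerP (1/2) x.
  have : expR x <= expR (2 * (x * x)) by rewrite ler_expR; nra.
  by lra.
have [ys|ys] := lerP x (-(1/2)).
  have : expR x <= 1 by rewrite -expR0 ler_expR; lra.
  nra.
suff : expR x <= 1 + x + 2 * (x * x) by lra.
have h3 := expR_ge1Dx (- x); rewrite expRN in h3.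
have e0 := expR_gt0 x.
have : (1 - x) * expR x <= 1.
  have := ler_wpM2r (ltW e0) h3; rewrite mulVf ?gt_eqF //; lra.
by move=> h4; nra.
Qed.

Lemma two_point_subgaussian (a b c lam : R) : `|a - b| <= c ->
  p * expR (lam * (a - (p * a + (1 - p) * b)))
  + (1 - p) * expR (lam * (b - (p * a + (1 - p) * b)))
  <= expR (2 * lam ^+ 2 * c ^+ 2).
Proof.
move=> hc; set mu := p * a + (1 - p) * b.
have c0 : 0 <= c by apply: le_trans hc.
have key x : `|x| <= c -> expR (lam * x) <= lam * x + expR (2 * lam ^+ 2 * c ^+ 2).
  move=> hx; apply: le_trans (expR_le_expR_sqr _) _; rewrite lerD2l ler_expR.
  rewrite exprMn mulrA; apply: ler_wpM2l; first by rewrite mulr_ge0 ?sqr_ge0.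
  by rewrite -[x ^+ 2]real_normK ?num_real // lerXn2r ?nnegrE.
have ha : `|a - mu| <= c.
  apply: le_trans hc; rewrite (_ : a - mu = (1 - p) * (a - b)) /mu; last by ring.
  by rewrite normrM ger0_norm ?subr_ge0 // ler_piMl // gerBl.
have hb : `|b - mu| <= c.
  apply: le_trans hc; rewrite (_ : b - mu = - (p * (a - b))) /mu; last by ring.
  by rewrite normrN normrM ger0_norm // ler_piMl.
have k1 := key _ ha; have k2 := key _ hb.
have l1 := ler_wpM2l p0 k1; have q0 : 0 <= 1 - p by rewrite subr_ge0.
have l2 := ler_wpM2l q0 k2.
apply: le_trans (lerD l1 l2) _; rewrite le_eqVlt; apply/orP; left; apply/eqP.
by rewrite /mu; ring.
Qed.

Lemma mix_setU1 (e : T) U G G' H : e \notin U ->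
  mix (e |: U) (mix [set e] G' G) H = mix U G (mix [set e] G' H).
Proof.
move=> eU; apply/setP => x; rewrite !in_mix !inE.
by case: eqP => [->|_] //=; rewrite (negPf eU).
Qed.

Lemma mcdiarmid_mix F (c : T -> R) (lam : R) U :
  (forall G e, `|F (e |: G) - F (G :\ e)| <= c e) ->
  forall H, Ex p (fun G => expR (lam * (F (mix U G H) - Ex p (fun G => F (mix U G H)))))
    <= expR (2 * lam ^+ 2 * \sum_(e in U) c e ^+ 2).
Proof.
move=> hc; have [n] := ubnP #|U|; elim: n U => // n IH U ltU H.
have [->|[e eU]] := set_0Vmem U.
  rewrite big_set0 mulr0; apply: Ex_le_cst => G; rewrite mix0.
  by rewrite (eq_Ex _ (F2 := fun=> F H)) ?Ex_cst ?subrr ?mulr0 // => ?; rewrite mix0.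
have eD : e \notin U :\ e by rewrite !inE eqxx.
have UE : U = e |: (U :\ e) by rewrite setD1K.
have ltD : (#|U :\ e| < n)%N by move: ltU; rewrite (cardsD1 e U) eU; lia.
set V := U :\ e in eD UE ltD.
pose A H' := Ex p (fun G => F (mix V G H')).
have mixE G' G : mix U (mix [set e] G' G) H = mix V G (mix [set e] G' H).
  by rewrite UE mix_setU1.
have avgE : Ex p (fun G => F (mix U G H)) = p * A (e |: H) + (1 - p) * A (H :\ e).
  rewrite (Ex_resample p [set e]) Ex_swap -(Ex_one p e A).
  by apply: eq_Ex => G'; apply: eq_Ex => G; rewrite mixE.
have hA : `|A (e |: H) - A (H :\ e)| <= c e.
  rewrite /A -ExB; apply: le_trans (norm_Ex _) _; apply: Ex_le_cst => G.
  rewrite (_ : mix V G (e |: H) = e |: mix V G H); last first.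
    by apply/setP => x; rewrite !(in_mix, inE); case: eqP => [->|_] //=; rewrite (negPf eD).
  rewrite (_ : mix V G (H :\ e) = mix V G H :\ e) //.
  by apply/setP => x; rewrite !(in_mix, inE); case: eqP => [->|_] //=; rewrite (negPf eD).
have tp := two_point_subgaussian lam hA.
have -> : \sum_(x in U) c x ^+ 2 = c e ^+ 2 + \sum_(x in V) c x ^+ 2.
  by rewrite {1}UE big_setU1.
rewrite avgE; set mu := p * A (e |: H) + (1 - p) * A (H :\ e) in tp *.
rewrite (Ex_resample p [set e]) Ex_swap.
apply: (@le_trans _ _ (Ex p (fun G' => expR (lam * (A (mix [set e] G' H) - mu))
   * expR (2 * lam ^+ 2 * \sum_(x in V) c x ^+ 2)))).
  apply: ler_Ex => G'.
  apply: le_trans (ler_wpM2l (expR_ge0 _) (IH V ltD (mix [set e] G' H))).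
  rewrite -[leRHS]ExZ; apply: ler_Ex => G; rewrite mixE -expRD ler_expR /A.
  by rewrite le_eqVlt; apply/orP; left; apply/eqP; ring.
rewrite ExZr (Ex_one p e (fun X => expR (lam * (A X - mu)))) [leRHS](_ : _ = expR (2 * lam ^+ 2 * c e ^+ 2) * expR (2 * lam ^+ 2 * \sum_(x in V) c x ^+ 2)); last by rewrite -expRD -mulrDr.
by rewrite ler_wpM2r ?expR_ge0.
Qed.

Lemma mcdiarmid F (c : T -> R) (lam : R) :
  (forall G e, `|F (e |: G) - F (G :\ e)| <= c e) ->
  Ex p (fun G => expR (lam * (F G - Ex p F))) <= expR (2 * lam ^+ 2 * \sum_e c e ^+ 2).
Proof.
move=> hc; have := mcdiarmid_mix lam setT hc set0.
have mE G : mix setT G set0 = G by apply/setP => x; rewrite in_mix inE.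
rewrite (eq_bigl predT); last by move=> x; rewrite inE.
move=> /(le_trans _); apply; apply: ler_Ex => G; rewrite mE.
by rewrite (eq_Ex p (F2 := F)) // => G'; rewrite mE.
Qed.

(* A quantity bounded by 1, and by [be] wherever [Y] is at least half its mean. *)
Lemma mcdiarmid_lower (Y B : {set T} -> R) (c : T -> R) (lam be : R) :
  0 <= lam -> 0 <= be ->
  (forall G e, `|Y (e |: G) - Y (G :\ e)| <= c e) ->
  (forall G, B G <= 1) -> (forall G, Ex p Y / 2 <= Y G -> B G <= be) ->
  Ex p B <= be + expR (2 * lam ^+ 2 * \sum_e c e ^+ 2 - lam * (Ex p Y / 2)).
Proof.
move=> l0 be0 hc B1 hB; set mu := Ex p Y in hB *.
apply: (@le_trans _ _ (Ex p (fun G => be + expR (- (lam * (mu / 2))) *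
    expR (- lam * (Y G - mu))))).
  apply: ler_Ex => G; have [h|h] := lerP (mu / 2) (Y G).
    by apply: le_trans (hB _ h) _; rewrite lerDl mulr_ge0 ?expR_ge0.
  apply: le_trans (B1 G) _; apply: le_trans (_ : expR 0 <= _); first by rewrite expR0.
  apply: ler_wpDl => //; rewrite -expRD ler_expR; nra.
rewrite ExD Ex_cst ExZ lerD2l addrC expRD ler_wpM2l ?expR_ge0 //.
by apply: le_trans (mcdiarmid (- lam) hc) _; rewrite sqrrN.
Qed.
End RealBernoulli.

(** * Complex expectations *)

Section ComplexBernoulli.
Variables (R : realType) (T : finType) (p : R).
Hypotheses (p0 : 0 <= p) (p1 : p <= 1).
Implicit Types (U V G H : {set T}).

Lemma bw_real G : bw p%:C G = (bw p G)%:C.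
Proof.
rewrite /bw rmorph_prod; apply: eq_bigr => e _.
by case: ifP => _ //; rewrite rmorphB.
Qed.

Lemma Ex_real (F : {set T} -> R) : (Ex p F)%:C = Ex p%:C (fun G => (F G)%:C).
Proof. by rewrite /Ex rmorph_sum; apply: eq_bigr => G _; rewrite rmorphM bw_real. Qed.

Lemma normc_sum (I : Type) (r : seq I) (P : pred I) (F : I -> R[i]) :
  nc (\sum_(i <- r | P i) F i) <= \sum_(i <- r | P i) nc (F i).
Proof.
elim/big_ind2: _ => [|x1 x2 y1 y2 h1 h2|//].
  by rewrite ComplexField.Normc.normc0.
by apply: le_trans (le_normcD _ _) _; rewrite lerD.
Qed.

Lemma normc_real (x : R) : nc x%:C = `|x|.
Proof. by rewrite /= expr0n addr0 sqrtr_sqr. Qed.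

Lemma normc_ge0 (x : R[i]) : 0 <= nc x.
Proof. by case: x => a b; exact: sqrtr_ge0. Qed.

Lemma normc_Ex (F : {set T} -> R[i]) : nc (Ex p%:C F) <= Ex p (fun G => nc (F G)).
Proof.
apply: le_trans (normc_sum _ _ _) _; apply: ler_sum => G _.
by rewrite ComplexField.Normc.normcM bw_real normc_real ger0_norm ?bw_ge0.
Qed.
End ComplexBernoulli.

(** * The function e^(ix) and its Taylor polynomials *)

Section Expi.
Variable R : realType.
Implicit Types x y : R.

Lemma expiD x y : expi (x + y) = expi x * expi y.
Proof.
rewrite /expi cosD sinD; apply/eqP; rewrite eq_complex /=; apply/andP; split=> //.
by rewrite addrC mulrC [sin y * _]mulrC.
Qed.

Lemma expi0 : expi (0 : R) = 1.
Proof. by rewrite /expi cos0 sin0. Qed.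

Lemma conj_expi x : conjc (expi x) = expi (- x).
Proof. by rewrite /expi cosN sinN. Qed.

Lemma normc_expi x : nc (expi x) = 1.
Proof. by rewrite /= cos2Dsin2 sqrtr1. Qed.

Lemma expi_sum (I : Type) (r : seq I) (P : pred I) (F : I -> R) :
  expi (\sum_(i <- r | P i) F i) = \prod_(i <- r | P i) expi (F i).
Proof.
elim/big_ind2: _ => [|x1 x2 y1 y2 h1 h2|//]; first by rewrite expi0.
by rewrite expiD h1 h2.
Qed.

Lemma normc_sqr (z : R[i]) : (nc z ^+ 2)%:C = z * conjc z.
Proof.
case: z => a b /=; rewrite sqr_sqrtr ?addr_ge0 ?sqr_ge0 //.
apply/eqP; rewrite eq_complex /=; apply/andP; split; apply/eqP; ring.
Qed.
End Expi.

Section ExpiTaylor.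
Variable R : realType.
Implicit Types x y : R.

Lemma is_derive_horner (q : {poly R}) x : is_derive x 1 (horner q) (q^`()).[x].
Proof.
have := @derivable_horner R q x => h; apply: DeriveDef => //.
by rewrite -derive1E -derive.derivE.
Qed.

(** Integration of a derivative bound: x^(J+1)/(J+1)! minus f (or plus f) vanishes at 0 and has
    nonnegative derivative for x >= 0. This is the inductive step of the Taylor estimate. *)
Lemma powers_bound (f df : R -> R) (J : nat) :
  (forall x : R, is_derive x 1 f (df x)) -> f 0 = 0 ->
  (forall x, 0 <= x -> `|df x| <= x ^+ J / J`!%:R) ->
  forall x, 0 <= x -> `|f x| <= x ^+ J.+1 / J.+1`!%:R.
Proof.
move=> fdf f0 hdf.
have main (g dg : R -> R) : (forall x : R, is_derive x 1 g (dg x)) -> g 0 = 0 ->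
    (forall x, 0 <= x -> dg x <= x ^+ J / J`!%:R) ->
    forall x, 0 <= x -> g x <= x ^+ J.+1 / J.+1`!%:R.
  move=> gdg g0 hdg x x0.
  pose q : {poly R} := (J.+1`!%:R)^-1 *: 'X^(J.+1).
  pose h := horner q - g; pose dh y := (q^`()).[y] - dg y.
  have hd y : is_derive y 1 h (dh y).
    have := gdg y => gy; have := is_derive_horner q y => qy.
    exact: is_deriveB.
  have [c /andP[c0 _] hE] : exists2 c, c \in `[0, x]%R & h x - h 0 = dh c * (x - 0).
    apply: MVT_segment => //; apply: derivable_within_continuous => y _.
    by have [] := hd y.
  have : 0 <= h x.
    have h0 : h 0 = 0 by rewrite /h !fctE g0 hornerZ hornerXn expr0n mulr0 subr0.
    have -> : h x = h x - h 0 by rewrite h0 subr0.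
    rewrite hE mulr_ge0 ?subr0 // /dh subr_ge0 derivZ derivXn hornerZ.
    rewrite hornerMn hornerXn /= -mulr_natl.
    apply: le_trans (hdg c c0) _; rewrite factS natrM le_eqVlt; apply/orP; left.
    apply/eqP; rewrite mulrC; field.
    by rewrite nat1r !pnatr_eq0 -lt0n fact_gt0.
  by rewrite /h !fctE subr_ge0 hornerZ hornerXn mulrC.
move=> x x0; rewrite ler_norml; apply/andP; split.
  rewrite lerNl; apply: (main (fun y => - f y) (fun y => - df y)) => //.
  - by rewrite f0 oppr0.
  - by move=> y y0; apply: le_trans (hdf y y0); rewrite -normrN ler_norm.
by apply: (main f df) => // y y0; apply: le_trans (hdf y y0); rewrite ler_norm.
Qed.

(** Real and imaginary parts of i^j, so that [PRe J] and [PIm J] are those of the Taylor polynomial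
    of e^(ix) with [J] terms. *)
Fixpoint iRe (j : nat) : R := if j is j'.+1 then - iIm j' else 1
with iIm (j : nat) : R := if j is j'.+1 then iRe j' else 0.

Definition PRe J : {poly R} := \sum_(j < J) (iRe j / j`!%:R) *: 'X^j.
Definition PIm J : {poly R} := \sum_(j < J) (iIm j / j`!%:R) *: 'X^j.

Lemma deriv_PRe J : (PRe J.+1)^`() = - PIm J.
Proof.
rewrite /PRe /PIm raddf_sum big_ord_recl /= expr0 alg_polyC derivC add0r -sumrN.
apply: eq_bigr => j _; rewrite /bump /= add1n derivZ derivXn /= -scalerMnr -scaler_nat scalerA -scaleNr.
congr (_ *: _); rewrite factS natrM; field.
by rewrite nat1r !pnatr_eq0 -lt0n fact_gt0.
Qed.

Lemma deriv_PIm J : (PIm J.+1)^`() = PRe J.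
Proof.
rewrite /PRe /PIm raddf_sum big_ord_recl /= expr0 alg_polyC derivC add0r.
apply: eq_bigr => j _; rewrite /bump /= add1n derivZ derivXn /= -scalerMnr -scaler_nat scalerA.
congr (_ *: _); rewrite factS natrM; field.
by rewrite nat1r !pnatr_eq0 -lt0n fact_gt0.
Qed.

Lemma cos_sin_taylor J x : 0 <= x ->
  `|cos x - (PRe J).[x]| <= x ^+ J / J`!%:R /\ `|sin x - (PIm J).[x]| <= x ^+ J / J`!%:R.
Proof.
elim: J x => [|J IH] x x0.
  rewrite /PRe /PIm !big_ord0 !horner0 !subr0 fact0 divr1 expr0.
  by split; [exact: cos_max | exact: sin_max].
split.
  apply: (powers_bound (f := fun y => cos y - (PRe J.+1).[y])
    (df := fun y => - (sin y - (PIm J).[y]))) => //.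
  - move=> y; have := is_derive_horner (PRe J.+1) y; rewrite deriv_PRe => h.
    by apply: is_derive_eq; rewrite hornerN; ring.
  - rewrite cos0 /PRe horner_sum big_ord_recl big1 /=; last first.
      by move=> j _; rewrite hornerZ hornerXn expr0n mulr0.
    by rewrite hornerZ hornerXn expr0 fact0 divr1 !mulr1 addr0 subrr.
  - by move=> y y0; rewrite normrN; case: (IH y y0).
apply: (powers_bound (f := fun y => sin y - (PIm J.+1).[y])
  (df := fun y => cos y - (PRe J).[y])) => //.
- move=> y; have := is_derive_horner (PIm J.+1) y; rewrite deriv_PIm => h.
  by apply: is_derive_eq.
- rewrite sin0 /PIm horner_sum big_ord_recl big1 /=; last first.
    by move=> j _; rewrite hornerZ hornerXn expr0n mulr0.
  by rewrite hornerZ !mul0r addr0 subr0.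
- by move=> y y0; case: (IH y y0).
Qed.

Definition expi_poly J x : R[i] := \sum_(j < J) ('i * x%:C) ^+ j / (j`!)%:R.

Lemma exprIi j : 'i%C ^+ j = iRe j +i* iIm j :> R[i].
Proof.
elim: j => [|j IH]; first by rewrite expr0.
rewrite exprS IH; apply/eqP; rewrite eq_complex /=.
by rewrite !(mul0r, mul1r) sub0r add0r !eqxx.
Qed.

Lemma expi_polyE J x : expi_poly J x = (PRe J).[x] +i* (PIm J).[x].
Proof.
rewrite /expi_poly /PRe /PIm !horner_sum.
have -> : (\sum_(i < J) ((iRe i / i`!%:R) *: 'X^i).[x]) +i* (\sum_(i < J) ((iIm i / i`!%:R) *: 'X^i).[x])
   = \sum_(i < J) (((iRe i / i`!%:R) *: 'X^i).[x] +i* ((iIm i / i`!%:R) *: 'X^i).[x]).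
  by elim/big_rec3: _ => // i a b c _ <-.
apply: eq_bigr => j _; rewrite exprMn exprIi !hornerZ hornerXn -rmorphXn.
have -> : (j`!%:R)^-1 = (j`!%:R^-1 : R)%:C :> R[i] by rewrite fmorphV rmorph_nat.
apply/eqP; rewrite eq_complex /= !(mulr0, mul0r, subr0, addr0, add0r).
by apply/andP; split; apply/eqP; ring.
Qed.

Lemma normc_le_add (a b : R) : nc (a +i* b) <= `|a| + `|b|.
Proof.
rewrite /= -[leRHS]ger0_norm ?addr_ge0 // -sqrtr_sqr ler_sqrt ?sqr_ge0 //.
rewrite sqrrD !real_normK ?num_real // -addrA [X in _ <= _ + X]addrC lerD2l lerDl.
by rewrite mulrn_wge0 ?mulr_ge0.
Qed.

Lemma expi_taylor J x : nc (expi x - expi_poly J x) <= 2 * (`|x| ^+ J / J`!%:R).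
Proof.
wlog x0 : x / 0 <= x.
  move=> h; have [x0|x0] := lerP 0 x; first exact: h.
  have := h (- x); rewrite oppr_ge0 normrN => /(_ (ltW x0)).
  suff -> : expi (- x) - expi_poly J (- x) = (expi x - expi_poly J x)^*.
    by case: (expi x - _) => a b /=; rewrite sqrrN.
  have -> : (expi x - expi_poly J x)^*%C = (expi x)^*%C - (expi_poly J x)^*%C by exact: rmorphB.
  rewrite conj_expi; congr (_ - _).
  rewrite /expi_poly rmorph_sum; apply: eq_bigr => j _.
  rewrite rmorphM rmorphXn /= fmorphV rmorph_nat; congr (_ ^+ _ * _).
  by apply/eqP; rewrite eq_complex /=; apply/andP; split; apply/eqP; ring.
have [h1 h2] := cos_sin_taylor J x0.
rewrite expi_polyE (_ : _ - _ = (cos x - (PRe J).[x]) +i* (sin x - (PIm J).[x])) //.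
apply: le_trans (normc_le_add _ _) _; rewrite (ger0_norm x0); lra.
Qed.

Lemma one_sub_cos_ge x : `|x| <= pi -> x ^+ 2 / 16 <= 1 - cos x.
Proof.
wlog x0 : x / 0 <= x.
  move=> h hx; have [x0|x0] := lerP 0 x; first exact: h.
  by have := h (- x); rewrite sqrrN cosN normrN; apply => //; rewrite oppr_ge0 ltW.
rewrite ger0_norm // => xpi; have pi4 := @pihalf_lt2 R.
(* Up to 2 the bound cos x <= 1 - x^2/2 + x^4/24 suffices; beyond 2 > pi/2 the cosine is nonpositive
   while x^2 <= 16. *)
have [x2|x2] := lerP x 2.
  have [] := cos_sin_taylor 4 x0; rewrite /PRe !big_ord_recr big_ord0 /= => h _.
  have f4 : (4`!)%:R = 24 :> R by [].
  move: h; rewrite f4 !hornerE /= !factS fact0 /= ler_norml => /andP[_].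
  rewrite ?oppr0 ?mul0r ?oppr0 ?mul0r invr1 => h.
  have h' : cos x <= 1 - x * x / 2 + (x * x) * (x * x) / 24.
    move: h; rewrite (_ : x ^+ 4 = (x * x) * (x * x)); last by ring.
    by lra.
  have z0 : 0 <= x * x by rewrite mulr_ge0.
  have z4 : x * x <= 4 by nra.
  rewrite expr2; move: (x * x) z0 z4 h' => z z0 z4; nra.
have : cos x <= 0.
  rewrite -cos_pihalf leNgt; apply/negP => h.
  have := @ltr_cos R x (pi / 2); rewrite !in_itv /= x0 xpi h => /(_ isT).
  have -> : (0 <= (pi / 2 : R) <= pi) by have := @pi_gt0 R; move=> ?; apply/andP; split; lra.
  move=> /(_ isT); lra.
nra.
Qed.
End ExpiTaylor.

(** * Monomials: indicators that an edge set is present *)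

Section Mono.
Variables (R : realType) (T : finType).
Implicit Types (U V G H F : {set T}).

Definition mono F H : R := (F \subset H)%:R.

Lemma mono_ge0 F H : 0 <= mono F H.
Proof. exact: ler0n. Qed.

Lemma mono_le1 F H : mono F H <= 1.
Proof. by rewrite /mono; case: (_ \subset _). Qed.

Lemma monoU F F' H : mono (F :|: F') H = mono F H * mono F' H.
Proof. by rewrite /mono subUset -natrM mulnb. Qed.

Lemma monoID F U H : mono F H = mono (F :&: U) H * mono (F :\: U) H.
Proof. by rewrite -monoU setID. Qed.

Lemma dep_mono F : dep F (mono F).
Proof.
move=> G H; congr ((_ : bool)%:R); apply/subsetP/subsetP => h x xF; have := h x xF;
by rewrite in_mix xF.
Qed.

Lemma mono_mix F U G H : mono F (mix U G H) = mono (F :&: U) G * mono (F :\: U) H.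
Proof.
rewrite (monoID F U (mix U G H)); congr (_ * _).
  by apply: (dep_sub _ (@dep_mono (F :&: U))); rewrite subsetIr.
by apply: (dep_mix _ _ (@dep_mono _)); rewrite disjoint_sym -setI_eq0 setIDAC -setIDA setDv setI0.
Qed.
End Mono.

(** * Decoupling by Cauchy-Schwarz *)

Section Decoupling.
Variables (R : realType) (T : finType) (p : R).
Hypotheses (p0 : 0 <= p) (p1 : p <= 1).
Implicit Types (U V G H F : {set T}) (l : seq ({set T} * {set T})).

Definition dl U G (f : {set T} -> R) H := f H - f (mix U G H).
Fixpoint dls l f := if l is x :: l' then dl x.1 x.2 (dls l' f) else f.
Definition cov l : {set T} := \bigcup_(x <- l) x.1.
Definition disj l := pairwise (fun x y : {set T} * {set T} => [disjoint x.1 & y.1]) l.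

(** Average over the [U]-coordinates inside, apply Cauchy-Schwarz to the outer average, and expand
    the squared modulus over two copies of those coordinates. The phases subtract, and the second
    copy [G] is frozen at its worst value. Whatever part of [f] ignores [U] cancels in the
    difference. *)
Lemma decouple1 (f : {set T} -> R) U be :
  (forall G, nc (Ex p%:C (fun H => expi (dl U G f H))) <= be) ->
  nc (Ex p%:C (fun H => expi (f H))) ^+ 2 <= be.
Proof.
move=> hbe; rewrite (Ex_resample p%:C U).
pose w H := Ex p%:C (fun G => expi (f (mix U G H))).
have step : nc (Ex p%:C w) ^+ 2 <= Ex p (fun H => nc (w H) ^+ 2).
  apply: le_trans (Ex_sqr p0 p1 _).
  by rewrite lerXn2r ?nnegrE ?normc_ge0 ?normc_Ex // (le_trans (normc_ge0 _) (normc_Ex p0 p1 _)).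
apply: le_trans step _.
have key : (Ex p (fun H => nc (w H) ^+ 2))%:C =
    Ex p%:C (fun G => Ex p%:C (fun H => expi (dl U G f H))).
  rewrite Ex_real.
  transitivity (Ex p%:C (fun H => Ex p%:C (fun G => Ex p%:C (fun G1 =>
     expi (dl U G f (mix U G1 H)))))); last first.
    by rewrite Ex_swap; apply: eq_Ex => G; rewrite [RHS](Ex_resample p%:C U).
  apply: eq_Ex => H; rewrite normc_sqr.
  have -> : conjc (w H) = Ex p%:C (fun G => expi (- f (mix U G H))).
    rewrite /w /Ex rmorph_sum; apply: eq_bigr => G _.
    rewrite rmorphM bw_real -conj_expi; congr (_ * _); exact: conjc_real.
  rewrite -ExZ; apply: eq_Ex => G; rewrite -ExZr; apply: eq_Ex => G1.
  by rewrite /dl mix_absorb -expiD.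
have le1 : Ex p (fun H => nc (w H) ^+ 2) <= nc (Ex p (fun H => nc (w H) ^+ 2))%:C.
  by rewrite normc_real ler_norm.
apply: le_trans le1 _; rewrite key.
by apply: le_trans (normc_Ex p0 p1 _) _; apply: Ex_le_cst.
Qed.

(** Each block costs one squaring, whence the exponent. The induction hypothesis is used with
    [Num.sqrt be], a bound which one more decoupling step supplies. *)
Lemma decouple (f : {set T} -> R) (Us : seq {set T}) be :
  (forall Gs, size Gs = size Us ->
     nc (Ex p%:C (fun H => expi (dls (zip Us Gs) f H))) <= be) ->
  nc (Ex p%:C (fun H => expi (f H))) ^+ (2 ^ size Us) <= be.
Proof.
elim: Us be => [|U Us IH] be hbe /=; first by rewrite expn0 expr1; apply: (hbe [::]).
rewrite expnSr exprM; set x := nc _.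
have be0 : 0 <= be.
  by apply: le_trans (hbe (nseq (size Us).+1 set0) _); rewrite ?normc_ge0 ?size_nseq.
rewrite -[leRHS]sqr_sqrtr // lerXn2r ?nnegrE ?sqrtr_ge0 ?exprn_ge0 ?normc_ge0 //.
apply: IH => Gs sGs; rewrite -(@ler_pXn2r _ 2) ?nnegrE ?sqrtr_ge0 ?normc_ge0 //.
rewrite sqr_sqrtr //; apply: (@decouple1 _ U) => G.
by have := hbe (G :: Gs); rewrite /= sGs; apply.
Qed.

Lemma disj_cov U l : all (fun y : {set T} * {set T} => [disjoint U & y.1]) l -> [disjoint U & cov l].
Proof.
rewrite /cov; elim: l => [|x l IH] /=; first by rewrite big_nil -setI_eq0 setI0.
by case/andP => h1 h2; rewrite big_cons -setI_eq0 setIUr setU_eq0 !setI_eq0 h1 IH.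
Qed.

(** A monomial factors over disjoint blocks and each difference acts on the factor of its own block
    only. In particular everything vanishes when [F] misses a block, where the factor is 1 - 1. *)
Lemma dls_mono l F H : disj l ->
  dls l (mono R F) H = mono R (F :\: cov l) H *
     \prod_(x <- l) (mono R (F :&: x.1) H - mono R (F :&: x.1) x.2).
Proof.
elim: l H => [|[U G] l IH] H /=.
  by rewrite /cov !big_nil setD0 mulr1.
case/andP => hU hl; have dU := disj_cov hU.
rewrite /dl !IH //= /cov !big_cons -/(cov l) /=.
have -> : \prod_(x <- l) (mono R (F :&: x.1) (mix U G H) - mono R (F :&: x.1) x.2) =
          \prod_(x <- l) (mono R (F :&: x.1) H - mono R (F :&: x.1) x.2).
  rewrite !big_seq; apply: eq_bigr => x xl; congr (_ - _).
  apply: (dep_mix _ _ (dep_sub _ (@dep_mono R T _))); first by apply: subsetIr.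
  exact: (allP hU).
rewrite mono_mix (monoID R (F :\: cov l) U H).
have -> : (F :\: cov l) :&: U = F :&: U.
  apply/setP => x; rewrite !inE; case: (boolP (x \in U)) => xU; rewrite ?andbF // !andbT.
  by rewrite (disjointFr dU xU).
have -> : (F :\: cov l) :\: U = F :\: (U :|: cov l) by rewrite setDDl setUC.
ring.
Qed.

Lemma dls_sum (I : Type) (r : seq I) (P : pred I) (w : I -> R) (f : I -> {set T} -> R) l H :
  dls l (fun H => \sum_(i <- r | P i) w i * f i H) H =
  \sum_(i <- r | P i) w i * dls l (f i) H.
Proof.
elim: l H => [|[U G] l IH] H //=.
by rewrite /dl !IH -sumrB; apply: eq_bigr => i _; rewrite mulrBr.
Qed.

Lemma dls_scale (s : R) f l H : dls l (fun H => s * f H) H = s * dls l f H.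
Proof. by elim: l H => [|[U G] l IH] H //=; rewrite /dl !IH mulrBr. Qed.

Lemma eq_dls f1 f2 l : f1 =1 f2 -> dls l f1 =1 dls l f2.
Proof. by move=> h; elim: l => [|[U G] l IH] H //=; rewrite /dl !IH. Qed.

(* Testing against functions of mean zero in each block kills the resampled terms. *)
Lemma Ex_dls_test (psi : {set T} -> {set T} -> R) f l (X : {set T} -> R) :
  disj l -> (forall x, x \in l -> dep x.1 (psi x.1) /\ Ex p (psi x.1) = 0) ->
  dep (~: cov l) X ->
  Ex p (fun H => dls l f H * ((\prod_(x <- l) psi x.1 H) * X H)) =
  Ex p (fun H => f H * ((\prod_(x <- l) psi x.1 H) * X H)).
Proof.
elim: l X => [|[U G] l IH] X //= /andP[hU hl] hpsi dX; have dU := disj_cov hU.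
have [/= dpsi psi0] := hpsi (U, G) (mem_head _ _).
have hpsi' x : x \in l -> dep x.1 (psi x.1) /\ Ex p (psi x.1) = 0.
  by move=> xl; apply: hpsi; rewrite inE xl orbT.
rewrite /cov big_cons -/(cov l) /= in dX.
have dXU : dep (~: U) X.
  by apply: (dep_sub _ dX); rewrite setCS subsetUl.
have dXl : dep (~: cov l) (fun H => psi U H * X H).
  apply: dep_op2.
    by apply: (dep_sub _ dpsi); rewrite -disjoints_subset.
  by apply: (dep_sub _ dX); rewrite setCS subsetUr.
have dprod : dep (~: U) (fun H => \prod_(x <- l) psi x.1 H).
  move=> G1 G2; rewrite !big_seq; apply: eq_bigr => x xl.
  apply: (dep_sub _ (hpsi' x xl).1); rewrite -disjoints_subset disjoint_sym.
  exact: (allP hU).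
transitivity (Ex p (fun H => dls l f H * ((\prod_(x <- l) psi x.1 H) * (psi U H * X H))
   - psi U H * (dls l f (mix U G H) * ((\prod_(x <- l) psi x.1 H) * X H)))).
  by apply: eq_Ex => H; rewrite /dl big_cons /=; ring.
rewrite ExB (@Ex_indep _ _ p U (psi U)
  (fun H => dls l f (mix U G H) * ((\prod_(x <- l) psi x.1 H) * X H))) //; last first.
  move=> G1 G2 /=; rewrite dprod dXU; congr (dls l f _ * _).
  by apply/setP => x; rewrite !in_mix inE; case: (x \in U).
rewrite psi0 mul0r subr0 (IH (fun H => psi U H * X H)) //.
by apply: eq_Ex => H; rewrite big_cons /=; ring.
Qed.
End Decoupling.

(** * Characteristic functions of nearly linear phases *)

Section NearlyLinear.
Variables (R : realType) (T : finType) (p : R).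
Hypotheses (p0 : 0 <= p) (p1 : p <= 1).
Implicit Types (U V G H K : {set T}).
Local Notation v := (p * (1 - p)).

(** The squared modulus equals 1 - 2v(1 - cos th), and 1 - cos th >= th^2/16 on [-pi, pi].
    Periodicity of the cosine forbids such decay for all th, which is why phases must be kept below
    pi throughout. *)
Lemma normc_bernoulli (th : R) : `|th| <= pi ->
  nc (p%:C * expi th + (1 - p%:C)) <= expR (- (v / 16 * th ^+ 2)).
Proof.
move=> hth; have hc := one_sub_cos_ge hth.
have v0 : 0 <= v by rewrite mulr_ge0 ?subr_ge0.
rewrite -(@ler_pXn2r _ 2) ?nnegrE ?expR_ge0 ?normc_ge0 //.
have -> : nc (p%:C * expi th + (1 - p%:C)) ^+ 2 = 1 - 2 * v * (1 - cos th).
  rewrite /= sqr_sqrtr ?addr_ge0 ?sqr_ge0 // !(mul0r, subr0, addr0, oppr0).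
  have : sin th ^+ 2 = 1 - cos th ^+ 2 by rewrite -(cos2Dsin2 th); ring.
  move=> hs; rewrite (_ : _ + _ = p ^+ 2 * (cos th ^+ 2 + sin th ^+ 2) +
     2 * p * (1 - p) * cos th + (1 - p) ^+ 2); last by ring.
  by rewrite hs; ring.
apply: le_trans (expR_ge1Dx (- (2 * v * (1 - cos th)))) _.
rewrite -expRM_natl ler_expR; nra.
Qed.

Variables (S : {set T}) (ell : T -> R).
Hypothesis ell_pi : forall e, e \in S -> `|ell e| <= pi.
Definition linS K := \sum_(e in S) ell e * (e \in K)%:R.
Definition rho := expR (- (v / 16 * \sum_(e in S) ell e ^+ 2)).

Lemma Ex_expi_lin U : U \subset S ->
  nc (Ex p%:C (fun G => expi (\sum_(e in U) ell e * (e \in G)%:R))) <=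
  expR (- (v / 16 * \sum_(e in U) ell e ^+ 2)).
Proof.
move=> US.
pose ph e (b : bool) : R[i] := if e \in U then expi (ell e * b%:R) else 1.
rewrite (eq_Ex _ (F2 := fun G => \prod_e ph e (e \in G))); last first.
  by move=> G; rewrite expi_sum big_mkcond.
rewrite Ex_prod (bigID (mem U)) /= [X in _ * X]big1 ?mulr1; last first.
  by move=> e eU; rewrite /ph (negPf eU) !mulr1 addrC subrK.
have -> : expR (- (v / 16 * \sum_(e in U) ell e ^+ 2)) =
    \prod_(e in U) expR (- (v / 16 * ell e ^+ 2)).
  by rewrite mulr_sumr -sumrN expR_sum.
elim/big_ind2: _ => [|x1 x2 y1 y2 h1 h2|e eU].
- by rewrite ComplexField.Normc.normc1.
- by rewrite ComplexField.Normc.normcM ler_pM ?normc_ge0.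
rewrite /ph eU mulr1 mulr0 expi0 mulr1; apply: normc_bernoulli.
by apply: ell_pi; apply: (subsetP US).
Qed.

(** Freezing the coordinates in [D] turns [X] into a constant of modulus at most 1, and only the
    edges of [S] off [D] still give decay. Each edge lost costs at most a factor e, because v/16
    times the square of its coefficient is at most 1. *)
Lemma Ex_local_expi_lin (X : {set T} -> R[i]) (D : {set T}) :
  dep D X -> (forall G, nc (X G) <= 1) ->
  nc (Ex p%:C (fun G => X G * expi (linS G))) <= rho * expR 1 ^+ #|D|.
Proof.
move=> dX X1; pose U := S :\: D.
rewrite (Ex_resample p%:C U); apply: le_trans (normc_Ex p0 p1 _) _.
apply: Ex_le_cst => // H.
have split G : linS (mix U G H) = \sum_(e in U) ell e * (e \in G)%:R +
    \sum_(e in S :&: D) ell e * (e \in H)%:R.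
  rewrite /linS (big_setID D) /= addrC; congr (_ + _).
    by apply: eq_bigr => e eU; rewrite in_mix -/U eU.
  by apply: eq_bigr => e; rewrite inE => /andP[_ eD]; rewrite in_mix inE eD.
rewrite (eq_Ex _ (F2 := fun G => (X H * expi (\sum_(e in S :&: D) ell e * (e \in H)%:R))
   * expi (\sum_(e in U) ell e * (e \in G)%:R))); last first.
  move=> G; rewrite split expiD (dep_mix _ _ dX); first by ring.
  by rewrite -setI_eq0 setIDAC -setIDA setDv setI0.
rewrite ExZ !ComplexField.Normc.normcM normc_expi mulr1.
apply: (@le_trans _ _ (nc (Ex p%:C (fun G => expi (\sum_(e in U) ell e * (e \in G)%:R))))).
  by rewrite ler_piMl ?normc_ge0.
apply: le_trans (Ex_expi_lin (subsetDl _ _)) _.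
rewrite /rho -expRM_natl -expRD ler_expR mulr1.
have -> : \sum_(e in S) ell e ^+ 2 =
    \sum_(e in S :&: D) ell e ^+ 2 + \sum_(e in U) ell e ^+ 2 by rewrite (big_setID D).
suff : v / 16 * \sum_(e in S :&: D) ell e ^+ 2 <= #|D|%:R.
  by move: (\sum_(e in S :&: D) _) (\sum_(e in U) _) => y z; nra.
apply: (@le_trans _ _ (\sum_(e in S :&: D) 1)); last first.
  by rewrite sumr_const; rewrite ler_nat subset_leq_card // subsetIr.
rewrite mulr_sumr; apply: ler_sum => e; rewrite inE => /andP[eS _].
have := ell_pi eS; have := @pihalf_lt2 R; rewrite -(@real_normK _ (ell e)) ?num_real //.
have := normr_ge0 (ell e); move: (`|_|) => x x0 pi4 xpi.
have x2 : x ^+ 2 <= 16 by rewrite expr2; nra.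
have v1 : v <= 1 by nra.
have v0 : 0 <= v by rewrite mulr_ge0 ?subr_ge0.
have x2' : 16^-1 * x ^+ 2 <= 1 by lra.
have x0' : 0 <= 16^-1 * x ^+ 2 by rewrite mulr_ge0 ?sqr_ge0 // invr_ge0.
by rewrite -mulrA; apply: le_trans (ler_wpM2r x0' v1) _; rewrite mul1r.
Qed.

Variables (I : finType) (F : I -> {set T} -> R) (D : I -> {set T}) (b : R) (Dn : nat).
Hypotheses (b0 : 0 < b) (depF : forall i, dep (D i) (F i))
  (cardD : forall i, (#|D i| <= Dn)%N) (Fb : forall i G, `|F i G| <= b).
Let Q G := \sum_i F i G.
Let mu := Ex p Q.
Let F' i G := F i G - Ex p (F i).

Lemma sum_centered G : \sum_i F' i G = Q G - mu.
Proof. by rewrite sumrB /mu /Q Ex_sum. Qed.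

Lemma centered_le i G : `|F' i G| <= 2 * b.
Proof.
apply: le_trans (ler_normB _ _) _; rewrite mulr_natl mulr2n lerD //.
by apply: le_trans (norm_Ex p0 p1 _) _; apply: Ex_le_cst.
Qed.

(** One factor [Q - mu] is expanded into local centred terms of size at most 2b; each is normalised
    and absorbed into [X], whose support grows by at most [Dn] coordinates. *)
Lemma Ex_power_expi_lin j (X : {set T} -> R[i]) (D0 : {set T}) :
  dep D0 X -> (forall G, nc (X G) <= 1) ->
  nc (Ex p%:C (fun G => (Q G - mu)%:C ^+ j * (X G * expi (linS G)))) <=
  (#|I|%:R * (2 * b)) ^+ j * (rho * expR 1 ^+ (#|D0| + j * Dn)).
Proof.
elim: j X D0 => [|j IH] X D0 dX X1.
  rewrite expr0 mul1r mul0n addn0; under eq_Ex do rewrite expr0 mul1r.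
  exact: Ex_local_expi_lin.
have b2 : 0 < 2 * b by rewrite mulr_gt0.
pose X' i G := (F' i G / (2 * b))%:C * X G.
rewrite (eq_Ex _ (F2 := fun G => \sum_i (2 * b)%:C *
    ((Q G - mu)%:C ^+ j * (X' i G * expi (linS G))))); last first.
  move=> G; rewrite exprSr -{2}sum_centered rmorph_sum -mulrA mulr_suml mulr_sumr.
  apply: eq_bigr => i _; rewrite /X'.
  have E : (F' i G)%:C = (2 * b)%:C * (F' i G / (2 * b))%:C.
    by rewrite -rmorphM mulrC divfK // gt_eqF.
  transitivity ((Q G - mu)%:C ^+ j * (((2 * b)%:C * (F' i G / (2 * b))%:C) * (X G * expi (linS G)))).
    by congr (_ * (_ * _)); exact: E.
  by ring.
rewrite Ex_sum; apply: le_trans (normc_sum _ _ _) _.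
have -> : (#|I|%:R * (2 * b)) ^+ j.+1 * (rho * expR 1 ^+ (#|D0| + j.+1 * Dn)) =
    \sum_(i : I) (2 * b) * ((#|I|%:R * (2 * b)) ^+ j * (rho * expR 1 ^+ (#|D0| + j.+1 * Dn))).
  by rewrite sumr_const -mulr_natl exprS; ring.
apply: ler_sum => i _.
rewrite ExZ ComplexField.Normc.normcM normc_real gtr0_norm // ler_pM2l //.
have dX' : dep (D0 :|: D i) (X' i).
  apply: dep_op2; last by apply: dep_sub dX; rewrite subsetUl.
  by move=> G1 G2; rewrite /F' (dep_sub (subsetUr _ _) (depF i)).
have X'1 G : nc (X' i G) <= 1.
  rewrite ComplexField.Normc.normcM normc_real -[leRHS]mulr1 ler_pM ?normc_ge0 //.
  by rewrite normrM (gtr0_norm (x := _^-1)) ?invr_gt0 // ler_pdivrMr // mul1r centered_le.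
apply: le_trans (IH _ _ dX' X'1) _.
apply: ler_wpM2l; first by rewrite exprn_ge0 // mulr_ge0 // ltW.
rewrite ler_wpM2l ?expR_ge0 // ler_weXn2l //.
  by rewrite -(@expR0 R) ler_expR.
have [h1 _] := leq_card_setU D0 (D i); have := cardD i; rewrite mulSn => h2; lia.
Qed.

Variable c : T -> R.
Hypothesis Qc : forall G e, `|Q (e |: G) - Q (G :\ e)| <= c e.

(** Expand e^(i(Q - mu)) to [J] Taylor terms. Each power of [Q - mu] keeps the decay [rho] of the
    linear phase. The remainder is controlled by |Q - mu|^J / J! <= eta^J e^(|Q - mu| / eta), whose
    mean McDiarmid's inequality bounds at the parameters 1/eta and -1/eta. *)
Theorem charfun_nearly_linear (J : nat) (eta : R) : 0 < eta ->
  nc (Ex p%:C (fun G => expi (linS G + Q G))) <=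
  \sum_(j < J) (#|I|%:R * (2 * b)) ^+ j * (rho * expR 1 ^+ (j * Dn)) +
  4 * eta ^+ J * expR (2 * (\sum_e c e ^+ 2) / eta ^+ 2).
Proof.
move=> eta0.
pose W G := Q G - mu.
rewrite (eq_Ex _ (F2 := fun G => expi mu *
  ((\sum_(j < J) ('i ^+ j / (j`!)%:R) * ((W G)%:C ^+ j * (1 * expi (linS G)))) +
   expi (linS G) * (expi (W G) - expi_poly J (W G))))); last first.
  move=> G; rewrite (_ : linS G + Q G = mu + (linS G + W G)); last by rewrite /W; ring.
  rewrite expiD expiD; congr (_ * _).
  have -> : \sum_(j < J) ('i ^+ j / (j`!)%:R) * ((W G)%:C ^+ j * (1 * expi (linS G))) =
      expi (linS G) * expi_poly J (W G).
    rewrite /expi_poly mulr_sumr; apply: eq_bigr => j _.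
    by rewrite exprMn; ring.
  by ring.
rewrite ExZ ComplexField.Normc.normcM normc_expi mul1r ExD.
apply: le_trans (le_normcD _ _) _; apply: lerD.
  rewrite Ex_sum; apply: le_trans (normc_sum _ _ _) _; apply: ler_sum => j _.
  rewrite ExZ ComplexField.Normc.normcM.
  have n1 : nc ('i%C ^+ j / (j`!)%:R : R[i]) <= 1.
    rewrite ComplexField.Normc.normcM.
    have -> : nc ('i%C ^+ j : R[i]) = 1.
      elim: (nat_of_ord j) => [|k IHk]; first by rewrite expr0 ComplexField.Normc.normc1.
      by rewrite exprS ComplexField.Normc.normcM IHk /= expr0n expr1n add0r sqrtr1 mulr1.
    rewrite mul1r (_ : (j`!%:R)^-1 = (j`!%:R^-1 : R)%:C); last by rewrite fmorphV rmorph_nat.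
    rewrite normc_real ger0_norm ?invr_ge0 // invf_le1 ?ler1n ?ltr0n ?fact_gt0 //.
  apply: (@le_trans _ _ (1 * nc (Ex p%:C (fun G => (W G)%:C ^+ j * (1 * expi (linS G)))))).
    by rewrite ler_wpM2r ?normc_ge0.
  rewrite mul1r.
  have := @Ex_power_expi_lin j (fun=> 1) set0; rewrite cards0 add0n; apply=> //.
  by move=> G; rewrite ComplexField.Normc.normc1.
apply: le_trans (normc_Ex p0 p1 _) _.
apply: (@le_trans _ _ (Ex p (fun G => 2 * eta ^+ J *
    (expR (eta^-1 * W G) + expR (- eta^-1 * W G))))); last first.
  rewrite ExZ ExD.
  have h1 := mcdiarmid p0 p1 eta^-1 Qc; have h2 := mcdiarmid p0 p1 (- eta^-1) Qc.
  rewrite sqrrN in h2; rewrite -/mu in h1 h2.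
  have e0 : 0 <= 2 * eta ^+ J by rewrite mulr_ge0 ?exprn_ge0 ?ltW.
  apply: le_trans (ler_wpM2l e0 (lerD h1 h2)) _.
  rewrite exprVn le_eqVlt; apply/orP; left; apply/eqP.
  rewrite (_ : 2 * (eta ^+ 2)^-1 * _ = 2 * (\sum_e c e ^+ 2) / eta ^+ 2); ring.
apply: ler_Ex => // G; rewrite ComplexField.Normc.normcM normc_expi mul1r.
apply: le_trans (expi_taylor _ _) _; rewrite -mulrA ler_wpM2l //.
rewrite -[X in X ^+ J / _](@divfK _ eta) ?gt_eqF // exprMn mulrAC [leLHS]mulrC.
apply: ler_wpM2l; first by rewrite exprn_ge0 // ltW.
apply: (@le_trans _ _ (expR (`|W G| / eta))).
  have y0 : 0 <= `|W G| / eta by rewrite divr_ge0 // ltW.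
  case: J => [|J].
    by rewrite expr0 fact0 divr1; apply: le_trans (expR_ge1Dx _); rewrite lerDl.
  by apply: le_trans (expR_ge1Dxn J y0); rewrite lerDr.
case: (lerP 0 (W G)) => h.
  by rewrite (ger0_norm h) [_ / eta]mulrC lerDl expR_ge0.
by rewrite (ltr0_norm h) [_ / eta]mulrC mulrN -mulNr lerDr expR_ge0.
Qed.
End NearlyLinear.

(** * Discrete derivatives *)

Section Increments.
Variables (R : realType) (T : finType).
Implicit Types (U V G H K : {set T}) (e g : T).

Lemma dep_eq (A : Type) U (f : {set T} -> A) G H :
  dep U f -> {in U, G =i H} -> f G = f H.
Proof.
move=> df h; rewrite -(df G H); congr f; apply/setP => x; rewrite in_mix.
by case: ifP => // /h.
Qed.

Definition incr (t : {set T} -> R) e H := t (e |: H) - t (H :\ e).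

Lemma incr0 (t : {set T} -> R) U e H : dep U t -> e \notin U -> incr t e H = 0.
Proof.
move=> dt eU; apply/eqP; rewrite subr_eq0; apply/eqP; apply: (dep_eq dt) => x xU.
by rewrite !inE; case: eqP => // xe; rewrite -xe xU in eU.
Qed.

Lemma incr_eq (t : {set T} -> R) U e H H' : dep U t ->
  {in U :\ e, H =i H'} -> incr t e H = incr t e H'.
Proof.
move=> dt h; congr (_ - _); apply: (dep_eq dt) => x xU; rewrite !inE; case: eqP => //= /eqP xe;
by apply: h; rewrite !inE xe.
Qed.

Lemma incr_le2 (t : {set T} -> R) e H : (forall G, `|t G| <= 1) -> `|incr t e H| <= 2.
Proof. by move=> h; apply: le_trans (ler_normB _ _) _; have := h (e |: H); have := h (H :\ e); lra. Qed.

Lemma incr_self (t : {set T} -> R) e H : incr t e (e |: H) = incr t e (H :\ e).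
Proof. by congr (t _ - t _); apply/setP => x; rewrite !inE; case: eqP. Qed.

Lemma incr_sum (I : finType) (t : I -> {set T} -> R) e H :
  incr (fun G => \sum_i t i G) e H = \sum_i incr (t i) e H.
Proof. by rewrite /incr sumrB. Qed.

Lemma incr_incr_le (t : {set T} -> R) U e g H : dep U t -> (forall G, `|t G| <= 1) -> e != g ->
  `|incr t e (g |: H) - incr t e (H :\ g)| <= 4 * ((g \in U) && (e \in U))%:R.
Proof.
move=> dt t1 eg; case: (boolP (e \in U)) => eU; last first.
  by rewrite !(incr0 _ dt eU) subrr normr0 andbF mulr0.
case: (boolP (g \in U)) => gU /=.
  rewrite mulr1; apply: le_trans (ler_normB _ _) _.
  by have := incr_le2 e (g |: H) t1; have := incr_le2 e (H :\ g) t1; lra.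
rewrite mulr0 (incr_eq (H' := H :\ g) dt) ?subrr ?normr0 // => x.
by rewrite !inE => /andP[_ xU]; case: eqP => // xg; rewrite -xg xU in gU.
Qed.
End Increments.

(** * Linearizing a sum of local functions along a sparse edge set *)

Section KeyEstimate.
Variables (R : realType) (T : finType) (p : R).
Hypotheses (p0 : 0 <= p) (p1 : p <= 1).
Implicit Types (U V G H K : {set T}) (e g : T).
Variables (I : finType) (t : I -> {set T} -> R) (FF : I -> {set T}) (Dn : nat).
Hypotheses (dt : forall i, dep (FF i) (t i)) (t1 : forall i G, `|t i G| <= 1)
  (cardF : forall i, (#|FF i| <= Dn)%N).
Let g H := \sum_i t i H.
Variables (S : {set T}) (s : R) (c : T -> R) (M : R).
Hypothesis s0 : s != 0.
Hypothesis hc : forall e, \sum_(e' in S | e' != e) \sum_i ((e \in FF i) && (e' \in FF i))%:R <= c e.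
Hypothesis hpi : forall H e, e \in S -> `|s * incr g e H| <= pi.
Hypothesis M0 : 0 <= M.
Hypothesis hM : forall e, e \in S -> M <= Ex p (fun H => `|incr g e H|).
Hypothesis S0 : (0 < #|S|)%N.
Local Notation v := (p * (1 - p)).

Let c0 e : 0 <= c e.
Proof. by apply: le_trans (hc e); apply: sumr_ge0 => i _; apply: sumr_ge0. Qed.

Let Fi H i K := s * (t i (mix S K H) - \sum_(e in S) incr (t i) e H * (e \in K)%:R).

Let dep_Fi H i : dep (FF i) (Fi H i).
Proof.
move=> G1 G2; rewrite /Fi; congr (_ * (_ - _)).
  by apply: (dep_eq (@dt i)) => x xF; rewrite !in_mix xF.
apply: eq_bigr => e _; case: (boolP (e \in FF i)) => eF; first by rewrite in_mix eF.
by rewrite (incr0 _ (@dt i) eF) !mul0r.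
Qed.

Let Fi_le H i K : `|Fi H i K| <= `|s| * (1 + 2 * Dn%:R).
Proof.
rewrite normrM ler_wpM2l //; apply: le_trans (ler_normB _ _) _; apply: lerD => //.
apply: le_trans (ler_norm_sum _ _ _) _.
apply: (@le_trans _ _ (\sum_(e in FF i) 2)).
  rewrite [leLHS]big_mkcond [leRHS]big_mkcond /=; apply: ler_sum => e _.
  case: (boolP (e \in FF i)) => eF; last first.
    by case: ifP => // _; rewrite (incr0 _ (@dt i) eF) mul0r normr0.
  case: ifP => // _; rewrite normrM.
  have := incr_le2 e H (@t1 i); case: (e \in K); rewrite ?normr1 ?normr0 ?mulr1 ?mulr0 //.
rewrite sumr_const -[_ *+ #|_|]mulr_natr ler_wpM2l // ler_nat; exact: cardF.
Qed.

Let lin_plus H K :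
  linS S (fun e => s * incr g e H) K + \sum_i Fi H i K = s * g (mix S K H).
Proof.
rewrite /Fi -mulr_sumr sumrB mulrBr -/(g (mix S K H)) addrC.
rewrite exchange_big /= /linS mulr_sumr -[RHS]addr0 -addrA; congr (_ + _).
rewrite addrC; apply/eqP; rewrite subr_eq0; apply/eqP; rewrite mulr_sumr; apply: eq_bigr => e _.
by rewrite -mulr_suml /g incr_sum mulrA.
Qed.

(** The difference at [e] compares derivatives of [t i] at two outcomes that agree off [S]. They can
    differ only if the support of [t i] contains [e] and another edge of [S], which is what [c]
    counts. *)
Let Fi_incr H K e : `|\sum_i Fi H i (e |: K) - \sum_i Fi H i (K :\ e)| <=
  (e \in S)%:R * (4 * `|s| * c e).
Proof.
have e1 X : \sum_i Fi H i X = s * g (mix S X H) - linS S (fun e => s * incr g e H) X.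
  by rewrite -lin_plus addrC addKr.
case: (boolP (e \in S)) => eS; last first.
  rewrite mul0r -sumrB big1 ?normr0 // => i _; apply/eqP; rewrite subr_eq0; apply/eqP.
  rewrite /Fi; congr (_ * (t i _ - _)).
    apply/setP => x; rewrite !in_mix; case: ifP => // xS; rewrite !inE.
    by case: eqP => // xe; rewrite -xe xS in eS.
  apply: eq_bigr => x xS; congr (_ * (nat_of_bool _)%:R); rewrite !inE.
  by case: eqP => // xe; rewrite -xe xS in eS.
rewrite mul1r !e1.
have -> : s * g (mix S (e |: K) H) - linS S (fun e0 => s * incr g e0 H) (e |: K) -
   (s * g (mix S (K :\ e) H) - linS S (fun e0 => s * incr g e0 H) (K :\ e)) =
   s * \sum_i (incr (t i) e (mix S K H) - incr (t i) e H).
  have -> : linS S (fun e0 => s * incr g e0 H) (e |: K) =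
     linS S (fun e0 => s * incr g e0 H) (K :\ e) + s * incr g e H.
    rewrite /linS (bigD1 e) //= [in RHS](bigD1 e) //= !inE eqxx /= mulr1 mulr0 add0r addrC.
    congr (_ + _); apply: eq_bigr => x /andP[_ xe]; by rewrite !inE (negPf xe).
  rewrite sumrB -!incr_sum -/g {1}/incr.
  have -> : mix S (e |: K) H = e |: mix S K H.
    by apply/setP => x; rewrite !(in_mix, inE); case: eqP => // ->; rewrite eS.
  have -> : mix S (K :\ e) H = mix S K H :\ e.
    by apply/setP => x; rewrite !(in_mix, inE); case: eqP => // ->; rewrite eS.
  by rewrite {2}/g /incr /=; ring.
rewrite normrM [leRHS](_ : _ = `|s| * (4 * c e)); last by ring.
rewrite ler_wpM2l //.
apply: le_trans (ler_wpM2l (ler0n _ 4) (hc e)).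
rewrite exchange_big /= mulr_sumr; apply: le_trans (ler_norm_sum _ _ _) _.
apply: ler_sum => i _.
have [h|] := boolP [exists e' in S, (e' != e) && ((e \in FF i) && (e' \in FF i))].
  have /existsP[e' /and3P[e'S ne h']] := h.
  apply: (@le_trans _ _ 4).
    apply: le_trans (ler_normB _ _) _.
    by have := incr_le2 e (mix S K H) (@t1 i); have := incr_le2 e H (@t1 i); lra.
  rewrite (bigD1 e') ?e'S ?ne //= h' mulrDr mulr1 lerDl mulr_ge0 //.
  by apply: sumr_ge0.
rewrite negb_exists => /forallP h.
rewrite (_ : _ - _ = 0) ?normr0 ?mulr_ge0 ?sumr_ge0 //.
apply/eqP; rewrite subr_eq0; apply/eqP.
case: (boolP (e \in FF i)) => eF; last by rewrite !(incr0 _ (@dt i) eF).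
apply: (incr_eq (@dt i)) => x; rewrite in_mix in_setD1 => /andP[xe xF].
by case: ifP => // xS; have := h x; rewrite xS xe eF xF.
Qed.

Let Y H := \sum_(e in S) `|incr g e H|.

Let Y_incr H e : `|Y (e |: H) - Y (H :\ e)| <= 4 * c e.
Proof.
rewrite /Y -sumrB; apply: le_trans (ler_norm_sum _ _ _) _.
apply: le_trans (ler_wpM2l (ler0n _ 4) (hc e)); rewrite mulr_sumr.
rewrite [leLHS](bigID (pred1 e)) /= big1 ?add0r; last first.
  by move=> x /andP[_ /eqP ->]; rewrite incr_self subrr normr0.
apply: ler_sum => x /andP[_ xe].
apply: le_trans (ler_dist_dist _ _) _; rewrite /g !incr_sum -sumrB.
apply: le_trans (ler_norm_sum _ _ _) _; rewrite mulr_sumr; apply: ler_sum => i _.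
exact: incr_incr_le (@dt i) (@t1 i) _.
Qed.

(** All edges outside [S] are frozen and [B H] is the conditional mean. Where the total derivative
    [Y] is at least half its mean, Cauchy-Schwarz bounds the sum of squared coefficients from below
    and [charfun_nearly_linear] applies. Elsewhere [B H <= 1], and the lower tail of [Y] yields the
    last term. *)
Theorem charfun_local_sum (J : nat) (eta lam : R) : 0 < eta -> 0 <= lam ->
  nc (Ex p%:C (fun H => expi (s * g H))) <=
  \sum_(j < J) (#|I|%:R * (2 * (`|s| * (1 + 2 * Dn%:R)))) ^+ j *
     (expR (- (v / 16 * (s ^+ 2 * (#|S|%:R * M ^+ 2) / 4))) * expR 1 ^+ (j * Dn)) +
  4 * eta ^+ J * expR (2 * (\sum_(e in S) (4 * `|s| * c e) ^+ 2) / eta ^+ 2) +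
  expR (2 * lam ^+ 2 * \sum_e (4 * c e) ^+ 2 - lam * (#|S|%:R * M / 2)).
Proof.
move=> eta0 lam0; set be := _ + 4 * eta ^+ J * _.
have m0 : 0 < #|S|%:R :> R by rewrite ltr0n.
have v0 : 0 <= v by rewrite mulr_ge0 ?subr_ge0.
have bb : 0 <= #|I|%:R * (2 * (`|s| * (1 + 2 * Dn%:R))).
  by rewrite mulr_ge0 // mulr_ge0 // mulr_ge0 // addr_ge0 // mulr_ge0.
have be0 : 0 <= be.
  apply: addr_ge0; last first.
    by apply: mulr_ge0; [rewrite mulr_ge0 // exprn_ge0 // ltW | exact: expR_ge0].
  apply: sumr_ge0 => j _; apply: mulr_ge0; first exact: exprn_ge0.
  by rewrite mulr_ge0 ?exprn_ge0 ?expR_ge0.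
have EY : #|S|%:R * M <= Ex p Y.
  rewrite /Y Ex_sum mulr_natl -sumr_const; exact: ler_sum.
rewrite (Ex_resample p%:C S).
pose B H := nc (Ex p%:C (fun K => expi (s * g (mix S K H)))).
apply: le_trans (normc_Ex p0 p1 _) _; rewrite -/B.
have B1 H : B H <= 1.
  by apply: le_trans (normc_Ex p0 p1 _) _; apply: Ex_le_cst => // K; rewrite normc_expi.
have hB H : Ex p Y / 2 <= Y H -> B H <= be.
  move=> hY.
  have b0 : 0 < `|s| * (1 + 2 * Dn%:R) by rewrite mulr_gt0 ?normr_gt0 // ltr_pwDl // mulr_ge0.
  rewrite /B; under eq_Ex do rewrite -lin_plus.
  have := charfun_nearly_linear p0 p1 (hpi H) b0 (dep_Fi H) cardF (Fi_le H) (Fi_incr H) J eta0.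
  move=> /le_trans; apply; rewrite /be; apply: lerD.
    apply: ler_sum => j _; apply: ler_wpM2l; first exact: exprn_ge0.
    rewrite ler_wpM2r ?exprn_ge0 ?expR_ge0 // /rho ler_expR lerN2 ler_wpM2l ?divr_ge0 //.
    have -> : \sum_(e in S) (s * incr g e H) ^+ 2 = s ^+ 2 * \sum_(e in S) `|incr g e H| ^+ 2.
      by rewrite mulr_sumr; apply: eq_bigr => e _; rewrite exprMn real_normK ?num_real.
    rewrite -mulrA ler_wpM2l ?sqr_ge0 //.
    (* Cauchy-Schwarz *)
    have cs : 0 <= \sum_(e in S) (`|incr g e H| - M / 2) ^+ 2 by apply: sumr_ge0 => e _; apply: sqr_ge0.
    move: cs; rewrite (eq_bigr (fun e => `|incr g e H| ^+ 2 - M * `|incr g e H| + M ^+ 2 / 4)); last first.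
      by move=> e _; field.
    rewrite big_split sumrB /= -mulr_sumr -/(Y H) sumr_const -[_ *+ #|S|]mulr_natl.
    have : M * (#|S|%:R * M / 2) <= M * Y H by rewrite ler_wpM2l //; lra.
    by nra.
  apply: ler_wpM2l; first by rewrite mulr_ge0 // exprn_ge0 // ltW.
  rewrite ler_expR.
  rewrite ler_pM2r ?invr_gt0 ?exprn_gt0 // ler_pM2l //.
  rewrite [leRHS]big_mkcond /=; apply: ler_sum => e _.
  by case: (e \in S); rewrite ?mul1r // mul0r expr0n.
apply: le_trans (mcdiarmid_lower p0 p1 lam0 be0 Y_incr B1 hB) _.
rewrite lerD2l ler_expR lerD2l lerN2 ler_wpM2l // ; lra.
Qed.
End KeyEstimate.

(** * Elementary counting *)

Lemma exp_mono a b k : (a <= b)%N -> (a ^ k <= b ^ k)%N.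
Proof. by case: k => [|k] h //; rewrite leq_exp2r. Qed.

Lemma bin_le_exp m k : ('C(m, k) <= m ^ k)%N.
Proof.
elim: m k => [|m IH] [|k]; rewrite ?bin0 ?bin0n ?expn0 //.
rewrite binS; apply: leq_trans (leq_add (IH k.+1) (IH k)) _.
by rewrite expnS -mulSnr [leqRHS]expnS leq_mul2l exp_mono.
Qed.

Lemma card_ord_itv_le n a k : (#|[set y : 'I_n | (a <= y < a + k)%N]| <= k)%N.
Proof.
case: k => [|k].
  by rewrite leqn0 cards_eq0; apply/eqP/setP => y; rewrite !inE; lia.
rewrite -[leqRHS](card_ord k.+1).
rewrite -(@card_in_imset _ _ (fun y : 'I_n => inord (y - a) : 'I_k.+1)); first exact: max_card.
move=> x y; rewrite !inE => hx hy /(congr1 val); rewrite /= !inordK; [|lia|lia].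
by move=> h; apply: val_inj => /=; lia.
Qed.

Lemma card_ord_itv_ge n a k : (a + k <= n)%N -> (k <= #|[set y : 'I_n | (a <= y < a + k)%N]|)%N.
Proof.
case: n => [|n] hk; first by lia.
rewrite -[leqLHS](card_ord k) -(@card_imset _ _ (fun i : 'I_k => inord (a + i) : 'I_n.+1)).
  apply: subset_leq_card; apply/subsetP => x /imsetP[i _ ->].
  rewrite inE inordK; last by have := ltn_ord i; lia.
  by have := ltn_ord i; lia.
move=> i j /(congr1 val); have := ltn_ord i; have := ltn_ord j => hj hi.
by rewrite /= !inordK; [|lia|lia] => h; apply: val_inj => /=; lia.
Qed.

Lemma card_bigcup_le (I T : finType) (P : pred I) (X : I -> {set T}) :
  (#|\bigcup_(i | P i) X i| <= \sum_(i | P i) #|X i|)%N.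
Proof.
elim/big_ind2: _ => [|A a B b hA hB|//]; first by rewrite cards0.
have [h _] := leq_card_setU a b; exact: leq_trans h (leq_add hA hB).
Qed.

(** * Cliques as monomials, and counts of vertex sets *)

Section Cliques.
Variable n : nat.
Implicit Types (A B C Y Z Q : {set 'I_n}) (e : edge n) (Zs : seq {set 'I_n}).

Definition EE A : {set edge n} := [set e : edge n | val e \subset A].
Definition star (a : 'I_n) Q : {set edge n} :=
  [set e : edge n | (a \in val e) && (val e :&: Q != set0)].

Lemma is_cliqueE (G : graph n) A : is_clique G A = (EE A \subset G).
Proof.
apply/forallP/subsetP => [h e|h e]; first by rewrite inE => eA; exact: (implyP (h e)).
by apply/implyP => eA; apply: h; rewrite inE.
Qed.

Lemma card_edge e : #|val e| = 2.
Proof. by apply/eqP; exact: (valP e). Qed.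

Lemma card_EE A : #|EE A| = 'C(#|A|, 2).
Proof.
rewrite -cards_draws -(@card_imset _ _ (val : edge n -> _)); last exact: val_inj.
congr #|pred_of_set _|; apply/setP => B; rewrite inE; apply/imsetP/andP.
  by move=> [e eA ->]; rewrite inE in eA; rewrite card_edge.
by move=> [BA B2]; exists (Sub B B2); rewrite ?inE.
Qed.

Lemma card_star a Q : a \notin Q -> #|star a Q| = #|Q|.
Proof.
move=> aQ; rewrite -(@card_imset _ _ (val : edge n -> _)); last exact: val_inj.
rewrite -(@card_in_imset _ _ (fun b => [set a; b]) Q); last first.
  move=> x y xQ yQ /setP /(_ x); rewrite !inE eqxx orbT => /esym/orP[/eqP xa|/eqP //].
  by rewrite -xa xQ in aQ.
congr #|pred_of_set _|; apply/setP => B; apply/imsetP/imsetP.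
  move=> [e]; rewrite inE => /andP[ae /set0Pn [b]]; rewrite inE => /andP[be bQ] ->.
  exists b => //; apply/esym/eqP; rewrite eqEcard card_edge cards2.
  have -> : a != b by apply: contraNneq aQ => ->.
  rewrite leqnn andbT; apply/subsetP => x; rewrite !inE; by case/orP => /eqP ->.
move=> [b bQ ->]; have ab : a != b by apply: contraNneq aQ => ->.
have B2 : #|[set a; b]| == 2 by rewrite cards2 ab.
exists (Sub [set a; b] B2); rewrite //= inE /= !inE eqxx /=.
by apply/set0Pn; exists b; rewrite !inE eqxx orbT.
Qed.

Definition rset r := {A : {set 'I_n} | #|A| == r}.

Lemma card_rset r : #|{: rset r}| = 'C(n, r).
Proof. by rewrite card_sig -[in RHS](card_ord n) -card_draws cardsE. Qed.

Lemma sum_rset (K : nmodType) r (F : {set 'I_n} -> K) :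
  \sum_(A : rset r) F (val A) = \sum_(A : {set 'I_n} | #|A| == r) F A.
Proof. exact: (esym (big_sub [pred A : {set 'I_n} | #|A| == r] F)). Qed.

Lemma cliquesE (R : realType) r (G : graph n) :
  cliques R r G = \sum_(A : rset r) mono R (EE (val A)) G.
Proof.
rewrite (sum_rset r (fun A => mono R (EE A) G)) /cliques /clique_count.
rewrite -sum1dep_card natr_sum big_mkcondr /=; apply: eq_bigr => A _.
by rewrite is_cliqueE /mono; case: (_ \subset _).
Qed.

(** The product form stays true, with left side zero, when [Y] has more than [r] elements. *)
Lemma card_superset r Y :
  (#|[set A : {set 'I_n} | (#|A| == r) && (Y \subset A)]| * n ^ #|Y| <= n ^ r)%N.
Proof.
set X := [set A | _].
have [rY|Yr] := ltnP r #|Y|.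
  suff -> : X = set0 by rewrite cards0.
  apply/setP => A; rewrite !inE; apply/negP => /andP[/eqP rA YA].
  by have := subset_leq_card YA; rewrite rA; lia.
rewrite -[r in (_ <= n ^ r)%N](subnK Yr) expnD leq_mul2r; apply/orP; right.
have YX : {in X &, injective (fun A => A :\: Y)}.
  move=> A B; rewrite !inE => /andP[_ YA] /andP[_ YB] h.
  by rewrite -(setID A Y) -(setID B Y) h (setIidPr YA) (setIidPr YB).
rewrite -(card_in_imset YX).
apply: leq_trans (_ : 'C(#|~: Y|, r - #|Y|) <= _)%N.
  rewrite -cards_draws; apply: subset_leq_card; apply/subsetP => B /imsetP[A].
  rewrite !inE => /andP[/eqP rA YA] ->; rewrite cardsD (setIidPr YA) rA eqxx andbT.
  by rewrite setDE subsetIr.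
apply: leq_trans (bin_le_exp _ _) (exp_mono _ _).
by rewrite -[leqRHS](card_ord n) max_card.
Qed.

Definition hits Zs A := all (fun Z => A :&: Z != set0) Zs.

(** Meeting a block [Z] costs a factor |Z|/n: a point z of the intersection is chosen and adjoined
    to [Y]. Disjointness ensures that [Y] really grows. *)
Lemma card_hits r Y Zs :
  pairwise (fun Z Z' => [disjoint Z & Z']) (Y :: Zs) ->
  (#|[set A : {set 'I_n} | [&& #|A| == r, Y \subset A & hits Zs A]]| * n ^ (#|Y| + size Zs)
    <= (\prod_(Z <- Zs) #|Z|) * n ^ r)%N.
Proof.
elim: Zs Y => [|Z Zs IH] Y /=.
  move=> _; rewrite addn0 big_nil mul1n; apply: leq_trans (card_superset r Y).
  rewrite leq_mul2r subset_leq_card ?orbT //; apply/subsetP => A.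
  by rewrite !inE andbT.
move=> /and3P[/andP[YZ hY] hZ hZs].
pose X z := [set A : {set 'I_n} | [&& #|A| == r, z |: Y \subset A & hits Zs A]].
apply: (@leq_trans ((\sum_(z in Z) #|X z|) * n ^ (#|Y| + (size Zs).+1)))%N.
  rewrite leq_mul2r; apply/orP; right.
  apply: (@leq_trans #|\bigcup_(z in Z) X z|).
    apply: subset_leq_card; apply/subsetP => A; rewrite inE => /and3P[rA YA /andP[AZ hA]].
    have /set0Pn[z] := AZ; rewrite inE => /andP[zA zZ].
    apply/bigcupP; exists z => //; rewrite inE rA hA andbT /=.
    by rewrite subUset sub1set zA.
  exact: card_bigcup_le.
rewrite big_distrl /= big_cons -mulnA -sum_nat_const; apply: leq_sum => z zZ.
have zY : z \notin Y by rewrite (disjointFl YZ zZ).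
have := IH (z |: Y); rewrite cardsU1 zY add1n addSnnS; apply.
rewrite /= hZs andbT; apply/allP => W WZs.
rewrite -setI_eq0 setIUl setU_eq0 !setI_eq0 (allP hY) // andbT disjoints1.
by rewrite (disjointFr (allP hZ _ WZs) zZ).
Qed.

(** * A sparse, nearly regular edge set: at most n dg edges, all degrees at most 2 dg *)

Section Bandwidth.
(* The graph joining vertices of [A0] at distance at most [dg]. *)
Variables (n0 dg : nat).
Hypothesis n0n : (n0 <= n)%N.
Definition A0 : {set 'I_n} := [set i : 'I_n | (i < n0)%N].
Definition band : {set edge n} :=
  [set e : edge n | (val e \subset A0) && [exists i in val e, exists j in val e, (i < j <= i + dg)%N]].
Let near (x : 'I_n) : {set 'I_n} := [set y : 'I_n | (x.+1 <= y < x.+1 + dg)%N] :|: [set y : 'I_n | (x - dg <= y < x)%N].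

Lemma band_sub e : e \in band -> val e \subset A0.
Proof. by rewrite inE => /andP[]. Qed.

Lemma card_band_at x : (#|[set e : edge n in band | x \in val e]| <= 2 * dg)%N.
Proof.
apply: (@leq_trans #|star x (near x)|).
  apply: subset_leq_card; apply/subsetP => e; rewrite !inE => /andP[/andP[_]].
  move=> /existsP[i /andP[ie /existsP[j /andP[je hij]]]] xe.
  rewrite xe /=; apply/set0Pn.
  have : (x == i) || (x == j).
    have ij : i != j by apply: contraTneq hij => ->; lia.
    have : [set i; j] == val e.
      by rewrite eqEcard card_edge cards2 ij andbT; apply/subsetP => y; rewrite !inE => /orP[]/eqP ->.
    by move=> /eqP h; move: xe; rewrite -h !inE.
  case/orP => /eqP xE; [exists j|exists i]; rewrite !inE xE ?ie ?je /=; lia.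
rewrite card_star; last by rewrite !inE; lia.
rewrite mul2n -addnn; have [h _] := leq_card_setU [set y : 'I_n | (x.+1 <= y < x.+1 + dg)%N] [set y : 'I_n | (x - dg <= y < x)%N].
apply: leq_trans h _; apply: leq_add; first exact: card_ord_itv_le.
apply: leq_trans (card_ord_itv_le n (x - dg) dg); apply: subset_leq_card.
by apply/subsetP => y; rewrite !inE; lia.
Qed.

Lemma card_band : #|band| = (\sum_(x : 'I_n) #|[set y : 'I_n | (x < y <= x + dg) && (y < n0)]|)%N.
Proof.
pose X := [set u : 'I_n * 'I_n | (u.1 < u.2 <= u.1 + dg)%N && (u.2 < n0)%N].
transitivity #|X|; last first.
  rewrite -sum1_card (eq_bigl (fun u : 'I_n * 'I_n => (u.1 < u.2 <= u.1 + dg)%N && (u.2 < n0)%N)); last first.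
    by move=> u; rewrite inE.
  rewrite -(pair_big_dep xpredT (fun x y : 'I_n => (x < y <= x + dg)%N && (y < n0)%N) (fun _ _ => 1%N)) /=.
  by apply: eq_bigr => x _; rewrite -sum1_card; apply: eq_bigl => y; rewrite inE.
rewrite -(@card_imset _ _ (val : edge n -> _)); last exact: val_inj.
rewrite -(@card_in_imset _ _ (fun u => [set u.1; u.2]) X); last first.
  move=> [x y] [x' y']; rewrite !inE /= => h1 h2 /setP h.
  have := h x; have := h y; rewrite !inE !eqxx orbT /=.
  move=> /esym/orP[]/eqP e1 /esym/orP[]/eqP e2.
  - by exfalso; move: h1; rewrite e1 e2; lia.
  - by exfalso; move: h1 h2; rewrite e1 e2; lia.
  - by rewrite e1 e2.
  - by exfalso; move: h1; rewrite e1 e2; lia.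
congr #|pred_of_set _|; apply/setP => B; apply/imsetP/imsetP.
  move=> [e]; rewrite inE => /andP[eA /existsP[i /andP[ie /existsP[j /andP[je hij]]]]] ->.
  exists (i, j); first by rewrite inE /= hij; move: (subsetP eA j je); rewrite inE.
  have ij : i != j by apply: contraTneq hij => ->; lia.
  apply/esym/eqP; rewrite eqEcard card_edge cards2 ij andbT /=.
  by apply/subsetP => y; rewrite !inE => /orP[]/eqP ->.
move=> [[i j]]; rewrite inE /= => /andP[hij jn] ->.
have B2 : #|[set i; j]| == 2 by rewrite cards2; have -> : i != j by apply: contraTneq hij => ->; lia.
exists (Sub [set i; j] B2) => //; rewrite inE /=; apply/andP; split.
  by apply/subsetP => y; rewrite !inE => /orP[]/eqP -> //; lia.
apply/existsP; exists i; rewrite !inE eqxx /=; apply/existsP; exists j.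
by rewrite !inE eqxx orbT.
Qed.

Lemma card_band_le : (#|band| <= n * dg)%N.
Proof.
rewrite card_band -[n in leqRHS]card_ord -sum_nat_const; apply: leq_sum => x _.
apply: leq_trans (card_ord_itv_le n x.+1 dg); apply: subset_leq_card.
by apply/subsetP => y; rewrite !inE; lia.
Qed.

Lemma card_band_ge : ((n0 - dg) * dg <= #|band|)%N.
Proof.
rewrite card_band.
apply: leq_trans (_ : \sum_(x in [set y : 'I_n | (0 <= y < 0 + (n0 - dg))%N]) dg <= _)%N.
  by rewrite sum_nat_const leq_mul2r card_ord_itv_ge ?orbT //; lia.
rewrite [leqLHS]big_mkcond /=; apply: leq_sum => x _; case: ifP => // hx.
rewrite inE in hx.
apply: leq_trans (card_ord_itv_ge (n := n) (a := x.+1) (k := dg) _) _; first by lia.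
apply: subset_leq_card; apply/subsetP => y; rewrite !inE; lia.
Qed.
End Bandwidth.
End Cliques.

Lemma disj_unzip (T : finType) (l : seq ({set T} * {set T})) :
  disj l = pairwise (fun U V : {set T} => [disjoint U & V]) (unzip1 l).
Proof. by rewrite /disj /unzip1 pairwise_map. Qed.

Lemma in_covP (T : finType) (l : seq ({set T} * {set T})) (e : T) :
  reflect (exists2 x, x \in l & e \in x.1) (e \in cov l).
Proof.
rewrite /cov; elim: l => [|x l IH]; first by rewrite big_nil inE; constructor; case.
rewrite big_cons inE; apply: (iffP orP) => [[ex|/IH[y yl ey]]|[y]].
- by exists x; rewrite ?mem_head.
- by exists y; rewrite // inE yl orbT.
by rewrite inE => /orP[/eqP ->|yl ey]; [left|right; apply/IH; exists y].
Qed.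

(** * The decoupled clique count *)

Section Blocks.
Variables (R : realType) (n r : nat).
Implicit Types (Y Z Q : {set 'I_n}) (e : edge n) (A : rset n r) (H : graph n).
Variables (AA : {set 'I_n}) (Zs : seq {set 'I_n}) (H0 : graph n) (Gs : seq (graph n)).
Hypothesis subZ : all (fun Z => Z \subset ~: AA) Zs.
Hypothesis disjZ : pairwise (fun Z Z' => [disjoint Z & Z']) Zs.
Hypothesis sizeG : size Gs = size Zs.

(** The edges joining [AA] to [Z]. Edges within the complement of [AA] are frozen as [H0], and edges
    inside [AA] are never resampled, so they remain free for the linearization. *)
Definition blk Z : {set edge n} :=
  [set e : edge n | (val e :&: AA != set0) && (val e :&: Z != set0)].
Definition blks := zip (map blk Zs) Gs.
Let l := blks.
Definition inner := EE (~: AA).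
Definition tA (A : rset n r) (H : graph n) : R :=
  mono R (EE (val A) :&: inner) H0 * dls l (mono R (EE (val A) :\: inner)) H.
(** Support of the term [tA A]: empty when [A] misses a block, because the term then vanishes
    ([tA_miss]). This is the gain from decoupling. *)
Definition FFA (A : rset n r) : {set edge n} :=
  if hits Zs (val A) then EE (val A) :\: inner else set0.

Lemma unzip1_blks : unzip1 blks = map blk Zs.
Proof. by rewrite /blks unzip1_zip // size_map sizeG. Qed.

Lemma size_blks : size blks = size Zs.
Proof. by rewrite /blks size_zip size_map sizeG minnn. Qed.

Lemma blks_in x : x \in blks -> exists2 Z, Z \in Zs & x.1 = blk Z.
Proof. by move=> /(map_f fst); rewrite -/unzip1 -/(unzip1 blks) unzip1_blks => /mapP. Qed.

Lemma edge_two e x y : x \in val e -> y \in val e -> x != y -> val e = [set x; y].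
Proof.
move=> xe ye xy; apply/esym/eqP; rewrite eqEcard card_edge cards2 xy andbT.
by apply/subsetP => z; rewrite !inE => /orP[]/eqP ->.
Qed.

Lemma disjoint_blk Z Z' : Z \subset ~: AA -> Z' \subset ~: AA -> [disjoint Z & Z'] ->
  [disjoint blk Z & blk Z'].
Proof.
move=> sZ sZ' dZ; rewrite -setI_eq0; apply/eqP/setP => e; rewrite !inE; apply/negP.
case/andP => /andP[/set0Pn[a] ha /set0Pn[z] hz] /andP[_ /set0Pn[z'] hz'].
move: ha hz hz'; rewrite !inE => /andP[ae aA] /andP[ze zZ] /andP[ze' zZ'].
have zA : z \notin AA by have := subsetP sZ z zZ; rewrite inE.
have zA' : z' \notin AA by have := subsetP sZ' z' zZ'; rewrite inE.
have az : a != z by apply: contraNneq zA => <-.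
move: ze'; rewrite (edge_two ae ze az) !inE => /orP[]/eqP h.
  by rewrite h aA in zA'.
by have := disjointFr dZ zZ; rewrite -h zZ'.
Qed.

Lemma disj_blks : disj blks.
Proof.
rewrite disj_unzip unzip1_blks pairwise_map.
apply: sub_in_pairwise disjZ; rewrite -?all_predI; last exact: subZ.
by move=> Z Z' sZ sZ' dZ; apply: disjoint_blk.
Qed.

Lemma cov_blks_inner e : val e \subset AA -> e \notin cov l.
Proof.
move=> eA; apply/negP => /in_covP[x xl ex].
have [Z ZZ xZ] := blks_in xl; move: ex; rewrite xZ inE => /andP[_ /set0Pn[z]].
rewrite inE => /andP[ze zZ]; have := subsetP (allP subZ Z ZZ) z zZ.
by rewrite inE (subsetP eA).
Qed.

Lemma dls_cliques (s : R) H :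
  dls l (fun H => s * cliques R r (mix inner H0 H)) H = s * \sum_(A : rset n r) tA A H.
Proof.
rewrite dls_scale; congr (_ * _).
rewrite (eq_dls (f2 := fun H => \sum_(A : rset n r) mono R (EE (val A) :&: inner) H0 *
   mono R (EE (val A) :\: inner) H)) ?dls_sum // => H'.
by rewrite cliquesE; apply: eq_bigr => A _; rewrite mono_mix.
Qed.

Let prodA (A : rset n r) H : R :=
  \prod_(x <- l) (mono R ((EE (val A) :\: inner) :&: x.1) H -
                  mono R ((EE (val A) :\: inner) :&: x.1) x.2).

Lemma tAE A H : tA A H = mono R (EE (val A) :&: inner) H0 *
  (mono R ((EE (val A) :\: inner) :\: cov l) H * prodA A H).
Proof. by rewrite /tA dls_mono // disj_blks. Qed.

Lemma norm_prodA A H : `|prodA A H| <= 1.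
Proof.
rewrite /prodA; elim/big_ind: _ => [|x y hx hy|x _]; first by rewrite normr1.
  by rewrite normrM -[leRHS]mulr1 ler_pM.
rewrite ler_norml; have := mono_le1 R ((EE (val A) :\: inner) :&: x.1) H.
have := mono_le1 R ((EE (val A) :\: inner) :&: x.1) x.2.
have := mono_ge0 R ((EE (val A) :\: inner) :&: x.1) H.
have := mono_ge0 R ((EE (val A) :\: inner) :&: x.1) x.2.
by move: (mono _ _ _) (mono _ _ _) => a b; lra.
Qed.

Lemma tA_miss A H : ~~ hits Zs (val A) -> tA A H = 0.
Proof.
rewrite /hits -has_predC => /hasP[Z ZZ /=]; rewrite negbK => /eqP AZ.
rewrite tAE; suff -> : prodA A H = 0 by rewrite !mulr0.
have : blk Z \in unzip1 blks by rewrite unzip1_blks map_f.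
move=> /mapP[x xl xZ]; rewrite /prodA; apply/eqP; rewrite prodf_seq_eq0.
apply/hasP; exists x => //=; rewrite -xZ.
suff -> : (EE (val A) :\: inner) :&: blk Z = set0 by rewrite /mono !sub0set subrr.
apply/setP => e; rewrite !inE; apply/negP => /andP[/andP[_ eA] /andP[_ /set0Pn[z]]].
rewrite inE => /andP[ze zZ]; have : z \in val A :&: Z by rewrite inE (subsetP eA z ze).
by rewrite AZ inE.
Qed.

Lemma dep_tA A : dep (FFA A) (tA A).
Proof.
rewrite /FFA; case: (boolP (hits Zs (val A))) => hA; last first.
  by move=> G H; rewrite !tA_miss.
move=> G H; rewrite !tAE; congr (_ * (_ * _)).
  by apply: (dep_sub _ (@dep_mono R _ _)); rewrite subsetDl.
rewrite /prodA; apply: eq_bigr => x _; congr (_ - _).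
by apply: (dep_sub _ (@dep_mono R _ _)); rewrite subsetIl.
Qed.

Lemma norm_tA A H : `|tA A H| <= 1.
Proof.
rewrite tAE mulrA normrM -[leRHS]mulr1 ler_pM // ?norm_prodA //.
by rewrite ger0_norm ?mulr_ge0 ?mono_ge0 // -[leRHS]mulr1 ler_pM ?mono_ge0 ?mono_le1.
Qed.

Lemma card_FFA A : (#|FFA A| <= r ^ 2)%N.
Proof.
rewrite /FFA; case: ifP => _; last by rewrite cards0.
apply: leq_trans (subset_leq_card (subsetDl _ _)) _.
by rewrite card_EE (eqP (valP A)) bin_le_exp.
Qed.

Lemma incr_tA A e H : val e \subset AA -> `|incr (tA A) e H| <= (e \in FFA A)%:R.
Proof.
move=> eA; case: (boolP (e \in FFA A)) => eF; last first.
  by rewrite (incr0 _ (@dep_tA A) eF) normr0.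
rewrite /incr !tAE.
have -> : prodA A (e |: H) = prodA A (H :\ e).
  rewrite /prodA !big_seq; apply: eq_bigr => x xl; congr (_ - _).
  apply: (dep_eq (@dep_mono R _ _)) => y; rewrite !inE => /andP[_ yx].
  case: eqP => // ye; have := cov_blks_inner eA; rewrite -ye => /negP[].
  by apply/in_covP; exists x.
rewrite -mulrBr -mulrBl !normrM -[leRHS]mulr1 ler_pM //.
  by rewrite ger0_norm ?mono_ge0 ?mono_le1.
rewrite -[leRHS]mulr1 ler_pM ?norm_prodA //.
rewrite ler_norml; set X := _ :\: cov l.
have := mono_le1 R X (e |: H); have := mono_le1 R X (H :\ e).
have := mono_ge0 R X (e |: H); have := mono_ge0 R X (H :\ e).
by move: (mono _ _ _) (mono _ _ _) => a b; lra.
Qed.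

(** Bound for the number of r-sets that meet every block: n^r choices, thinned by |Z|/n for each
    block. *)
Definition PP : R := (\prod_(Z <- Zs) #|Z|)%N%:R * n%:R ^+ r / n%:R ^+ size Zs.

Lemma PP_ge0 : 0 <= PP.
Proof. by rewrite /PP divr_ge0 ?mulr_ge0 ?exprn_ge0. Qed.

Hypothesis n_gt0 : (0 < n)%N.

Lemma sum_hits Y : Y \subset AA ->
  \sum_(A : rset n r) ((Y \subset val A) && hits Zs (val A))%:R <= PP / n%:R ^+ #|Y|.
Proof.
move=> YA; have hp : pairwise (fun Z Z' => [disjoint Z & Z']) (Y :: Zs).
  rewrite /= disjZ andbT; apply/allP => Z ZZ; rewrite -setI_eq0 -subset0.
  apply/subsetP => x; rewrite inE => /andP[xY xZ].
  by have := subsetP (allP subZ Z ZZ) x xZ; rewrite inE (subsetP YA).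
have n0 : 0 < n%:R :> R by rewrite ltr0n.
have := card_hits r hp; rewrite -(ler_nat R) !natrM !natrX exprD => h.
rewrite (sum_rset r (fun B => ((Y \subset B) && hits Zs B)%:R)) /PP.
have -> : \sum_(A : {set 'I_n} | #|A| == r) ((Y \subset A) && hits Zs A)%:R =
   #|[set A : {set 'I_n} | [&& #|A| == r, Y \subset A & hits Zs A]]|%:R :> R.
  rewrite -sum1dep_card natr_sum big_mkcondr /=; apply: eq_bigr => A _.
  by case: (_ && _).
rewrite -[leRHS]mulrA -invfM ler_pdivlMr; first by rewrite [X in _ * X]mulrC.
by rewrite mulr_gt0 ?exprn_gt0.
Qed.

Variables (S : {set edge n}) (dg : nat).
Hypothesis subS : forall e, e \in S -> val e \subset AA.
Hypothesis degS : forall x, (#|[set e : edge n in S | x \in val e]| <= 2 * dg)%N.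
Hypothesis cardS : (#|S| <= n * dg)%N.

(** Bound for the pair counts at [e], which has k vertices in [AA]. At most n dg edges of [S] are
    disjoint from [e], and each lies with it in at most PP/n^(k+2) active sets; at most 4 dg edges
    of [S] touch it, with PP/n^(k+1) sets each. Together this gives the factor 5. An edge outside
    [AA] is frozen and counts zero. *)
Definition cc e : R :=
  if val e \subset ~: AA then 0 else 5 * dg%:R * PP / n%:R ^+ #|val e :&: AA|.+1.

Lemma sum_incr_tA e H : e \in S ->
  `|incr (fun H => \sum_A tA A H) e H| <= PP / n%:R ^+ 2.
Proof.
move=> eS; rewrite incr_sum; apply: le_trans (ler_norm_sum _ _ _) _.
have := sum_hits (subS eS); rewrite (card_edge e); apply: le_trans.
apply: ler_sum => A _; apply: le_trans (incr_tA _ _ (subS eS)) _; rewrite ler_nat /FFA.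
case: (hits Zs (val A)); rewrite !inE ?andbT ?andbF //; case: (val e \subset val A); rewrite ?andbF //; exact: leq_b1.
Qed.

Lemma pair_count e : \sum_(e' in S | e' != e) \sum_A ((e \in FFA A) && (e' \in FFA A))%:R <= cc e.
Proof.
rewrite /cc; case: ifPn => [eD|eD].
  rewrite big1 // => e' _; rewrite big1 // => A _; rewrite /FFA.
  by case: ifP => _; rewrite ?inE // eD.
set k := #|val e :&: AA|.
have n0 : 0 < n%:R :> R by rewrite ltr0n.
have P0 := PP_ge0.
have one e' : e' \in S -> e' != e ->
   \sum_A ((e \in FFA A) && (e' \in FFA A))%:R <=
   PP / n%:R ^+ k.+2 + (val e' :&: (val e :&: AA) != set0)%:R * (PP / n%:R ^+ k.+1).
  move=> e'S ne.
  have YA : val e' :|: (val e :&: AA) \subset AA by rewrite subUset subS // subsetIr.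
  apply: le_trans (_ : _ <= PP / n%:R ^+ #|val e' :|: (val e :&: AA)|) _.
    apply: le_trans (sum_hits YA); apply: ler_sum => A _; rewrite ler_nat /FFA.
    case: (hits Zs (val A)); rewrite ?inE // ?andbT andbC.
    case: (boolP (_ && _)) => // /andP[/andP[_ h1] /andP[_ h2]].
    by rewrite subUset h1 (subset_trans (subsetIl _ _) h2).
  rewrite cardsU card_edge -/k; case: eqP => [->|/eqP ne0] /=.
    by rewrite cards0 subn0 mul0r addr0.
  have -> : #|val e' :&: (val e :&: AA)| = 1%N.
    apply/eqP; rewrite eqn_leq card_gt0 ne0 andbT -ltnS.
    have := @proper_card _ (val e' :&: (val e :&: AA)) (val e').
    rewrite card_edge; apply; rewrite properEneq subsetIl andbT.
    apply: contra ne => /eqP h; apply/eqP/val_inj/eqP; rewrite eqEcard !card_edge leqnn andbT.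
    by rewrite -h; apply: subset_trans (subsetIr _ _) (subsetIl _ _).
  rewrite addSn subn1 /= add1n mul1r lerDr divr_ge0 // exprn_ge0 //.
apply: le_trans (_ : _ <= \sum_(e' in S) (PP / n%:R ^+ k.+2 +
    (val e' :&: (val e :&: AA) != set0)%:R * (PP / n%:R ^+ k.+1))) _.
  rewrite big_mkcondr; apply: ler_sum => e' e'S; case: ifP => ne; first by apply: one.
  by rewrite addr_ge0 ?mulr_ge0 ?divr_ge0 ?exprn_ge0 ?invr_ge0.
rewrite big_split /= sumr_const -mulr_suml -[_ *+ #|S|]mulr_natl.
have cnt : \sum_(e' in S) (val e' :&: (val e :&: AA) != set0)%:R <= 4 * dg%:R :> R.
  rewrite -natrM -natr_sum ler_nat.
  apply: (@leq_trans (\sum_(x in val e :&: AA) #|[set e' : edge n in S | x \in val e']|)%N).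
    apply: leq_trans (_ : #|\bigcup_(x in val e :&: AA) [set e' : edge n in S | x \in val e']| <= _)%N;
      last exact: card_bigcup_le.
    rewrite -big_mkcondr sum1dep_card; apply: subset_leq_card; apply/subsetP => e'.
    rewrite inE => /andP[e'S /set0Pn[x]]; rewrite inE => /andP[xe' xe].
    by apply/bigcupP; exists x => //; rewrite inE e'S.
  apply: (@leq_trans (\sum_(x in val e :&: AA) 2 * dg)%N); first by apply: leq_sum => x _; exact: degS.
  rewrite sum_nat_const; have : (#|val e :&: AA| <= 2)%N.
    have := subset_leq_card (subsetIl (val e) AA); by rewrite card_edge.
  by nia.
have q0 : 0 <= PP / n%:R ^+ k.+1 by rewrite divr_ge0 ?exprn_ge0.
have e1 : PP / n%:R ^+ k.+2 = (PP / n%:R ^+ k.+1) / n%:R.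
  by rewrite -mulrA -invfM -exprSr.
have cS : #|S|%:R <= n%:R * dg%:R :> R by rewrite -natrM ler_nat.
have -> : 5 * dg%:R * PP / n%:R ^+ k.+1 = 5 * dg%:R * (PP / n%:R ^+ k.+1) by rewrite mulrA.
rewrite e1; move: (PP / n%:R ^+ k.+1) q0 => q q0.
have h1 : #|S|%:R * (q / n%:R) <= dg%:R * q.
  rewrite mulrA ler_pdivrMr // -mulrA [q * _]mulrC mulrA [dg%:R * _]mulrC.
  by rewrite ler_wpM2r.
have h2 := ler_wpM2r q0 cnt.
apply: le_trans (lerD h1 h2) _; rewrite le_eqVlt; apply/orP; left; apply/eqP; ring.
Qed.
End Blocks.

(** * Riesz products as bounded test functions *)

Section RieszTest.
Variables (R : realType) (T : finType) (p : R).
Hypotheses (p0 : 0 <= p) (p1 : p <= 1).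
Implicit Types (U V W F G H : {set T}).

Lemma Ex_Im (F : {set T} -> R[i]) : Ex p (fun G => complex.Im (F G)) = complex.Im (Ex p%:C F).
Proof.
rewrite /Ex (_ : complex.Im (\sum_G _) = \sum_G complex.Im (bw p%:C G * F G)).
  by apply: eq_bigr => G _; rewrite bw_real; case: (F G) => a b /=; rewrite mul0r addr0.
by elim/big_rec2: _ => // G x y _ <-; case: y; case: (_ * _).
Qed.

(** A Riesz product has mean 1, so its imaginary part [psiW] has mean 0. To first order it is [lam]
    times the sum of the centred edges of [W], but it stays bounded as long as lam^2 |W| does, which
    that sum does not. *)
Definition riesz (lam : R) W H : R[i] :=
  \prod_(x in W) (1 +i* (lam * ((x \in H)%:R - p))).
Definition psiW lam W H : R := complex.Im (riesz lam W H).

Lemma dep_psiW lam W : dep W (psiW lam W).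
Proof.
move=> G H; congr complex.Im; apply: eq_bigr => x xW; by rewrite in_mix xW.
Qed.

Lemma Ex_mono_riesz lam W F :
  Ex p%:C (fun H => (mono R F H)%:C * riesz lam W H) =
  (p ^+ #|F|)%:C * (1 +i* (lam * (1 - p))) ^+ #|F :&: W|.
Proof.
pose ph x (b : bool) : R[i] :=
  (if x \in F then (b%:R : R)%:C else 1) *
  (if x \in W then (1 +i* (lam * (b%:R - p))) else 1).
rewrite (eq_Ex _ (F2 := fun H => \prod_x ph x (x \in H))); last first.
  move=> H; rewrite big_split /=; congr (_ * _); last by rewrite /riesz big_mkcond.
  rewrite /mono; case: (boolP (F \subset H)) => [/subsetP FH|/subsetPn[x xF xH]].
    by rewrite big1 // => x _; case: ifP => // /FH ->.
  by rewrite (bigD1 x) //= xF (negPf xH) mul0r.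
rewrite Ex_prod.
have -> : (p ^+ #|F|)%:C = \prod_x (if x \in F then p%:C else 1).
  by rewrite rmorphXn -prodr_const big_mkcond.
have -> : (1 +i* (lam * (1 - p))) ^+ #|F :&: W| =
    \prod_x (if x \in F :&: W then 1 +i* (lam * (1 - p)) else 1).
  by rewrite -prodr_const big_mkcond.
rewrite -big_split /=.
apply: eq_bigr => x _; rewrite /ph inE.
case: (x \in F); case: (x \in W) => /=; rewrite ?mulr1 ?mul1r ?mulr0 ?mul0r ?addr0 //.
- by apply/eqP; rewrite eq_complex /=; apply/andP; split; apply/eqP; ring.
- by apply/eqP; rewrite eq_complex /=; apply/andP; split; apply/eqP; ring.
- by rewrite addrC subrK.
Qed.

Lemma Ex_mono_psiW lam W F :
  Ex p (fun H => mono R F H * psiW lam W H) =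
  p ^+ #|F| * complex.Im ((1 +i* (lam * (1 - p))) ^+ #|F :&: W|).
Proof.
rewrite (eq_Ex _ (F2 := fun H => complex.Im ((mono R F H)%:C * riesz lam W H))); last first.
  by move=> H; rewrite /psiW; case: (riesz _ _ _) => a b /=; rewrite mul0r addr0.
by rewrite Ex_Im Ex_mono_riesz; case: ((1 +i* _) ^+ _) => a b /=; rewrite mul0r addr0.
Qed.

Lemma Ex_psiW lam W : Ex p (psiW lam W) = 0.
Proof.
have := Ex_mono_psiW lam W set0; rewrite set0I cards0 expr0 mulr0 => <-.
by apply: eq_Ex => H; rewrite /mono sub0set mul1r.
Qed.

Lemma psiW_le2 lam W H : lam ^+ 2 * #|W|%:R <= 1 / 4 -> `|psiW lam W H| <= 2.
Proof.
move=> hl; apply: le_trans (_ : nc (riesz lam W H) <= _).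
  rewrite /psiW; case: (riesz _ _ _) => a b /=; rewrite -sqrtr_sqr ler_sqrt ?addr_ge0 ?sqr_ge0 //.
  by rewrite lerDr sqr_ge0.
rewrite -(@ler_pXn2r _ 2) ?nnegrE ?normc_ge0 //.
apply: (@le_trans _ _ (expR (lam ^+ 2 * #|W|%:R))).
  rewrite mulr_natr -sumr_const expR_sum /riesz.
  elim/big_rec2: _ => [|x y z xW h]; first by rewrite ComplexField.Normc.normc1 expr1n.
  rewrite ComplexField.Normc.normcM exprMn ler_pM ?sqr_ge0 //.
  rewrite /= sqr_sqrtr ?addr_ge0 ?sqr_ge0 // expr1n; apply: le_trans (expR_ge1Dx _).
  rewrite lerD2l exprMn ler_piMr ?sqr_ge0 //.
  have v0 : 0 <= p * (1 - p) by rewrite mulr_ge0 ?subr_ge0.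
  by case: (x \in H); rewrite /= ?sub0r ?sqrrN expr2; nra.
have h := expR_ge1Dx (- (1 / 4) : R); rewrite expRN in h.
have e0 := @expR_gt0 R (1 / 4).
apply: (@le_trans _ _ (expR (1 / 4))); first by rewrite ler_expR.
have : 3 / 4 * expR (1 / 4) <= (expR (1 / 4))^-1 * expR (1 / 4) :> R.
  by apply: ler_wpM2r; [exact: ltW | lra].
by rewrite mulVf ?gt_eqF // expr2; lra.
Qed.

(** The argument of 1 + iy is at most y, so the k-th power has argument at most ky <= 1 and stays in
    the upper half plane. *)
Lemma Im_exp_ge0 (y : R) k : 0 <= y -> k%:R * y <= 1 -> 0 <= complex.Im ((1 +i* y) ^+ k).
Proof.
move=> y0 hk.
(* Bounds on both parts replace the argument, and make the induction close. *)
suff : [/\ 0 <= complex.Im ((1 +i* y) ^+ k), complex.Im ((1 +i* y) ^+ k) <= k%:R * y,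
   1 - (k%:R * y) ^+ 2 <= complex.Re ((1 +i* y) ^+ k) & complex.Re ((1 +i* y) ^+ k) <= 1] by case.
elim: k hk => [|k IH] hk.
  by rewrite expr0 /= mul0r expr0n /= subr0.
have ky : k%:R * y <= 1 by apply: le_trans hk; rewrite ler_wpM2r // ler_nat.
have [h1 h2 h3 h4] := IH ky; rewrite exprS.
move: h1 h2 h3 h4; case: (_ ^+ k) => a b /= h1 h2 h3 h4.
have k0 : 0 <= k%:R :> R by [].
have ky0 : 0 <= k%:R * y by rewrite mulr_ge0.
have a0 : 0 <= a by apply: le_trans h3; rewrite subr_ge0 expr_le1.
rewrite !mul1r -natr1.
have yb : y * b <= y * (k%:R * y) by rewrite ler_wpM2l.
have yb0 : 0 <= y * b by rewrite mulr_ge0.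
have ya0 : 0 <= y * a by rewrite mulr_ge0.
have ya1 : y * a <= y by rewrite ler_piMr.
split; rewrite ?addr_ge0 //; first by lra.
  have : 0 <= y * (k%:R * y) + y * y by rewrite addr_ge0 ?mulr_ge0.
  by rewrite !expr2 in h3 *; lra.
lra.
Qed.

Lemma Ex_mono_prod F (l : seq ({set T} * {set T})) (psi : {set T} -> {set T} -> R) :
  disj l -> (forall x, x \in l -> dep x.1 (psi x.1)) ->
  Ex p (fun H => mono R F H * \prod_(x <- l) psi x.1 H) =
  p ^+ #|F :\: cov l| * \prod_(x <- l) Ex p (fun H => mono R (F :&: x.1) H * psi x.1 H).
Proof.
elim: l F => [|[U G] l IH] F /=.
  rewrite /cov !big_nil setD0 mulr1 => _ _; rewrite -Ex_mono.
  by apply: eq_Ex => H; rewrite big_nil mulr1.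
case/andP => hU hl hpsi; have dU := disj_cov hU.
have hpsi' x : x \in l -> dep x.1 (psi x.1) by move=> xl; apply: hpsi; rewrite inE xl orbT.
rewrite (eq_Ex _ (F2 := fun H => (mono R (F :&: U) H * psi U H) *
   (mono R (F :\: U) H * \prod_(x <- l) psi x.1 H))); last first.
  by move=> H; rewrite big_cons (monoID R F U) /=; ring.
rewrite (@Ex_indep _ _ p U); first last.
- apply: dep_op2.
    by apply: (dep_sub _ (@dep_mono R _ _)); rewrite setDE subsetIr.
  move=> G1 G2; rewrite !big_seq; apply: eq_bigr => x xl.
  by apply: (dep_sub _ (hpsi' x xl)); rewrite -disjoints_subset disjoint_sym (allP hU).
- apply: dep_op2; last exact: (hpsi (U, G) (mem_head _ _)).
  by apply: (dep_sub _ (@dep_mono R _ _)); rewrite subsetIr.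
rewrite IH // big_cons /= /cov big_cons -/(cov l) setDDl mulrCA; congr (_ * (_ * _)).
rewrite !big_seq; apply: eq_bigr => x xl; apply: eq_Ex => H; congr (mono R _ H * _).
apply/setP => y; rewrite !inE; case: (boolP (y \in x.1)) => yx; rewrite ?andbF // !andbT.
by rewrite (disjointFl (allP hU x xl) yx).
Qed.

Lemma dls_incr (l : seq ({set T} * {set T})) (f : {set T} -> R) e H : e \notin cov l ->
  incr (dls l f) e H = dls l (incr f e) H.
Proof.
elim: l H => [|[U G] l IH] H //=; rewrite /cov big_cons inE negb_or /= => /andP[eU el].
rewrite /dl -!IH // /incr.
have -> : mix U G (e |: H) = e |: mix U G H.
  by apply/setP => x; rewrite !(in_mix, in_setU1); case: eqP => [->|_] //=; rewrite (negPf eU).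
have -> : mix U G (H :\ e) = mix U G H :\ e.
  by apply/setP => x; rewrite !(in_mix, in_setD1); case: eqP => [->|_] //=; rewrite (negPf eU).
ring.
Qed.

Lemma incr_mono F e H : incr (mono R F) e H = (e \in F)%:R * mono R (F :\ e) H.
Proof.
rewrite /incr; case: (boolP (e \in F)) => eF; last first.
  by rewrite mul0r -/(incr _ _ _) (incr0 _ (@dep_mono R _ F) eF).
rewrite mul1r [X in _ - X](_ : _ = 0) ?subr0; last first.
  rewrite /mono (_ : _ \subset _ = false) //; apply/negP => /subsetP /(_ e eF).
  by rewrite !inE eqxx.
congr ((_ : bool)%:R); apply/subsetP/subsetP => h x.
  by rewrite inE => /andP[xe /h]; rewrite !inE (negPf (_ : x != e)) //; rewrite inE in xe.
by move=> xF; rewrite !inE; case: eqP => //= /eqP xe; apply: h; rewrite !inE xe.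
Qed.
End RieszTest.

(** * Lower bound for the mean derivative of the decoupled count *)

Section LowerBound.
Variables (R : realType) (n r : nat) (p : R).
Hypotheses (p0 : 0 <= p) (p1 : p <= 1) (r2 : (2 <= r)%N).
Implicit Types (Y Z Q B C : {set 'I_n}) (e : edge n) (A : rset n r) (H : graph n).
Variables (AA : {set 'I_n}) (Zs : seq {set 'I_n}) (H0 : graph n) (Gs : seq (graph n)).
Hypothesis subZ : all (fun Z => Z \subset ~: AA) Zs.
Hypothesis disjZ : pairwise (fun Z Z' => [disjoint Z & Z']) Zs.
Hypothesis sizeG : size Gs = size Zs.
Variable CC : {set {set 'I_n}}.
Hypothesis CC_sub : forall C, C \in CC -> C \subset ~: AA.
Hypothesis CC_card : forall C, C \in CC -> #|C| = size Zs.
Hypothesis CC_clique : forall C, C \in CC -> EE C \subset H0.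
Hypothesis CC_hit : forall C Z, C \in CC -> Z \in Zs -> #|C :&: Z| = 1%N.
Hypothesis dr : (size Zs + 2 <= r)%N.
Let d := size Zs.
Let l := blks AA Zs Gs.
Let inn := inner AA.
Variables (e : edge n) (a : 'I_n).
Hypothesis eA : val e \subset AA.
Hypothesis ae : a \in val e.
Let aA : a \in AA. Proof. exact: (subsetP eA). Qed.

Let rowa (U : {set edge n}) : {set edge n} := [set x : edge n in U | a \in val x].
(** Here lam^2 times the row size is 1/r^2 <= 1/4, so the test function is at most 2. Also lam <=
    1/r, which keeps all pairings nonnegative, since an r-set has at most r edges in a row. For an
    empty row the inverse of 0 gives lam = 0. *)
Let lamU (U : {set edge n}) : R := (r%:R * Num.sqrt #|rowa U|%:R)^-1.
Let psi (U : {set edge n}) := psiW p (lamU U) (rowa U).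

Let rowa_blk Z : rowa (blk AA Z) = star a Z.
Proof.
apply/setP => x; rewrite !inE andbC; case: (boolP (a \in val x)) => //= ax.
suff -> : val x :&: AA != set0 by [].
by apply/set0Pn; exists a; rewrite inE ax aA.
Qed.

Let a_notin Z : Z \in Zs -> a \notin Z.
Proof.
by move=> ZZ; apply/negP => /(subsetP (allP subZ Z ZZ)); rewrite inE aA.
Qed.

Let r0 : 0 < r%:R :> R. Proof. by rewrite ltr0n; lia. Qed.

Let lam_ge0 U : 0 <= lamU U.
Proof. by rewrite invr_ge0 mulr_ge0 ?sqrtr_ge0. Qed.

Let lam_sq U : lamU U ^+ 2 * #|rowa U|%:R <= 1 / 4.
Proof.
rewrite /lamU exprVn exprMn sqr_sqrtr //.
have [->|c0] := eqVneq #|rowa U| 0%N; first by rewrite mulr0; lra.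
have c1 : 0 < #|rowa U|%:R :> R by rewrite ltr0n lt0n.
rewrite invfM -mulrA mulVf ?gt_eqF // mulr1 div1r lef_pV2 ?posrE ?exprn_gt0 //.
have : 2 <= r%:R :> R by rewrite ler_nat.
by rewrite expr2; nra.
Qed.

Let lam_le U : lamU U <= r%:R^-1.
Proof.
rewrite /lamU; have [->|c0] := eqVneq #|rowa U| 0%N.
  by rewrite sqrtr0 mulr0 invr0 invr_ge0.
rewrite lef_pV2 ?posrE // ?mulr_gt0 ?sqrtr_gt0 ?ltr0n ?lt0n //.
rewrite ler_peMr ?(ltW r0) // -[X in X <= _]sqrtr1 ler_sqrt ?ler1n ?lt0n //.
by lia.
Qed.

Let psi_le2 U H : `|psi U H| <= 2.
Proof. exact: psiW_le2. Qed.

Let dep_psi U : dep U (psi U).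
Proof.
by apply: (dep_sub _ (@dep_psiW R _ p _ _)); apply/subsetP => x; rewrite inE => /andP[].
Qed.

Let prod_psi_le H : `|\prod_(x <- l) psi x.1 H| <= 2 ^+ d.
Proof.
rewrite /d -(size_blks AA sizeG) -/l; elim: l => [|x s IH].
  by rewrite big_nil normr1 expr0.
by rewrite big_cons normrM /= exprS ler_pM ?psi_le2.
Qed.

Let FF A := EE (val A) :\: inn.
Let h H : R := \sum_A mono R (EE (val A) :&: inn) H0 * incr (mono R (FF A)) e H.

Let Ex_test : Ex p (fun H => incr (fun H => \sum_(A : rset n r) tA R AA Zs H0 Gs A H) e H *
   ((\prod_(x <- l) psi x.1 H) * 1)) = Ex p (fun H => h H * ((\prod_(x <- l) psi x.1 H) * 1)).
Proof.
rewrite -(@Ex_dls_test R _ p psi h l (fun=> 1)); first last.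
- by move=> G1 G2.
- by move=> x _; split; [exact: dep_psi | exact: Ex_psiW].
- exact: disj_blks.
apply: eq_Ex => H; congr (_ * _); rewrite /h dls_sum incr_sum; apply: eq_bigr => A _.
rewrite -dls_incr; last exact: cov_blks_inner.
by rewrite /incr /tA -mulrBr.
Qed.

Definition test_value A : R :=
  p ^+ #|(FF A :\ e) :\: cov l| *
  \prod_(x <- l) (p ^+ #|(FF A :\ e) :&: x.1| *
     complex.Im ((1 +i* (lamU x.1 * (1 - p))) ^+ #|((FF A :\ e) :&: x.1) :&: rowa x.1|)).

Let Ex_h : Ex p (fun H => h H * ((\prod_(x <- l) psi x.1 H) * 1)) =
  \sum_A mono R (EE (val A) :&: inn) H0 * ((e \in FF A)%:R * test_value A).
Proof.
under eq_Ex do rewrite mulr1 /h mulr_suml.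
rewrite Ex_sum; apply: eq_bigr => A _.
under eq_Ex do rewrite -mulrA; rewrite ExZ; congr (_ * _).
under eq_Ex do rewrite incr_mono -mulrA; rewrite ExZ; congr (_ * _).
rewrite Ex_mono_prod; [|exact: disj_blks|by move=> x _; exact: dep_psi].
by congr (_ * _); apply: eq_bigr => x _; rewrite Ex_mono_psiW.
Qed.

Let card_FFe A U : (#|(FF A :\ e) :&: U| <= r ^ 2)%N /\ (#|(FF A :\ e) :\: U| <= r ^ 2)%N.
Proof.
have h1 : (#|EE (val A)| <= r ^ 2)%N by rewrite card_EE (eqP (valP A)) bin_le_exp.
have h2 : FF A :\ e \subset EE (val A).
  by apply: subset_trans (subsetDl _ _) (subsetDl _ _).
split; apply: leq_trans h1; apply: subset_leq_card; apply: subset_trans h2.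
  exact: subsetIl.
exact: subsetDl.
Qed.

Let q1 : 0 <= 1 - p. Proof. by rewrite subr_ge0. Qed.

Let row_card A U : (#|((FF A :\ e) :&: U) :&: rowa U| <= r)%N.
Proof.
apply: (@leq_trans #|star a (val A :\ a)|).
  apply: subset_leq_card; apply/subsetP => x; rewrite !inE.
  move=> /andP[/andP[/andP[_ /andP[_ xA]] _] /andP[_ ax]]; rewrite ax /=.
  have /set0Pn[y] : val x :\ a != set0.
    by rewrite -card_gt0; have := cardsD1 a (val x); rewrite card_edge ax add1n => -[<-].
  rewrite !inE => /andP[ya yx]; apply/set0Pn; exists y.
  by rewrite !inE yx ya (subsetP xA).
rewrite card_star ?inE ?eqxx //.
have hA := eqP (valP A); apply: leq_trans (subset_leq_card (subsetDl _ _)) _.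
by rewrite hA.
Qed.

Let Im_ge0 A U : 0 <= complex.Im ((1 +i* (lamU U * (1 - p))) ^+ #|((FF A :\ e) :&: U) :&: rowa U|).
Proof.
apply: Im_exp_ge0; first by rewrite mulr_ge0.
have hr := row_card A U.
apply: (@le_trans _ _ (r%:R * (r%:R^-1 * 1))); last by rewrite mulr1 divff // gt_eqF.
apply: ler_pM => //; first by rewrite mulr_ge0.
  by rewrite ler_nat.
by apply: ler_pM => //; rewrite gerBl.
Qed.

Let test_value_ge0 A : 0 <= test_value A.
Proof.
rewrite mulr_ge0 ?exprn_ge0 //; apply: prodr_ge0 => x _.
by rewrite mulr_ge0 ?exprn_ge0.
Qed.

Let kap : R := p ^+ (r ^ 2) * \prod_(Z <- Zs) (p ^+ (r ^ 2) * ((1 - p) / (r%:R * Num.sqrt #|Z|%:R))).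

Let good (A : {set 'I_n}) := [&& val e \subset A, (A :\: AA) \in CC & #|A| == r].

(** For a good set each block pairing is of first order: the row at [a] contains exactly one edge of
    [A], so the imaginary part is exactly lam (1 - p). *)
Let good_value A : good (val A) ->
  mono R (EE (val A) :&: inn) H0 * ((e \in FF A)%:R * test_value A) >= kap.
Proof.
move=> /and3P[eAA AC _].
have -> : mono R (EE (val A) :&: inn) H0 = 1.
  rewrite /mono (_ : _ \subset _) //; apply/subsetP => x; rewrite !inE => /andP[xA xC].
  apply: (subsetP (CC_clique AC)); rewrite inE setDE subsetI xA.
  exact: xC.
have -> : e \in FF A.
  rewrite !inE eAA andbT; apply/negP => /subsetP /(_ a ae).
  by rewrite inE aA.
rewrite !mul1r /test_value /kap; apply: ler_pM.
- by rewrite exprn_ge0.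
- by apply: prodr_ge0 => Z _; rewrite mulr_ge0 ?exprn_ge0 ?divr_ge0 // mulr_ge0 ?sqrtr_ge0.
- by rewrite ler_wiXn2l //; case: (card_FFe A (cov l)).
have -> : \prod_(Z <- Zs) (p ^+ (r ^ 2) * ((1 - p) / (r%:R * Num.sqrt #|Z|%:R))) =
   \prod_(x <- l) (p ^+ (r ^ 2) * (lamU x.1 * (1 - p))).
  rewrite -(big_map fst xpredT (fun U => p ^+ (r ^ 2) * (lamU U * (1 - p)))) /=.
  rewrite -/(unzip1 l) /l unzip1_blks // big_map !big_seq; apply: eq_bigr => Z ZZ.
  by rewrite /lamU rowa_blk card_star ?a_notin // [X in _ * X]mulrC.
rewrite !big_seq; apply: ler_prod => x xl; apply/andP; split.
  by rewrite mulr_ge0 ?exprn_ge0 // mulr_ge0.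
have [Z ZZ xZ] := blks_in sizeG xl.
apply: ler_pM; rewrite ?exprn_ge0 ?mulr_ge0 //.
  by rewrite ler_wiXn2l //; case: (card_FFe A x.1).
have -> : #|((FF A :\ e) :&: x.1) :&: rowa x.1| = 1%N.
  apply: etrans (CC_hit AC ZZ); rewrite xZ rowa_blk.
  have aN : a \notin (val A :\: AA) :&: Z by rewrite inE (negPf (a_notin ZZ)) andbF.
  rewrite -(card_star aN); congr #|pred_of_set _|; apply/setP => y; rewrite !inE.
  case: (boolP (a \in val y)) => ay; rewrite ?andbF //= ?andbT.
  apply/idP/idP.
    case/andP => /andP[/andP[_ /andP[_ yA]] _] /set0Pn[z]; rewrite inE => /andP[zy zZ].
    apply/set0Pn; exists z; rewrite !inE zy zZ andbT /= (subsetP yA z zy) andbT.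
    by have := subsetP (allP subZ Z ZZ) z zZ; rewrite inE.
  case/set0Pn => z; rewrite !inE => /and3P[zy /andP[zAA zA] zZ].
  have az : a != z by apply: contraNneq zAA => <-.
  have yE := edge_two ay zy az.
  have yZ : val y :&: Z != set0 by apply/set0Pn; exists z; rewrite inE zy zZ.
  rewrite yZ !andbT; apply/andP; split; last by apply/set0Pn; exists a; rewrite inE ay aA.
  apply/and3P; split.
  - apply: contraNneq zAA => ye; apply: (subsetP eA); by rewrite -ye.
  - by apply/negP => /subsetP /(_ a ay); rewrite inE aA.
  - rewrite yE; apply/subsetP => w; rewrite !inE => /orP[]/eqP -> //.
    exact: (subsetP eAA).
by rewrite expr1.
Qed.

(** A good set is the union of some C in [CC], the edge [e], and further vertices B of [AA]. Both C
    and B can be recovered from the union, so distinct choices give distinct sets. *)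
Lemma card_good : (#|CC| * 'C(#|AA| - 2, r - size Zs - 2) <= #|[set A : {set 'I_n} | good A]|)%N.
Proof.
pose BB : {set {set 'I_n}} := [set B : {set 'I_n} | (B \subset AA :\: val e) && (#|B| == (r - size Zs - 2)%N)].
have cBB : #|BB| = 'C(#|AA| - 2, r - size Zs - 2).
  rewrite /BB cards_draws; congr 'C(_, _).
  by rewrite cardsD (setIidPr eA) card_edge.
rewrite -cBB -cardsX.
have BA B C : B \in BB -> C \in CC -> [/\ (C :|: val e :|: B) :\: AA = C,
    (C :|: val e :|: B) :&: (AA :\: val e) = B & #|C :|: val e :|: B| = r].
  rewrite inE => /andP[BA cB] CI; have CN := CC_sub CI.
  have CA x : x \in C -> x \notin AA by move=> /(subsetP CN); rewrite inE.
  have BB' x : x \in B -> (x \in AA) && (x \notin val e).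
    by move=> /(subsetP BA); rewrite !inE andbC.
  have eA' x : x \in val e -> x \in AA by move=> /(subsetP eA).
  split.
  - apply/setP => x; rewrite !inE; case: (boolP (x \in C)) => [/CA -> //|_] /=.
    case: (boolP (x \in val e)) => [/eA' -> //|_] /=.
    by case: (boolP (x \in B)) => [/BB' /andP[->] //|_]; rewrite andbF.
  - apply/setP => x; rewrite !inE; case: (boolP (x \in B)) => [/BB'/andP[-> ->]|_] //=.
      by rewrite orbT.
    rewrite orbF; case: (boolP (x \in val e)) => xe /=; first by rewrite andbF.
    by case: (boolP (x \in C)) => [/CA /negPf ->|].
  - rewrite cardsU (_ : (C :|: val e) :&: B = set0); last first.
      apply/setP => x; rewrite !inE; case: (boolP (x \in B)) => [/BB'/andP[xA xe]|_]; last by rewrite andbF.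
      by rewrite (negPf xe) orbF andbT; apply/negP => /CA; rewrite xA.
    rewrite cardsU (_ : C :&: val e = set0); last first.
      apply/setP => x; rewrite !inE; apply/negP => /andP[/CA xA /eA' xA'].
      by rewrite xA' in xA.
    rewrite !cards0 !subn0 (CC_card CI) card_edge (eqP cB); move: dr; clear; lia.
rewrite -(@card_in_imset _ _ (fun u : {set 'I_n} * {set 'I_n} => u.1 :|: val e :|: u.2)); last first.
  move=> [C B] [C' B']; rewrite !in_setX /= => /andP[hC hB] /andP[hC' hB'] hE.
  have [h1 h2 _] := BA _ _ hB hC; have [h1' h2' _] := BA _ _ hB' hC'.
  by congr (_, _); [rewrite -h1 hE h1' | rewrite -h2 hE h2'].
apply: subset_leq_card; apply/subsetP => A /imsetP[[C B]]; rewrite in_setX /= => /andP[hC hB] ->.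
have [h1 h2 h3] := BA _ _ hB hC; rewrite inE /good h1 h3 hC eqxx andbT /= andbT.
by apply/subsetP => x xe; rewrite !inE xe orbT.
Qed.

(** Duality: the derivative at [e] is tested against a product of Riesz functions, one per block,
    supported on the edges at an endpoint [a], and at most 2 each. Mean zero in each block removes
    the resampled copies; all remaining pairings are nonnegative, so counting good sets suffices. A
    block costs only |Z|^(-1/2), the size of a random fluctuation. *)
Theorem Ex_incr_lower :
  (#|CC| * 'C(#|AA| - 2, r - size Zs - 2))%N%:R * kap <=
  2 ^+ size Zs * Ex p (fun H => `|incr (fun H => \sum_(A : rset n r) tA R AA Zs H0 Gs A H) e H|).
Proof.
have kap0 : 0 <= kap.
  rewrite mulr_ge0 ?exprn_ge0 //.
  by apply: prodr_ge0 => Z _; rewrite mulr_ge0 ?exprn_ge0 ?divr_ge0 // mulr_ge0 ?sqrtr_ge0.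
apply: (@le_trans _ _ (\sum_A mono R (EE (val A) :&: inn) H0 * ((e \in FF A)%:R * test_value A))).
  apply: (@le_trans _ _ (\sum_(A : rset n r) (good (val A))%:R * kap)).
    rewrite (sum_rset r (fun B => (good B)%:R * kap)) -mulr_suml ler_wpM2r //.
    rewrite -natr_sum ler_nat; apply: leq_trans card_good _.
    rewrite -sum1dep_card [leqRHS]big_mkcond [leqLHS]big_mkcond /=; apply: leq_sum => A _.
    by rewrite /good; case: (#|A| == r); rewrite ?andbF //=; case: (_ && _).
  apply: ler_sum => A _; case: (boolP (good (val A))) => hA; first by rewrite mul1r good_value.
  by rewrite mul0r mulr_ge0 ?mono_ge0 // mulr_ge0.
rewrite -Ex_h -Ex_test; apply: le_trans (ler_norm _) _.
apply: le_trans (norm_Ex p0 p1 _) _; rewrite -ExZ; apply: ler_Ex => // H.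
by rewrite normrM mulr1 mulrC ler_wpM2r.
Qed.
End LowerBound.

Lemma bin_ge_exp m k : ((m - k) ^ k <= 'C(m, k) * k`!)%N.
Proof.
rewrite bin_ffact; elim: k m => [|k IH] m; first by rewrite expn0 ffactn0.
case: m => [|m]; first by rewrite sub0n exp0n.
rewrite ffactSS subSS expnS; apply: leq_mul; first by lia.
exact: IH.
Qed.

(** * Sum of the squared pair counts *)

Section CostSums.
Variables (R : realType) (n r : nat).
Implicit Types (e : edge n).
Variables (AA : {set 'I_n}) (Zs : seq {set 'I_n}) (dg : nat).
Hypothesis n_gt0 : (0 < n)%N.
Local Notation cc := (@cc R n r AA Zs dg).
Let Q : R := 5 * dg%:R * PP R r Zs.
Let Q0 : 0 <= Q. Proof. by rewrite !mulr_ge0 ?PP_ge0. Qed.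
Let n1 : 0 < n%:R :> R. Proof. by rewrite ltr0n. Qed.

Lemma cc_in e : val e \subset AA -> cc e = Q / n%:R ^+ 3.
Proof.
move=> eA; rewrite /cc (setIidPl eA) card_edge; case: ifPn => // /subsetP h.
have : val e != set0 by rewrite -card_gt0 card_edge.
by case/set0Pn => x xe; have := h x xe; rewrite inE (subsetP eA).
Qed.

Lemma card_edges_le : (#|{: edge n}| <= n ^ 2)%N.
Proof.
rewrite -cardsT (_ : [set: edge n] = EE setT); last by apply/setP => e; rewrite !inE subsetT.
by rewrite card_EE cardsT card_ord bin_le_exp.
Qed.

Lemma card_edges_out : (#|[set e : edge n | ~~ (val e \subset AA)]| <= #|~: AA| * n)%N.
Proof.
apply: (@leq_trans #|\bigcup_(z in ~: AA) star z (setT :\ z)|).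
  apply: subset_leq_card; apply/subsetP => e; rewrite inE => /subsetPn[z ze zA].
  apply/bigcupP; exists z; first by rewrite inE.
  rewrite inE ze /=; have : (0 < #|val e :\ z|)%N.
    by have := cardsD1 z (val e); rewrite card_edge ze add1n => -[<-].
  rewrite card_gt0 => /set0Pn[y]; rewrite !inE => /andP[yz ye].
  by apply/set0Pn; exists y; rewrite !inE ye yz.
apply: leq_trans (card_bigcup_le _ _) _; rewrite -sum_nat_const; apply: leq_sum => z _.
rewrite card_star ?inE ?eqxx //; apply: leq_trans (max_card _) _; by rewrite card_ord.
Qed.

(** At most n^2 edges lie inside [AA], at cost Q/n^3 each; at most n times the size of the
    complement join [AA] to it, at cost Q/n^2 each. *)
Lemma sum_cc_sq : \sum_e cc e ^+ 2 <=
  Q ^+ 2 * (n%:R ^+ 2 / n%:R ^+ 6 + #|~: AA|%:R * n%:R / n%:R ^+ 4).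
Proof.
apply: (@le_trans _ _ (\sum_(e : edge n) (Q ^+ 2 / n%:R ^+ 6 +
   (~~ (val e \subset AA))%:R * (Q ^+ 2 / n%:R ^+ 4)))).
  apply: ler_sum => e _; case: (boolP (val e \subset AA)) => eA.
    by rewrite cc_in // mul0r addr0 exprMn exprVn -exprM.
  rewrite mul1r; apply: ler_wpDl; first by rewrite divr_ge0 ?exprn_ge0.
  rewrite /cc; case: ifPn => eD; first by rewrite expr0n divr_ge0 ?exprn_ge0.
  have -> : #|val e :&: AA| = 1%N.
    apply/eqP; rewrite eqn_leq -ltnS; apply/andP; split.
      have := @proper_card _ (val e :&: AA) (val e).
      rewrite card_edge; apply; rewrite properEneq subsetIl andbT.
      by apply: contra eA => /eqP h; apply/setIidPl.
    rewrite card_gt0 setI_eq0; apply: contra eD; by rewrite disjoints_subset.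
  by rewrite exprMn exprVn -exprM.
rewrite big_split /= sumr_const -mulr_suml mulrDr; apply: lerD.
  rewrite -[_ *+ #|_|]mulr_natl mulrA [leRHS]mulrA [_ * Q ^+ 2]mulrC.
  rewrite ler_wpM2r ?invr_ge0 ?exprn_ge0 // ler_wpM2l ?exprn_ge0 //.
  by rewrite -natrX ler_nat; exact: card_edges_le.
have h : \sum_(e : edge n) (~~ (val e \subset AA))%:R <= #|~: AA|%:R * n%:R :> R.
  rewrite -natr_sum -natrM ler_nat; apply: leq_trans card_edges_out.
  by rewrite -sum1dep_card [leqRHS]big_mkcond.
have q0 : 0 <= Q ^+ 2 / n%:R ^+ 4 by rewrite divr_ge0 ?exprn_ge0.
apply: le_trans (ler_wpM2r q0 h) _; rewrite le_eqVlt; apply/orP; left; apply/eqP; ring.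
Qed.
End CostSums.

(** * The decoupled estimate in explicit parameters *)

Section BlockBound.
Variables (R : realType) (p : R) (d k : nat).
Hypotheses (p0 : 0 <= p) (p1 : p <= 1).
Let r := (d + 2 + k)%N.
(** Collects the constants of [Ex_incr_lower]; the factor 4^k k! comes from C(n0 - 2, k) >= (n/4)^k
    / k!. The mean derivative is then at least kap0 sqrt(N) n^k. *)
Definition kap0 : R :=
  (2 ^+ d)^-1 * p ^+ (r ^ 2) * (p ^+ (r ^ 2) * ((1 - p) / r%:R)) ^+ d / (4 ^+ k * (k`!)%:R).

Lemma kap0_ge0 : 0 <= kap0.
Proof.
rewrite /kap0 divr_ge0 ?mulr_ge0 ?exprn_ge0 ?mulr_ge0 ?exprn_ge0 ?divr_ge0 ?subr_ge0 //.
Qed.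

Variables (n n0 dg : nat) (s : R).
Local Notation AA := (@A0 n n0).
Variables (Zs : seq {set 'I_n}) (H0 : graph n) (CC : {set {set 'I_n}}).
Hypothesis subZ : all (fun Z : {set 'I_n} => Z \subset ~: AA) Zs.
Hypothesis disjZ : pairwise (fun Z Z' : {set 'I_n} => [disjoint Z & Z']) Zs.
Hypothesis sizeZ : size Zs = d.
Hypothesis CC_sub : forall C, C \in CC -> C \subset ~: AA.
Hypothesis CC_card : forall C, C \in CC -> #|C| = d.
Hypothesis CC_clique : forall C, C \in CC -> EE C \subset H0.
Hypothesis CC_hit : forall C Z, C \in CC -> Z \in Zs -> #|C :&: Z| = 1%N.
Variable N : nat.
Hypothesis N_gt0 : (0 < N)%N.
Hypothesis NZ : (\prod_(Z <- Zs) #|Z|)%N = N.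
Hypothesis NCC : #|CC| = N.
Hypothesis s0 : s != 0.
Hypothesis sN : `|s| * (N%:R * n%:R ^+ k) <= pi.
Hypothesis n0n : (n0 <= n)%N.
Hypothesis n0_ge : (n <= 2 * n0)%N.
Hypothesis dg_gt0 : (0 < dg)%N.
Hypothesis dg_le : (4 * dg <= n)%N.
Hypothesis n_large : (4 * (k + 2) <= n)%N.
(** Order of the phase variance that some n^2 edges with derivative sqrt(N) n^k would carry; the
    band retains a proportion of about dg/n. *)
Let X2 : R := s ^+ 2 * N%:R * n%:R ^+ (2 * k + 2).
Let S := @band n n0 dg.
Let M : R := kap0 * Num.sqrt N%:R * n%:R ^+ k.
Let n_gt0 : (0 < n)%N. Proof. by move: n_large; clear; lia. Qed.
Let n1 : 0 < n%:R :> R. Proof. by rewrite ltr0n. Qed.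

Let card_AA : #|AA| = n0.
Proof.
move: n0n; clear => n0n.
apply/eqP; rewrite eqn_leq; apply/andP; split.
  apply: leq_trans (card_ord_itv_le n 0 n0); apply: subset_leq_card.
  by apply/subsetP => x; rewrite !inE.
apply: leq_trans (card_ord_itv_ge (n := n) (a := 0) (k := n0) _) _; first by lia.
by apply: subset_leq_card; apply/subsetP => x; rewrite !inE; lia.
Qed.

Let M_le (Gs : seq (graph n)) e : size Gs = size Zs -> e \in S ->
  M <= Ex p (fun H => `|incr (fun H => \sum_(A : rset n r) tA R AA Zs H0 Gs A H) e H|).
Proof.
move=> sG eS; have eA := band_sub eS.
have /set0Pn[a ae] : val e != set0 by rewrite -card_gt0 card_edge.
have r2 : (2 <= r)%N by rewrite /r; clear; lia.
have dr : (size Zs + 2 <= r)%N by rewrite sizeZ /r leq_addr.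
have CC_card' C : C \in CC -> #|C| = size Zs by rewrite sizeZ; exact: CC_card.
have := Ex_incr_lower p0 p1 r2 subZ disjZ sG CC_sub CC_card' CC_clique CC_hit dr eA ae.
rewrite NCC sizeZ card_AA (_ : (r - d - 2)%N = k); last by rewrite /r; clear; lia.
set E := Ex p _ => h.
have e2 : 0 < 2 ^+ d :> R by rewrite exprn_gt0.
rewrite -(ler_pM2l e2); apply: le_trans h.
have -> : \prod_(Z <- Zs) (p ^+ (r ^ 2) * ((1 - p) / (r%:R * Num.sqrt #|Z|%:R))) =
   (p ^+ (r ^ 2) * ((1 - p) / r%:R)) ^+ d / Num.sqrt N%:R.
  rewrite -NZ -sizeZ; elim: (Zs) => [|Z Zs' IH].
    by rewrite !big_nil expr0 sqrtr1 divr1.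
  rewrite !big_cons IH natrM sqrtrM // exprS !invfM; ring.
set c := (p ^+ (r ^ 2) * ((1 - p) / r%:R)) ^+ d.
have c0 : 0 <= c by rewrite exprn_ge0 // mulr_ge0 ?exprn_ge0 ?divr_ge0 ?subr_ge0.
have sqN : 0 < Num.sqrt N%:R :> R by rewrite sqrtr_gt0 ltr0n.
have NE : N%:R = Num.sqrt N%:R ^+ 2 :> R by rewrite sqr_sqrtr.
have bin : n%:R ^+ k <= 4 ^+ k * ('C(n0 - 2, k)%:R * (k`!)%:R) :> R.
  rewrite -natrM -natrX -(natrX _ 4) -natrM ler_nat.
  apply: leq_trans (_ : (4 * (n0 - 2 - k)) ^ k <= _)%N.
    by apply: exp_mono; move: n_large n0_ge; clear; lia.
  by rewrite expnMn leq_mul2l bin_ge_exp orbT.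
rewrite /M /kap0 -/c natrM {2}NE.
have k0 : 0 < k`!%:R :> R by rewrite ltr0n fact_gt0.
have p40 : 0 < 4 ^+ k :> R by rewrite exprn_gt0.
have -> : 2 ^+ d * ((2 ^+ d)^-1 * p ^+ (r ^ 2) * c / (4 ^+ k * k`!%:R) * Num.sqrt N%:R * n%:R ^+ k)
   = (p ^+ (r ^ 2) * c * Num.sqrt N%:R) * (n%:R ^+ k / (4 ^+ k * k`!%:R)).
  field; by rewrite !gt_eqF.
have -> : Num.sqrt N%:R ^+ 2 * 'C(n0 - 2, k)%:R * (p ^+ (r ^ 2) * (c / Num.sqrt N%:R)) =
   (p ^+ (r ^ 2) * c * Num.sqrt N%:R) * 'C(n0 - 2, k)%:R.
  by field; rewrite gt_eqF.
apply: ler_wpM2l.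
  by apply: mulr_ge0; [apply: mulr_ge0; [exact: exprn_ge0 | exact: c0] | exact: sqrtr_ge0].
rewrite ler_pdivrMr ?mulr_gt0 //; apply: le_trans bin _.
by rewrite le_eqVlt; apply/orP; left; apply/eqP; ring.
Qed.

Local Notation D0 := (#|~: AA|%:R : R).

Let PPE : PP R r Zs = N%:R * n%:R ^+ (k + 2).
Proof.
rewrite /PP NZ sizeZ /r (_ : (d + 2 + k = k + 2 + d)%N); last by clear; lia.
by rewrite (exprD _ (k + 2)) mulrA mulfK // expf_neq0 // gt_eqF.
Qed.

Let card_S_ge : n%:R * dg%:R / 4 <= #|S|%:R :> R.
Proof.
rewrite ler_pdivrMr // -!natrM ler_nat.
have := card_band_ge dg n0n; rewrite -/S => h.
apply: leq_trans (_ : (4 * (n0 - dg)) * dg <= _)%N; last by lia.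
by rewrite leq_mul2r; apply/orP; right; lia.
Qed.

Let M_sq : M ^+ 2 = kap0 ^+ 2 * N%:R * n%:R ^+ (2 * k).
Proof. by rewrite /M !exprMn sqr_sqrtr ?ler0n // -[(n%:R ^+ k) ^+ 2]exprM (mulnC k 2). Qed.

Let cost_S : \sum_(e in S) (4 * `|s| * cc R r AA Zs dg e) ^+ 2 <=
  400 * X2 * N%:R * dg%:R ^+ 3 / n%:R ^+ 3.
Proof.
rewrite (eq_bigr (fun=> (4 * `|s| * (5 * dg%:R * (N%:R * n%:R ^+ (k + 2)) / n%:R ^+ 3)) ^+ 2)); last first.
  move=> e eS; have := @cc_in R n r AA Zs dg e (band_sub eS).
  by rewrite PPE => ->.
rewrite sumr_const -[_ *+ #|S|]mulr_natl.
apply: (@le_trans _ _ ((n%:R * dg%:R) *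
   (4 * `|s| * (5 * dg%:R * (N%:R * n%:R ^+ (k + 2)) / n%:R ^+ 3)) ^+ 2)).
  by rewrite ler_wpM2r ?sqr_ge0 // -natrM ler_nat card_band_le.
rewrite le_eqVlt; apply/orP; left; apply/eqP.
rewrite /X2 -(@real_normK _ s) ?num_real // (_ : (2 * k + 2 = k + k + 2)%N); last by clear; lia.
by rewrite !exprD; field; rewrite gt_eqF.
Qed.

Let V0 : R := 400 * dg%:R ^+ 2 * N%:R ^+ 2 * n%:R ^+ (2 * k + 1) * (D0 + 1).

Let cost_all : \sum_e (4 * cc R r AA Zs dg e) ^+ 2 <= V0.
Proof.
under eq_bigr do rewrite exprMn; rewrite -mulr_sumr.
have := @sum_cc_sq R n r AA Zs dg; rewrite PPE => h.
apply: le_trans (ler_wpM2l (sqr_ge0 4) h) _.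
apply: (@le_trans _ _ (400 * dg%:R ^+ 2 * N%:R ^+ 2 * n%:R ^+ (2 * k) * (D0 * n%:R + 1))).
  rewrite le_eqVlt; apply/orP; left; apply/eqP.
  rewrite (_ : (2 * k = k + k)%N) ?mul2n ?addnn // -addnn.
  by rewrite !exprD; field; rewrite gt_eqF.
have -> : V0 = 400 * dg%:R ^+ 2 * N%:R ^+ 2 * n%:R ^+ (2 * k) * (n%:R * (D0 + 1)).
  by rewrite /V0 exprD expr1; move: (_ ^+ (2 * k)) => a; ring.
apply: ler_wpM2l; first by do 3 (apply: mulr_ge0; last exact: exprn_ge0).
by rewrite mulrDr mulr1 [n%:R * _]mulrC lerD2l ler1n.
Qed.

Let M0 : 0 <= M.
Proof.
apply: mulr_ge0; last exact: exprn_ge0.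
by apply: mulr_ge0; [exact: kap0_ge0 | exact: sqrtr_ge0].
Qed.

Let raw_bound (Gs : seq (graph n)) J eta lam : size Gs = size Zs -> 0 < eta -> 0 <= lam ->
  nc (Ex p%:C (fun H => expi (s * \sum_(A : rset n r) tA R AA Zs H0 Gs A H))) <=
  \sum_(j < J) ('C(n, r)%:R * (2 * (`|s| * (1 + 2 * (r ^ 2)%:R)))) ^+ j *
     (expR (- (p * (1 - p) / 16 * (s ^+ 2 * (#|S|%:R * M ^+ 2) / 4))) * expR 1 ^+ (j * r ^ 2)) +
  4 * eta ^+ J * expR (2 * (\sum_(e in S) (4 * `|s| * cc R r AA Zs dg e) ^+ 2) / eta ^+ 2) +
  expR (2 * lam ^+ 2 * \sum_e (4 * cc R r AA Zs dg e) ^+ 2 - lam * (#|S|%:R * M / 2)).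
Proof.
move=> sG eta0 lam0.
have degS x : (#|[set e : edge n in S | x \in val e]| <= 2 * dg)%N by exact: (card_band_at dg n0n).
have subS e : e \in S -> val e \subset AA by exact: band_sub.
have hpi H e : e \in S ->
    `|s * incr (fun H => \sum_(A : rset n r) tA R AA Zs H0 Gs A H) e H| <= pi.
  move=> eS; rewrite normrM; apply: le_trans sN.
  apply: ler_wpM2l => //.
  apply: le_trans (sum_incr_tA R r H0 subZ disjZ sG n_gt0 subS H eS) _.
  by rewrite PPE exprD mulrA mulfK // expf_neq0 // gt_eqF.
have S0 : (0 < #|S|)%N.
  rewrite -(ltr0n R); apply: lt_le_trans card_S_ge; by rewrite divr_gt0 ?mulr_gt0 ?ltr0n.
have := charfun_local_sum p0 p1 (dep_tA R H0 subZ disjZ sG) (norm_tA R H0 subZ disjZ sG)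
  (@card_FFA n r AA Zs) s0
  (pair_count R r subZ disjZ sG n_gt0 subS degS (card_band_le dg n0n)) hpi M0
  (fun e eS => M_le sG eS) S0 J eta0 lam0.
by rewrite card_rset.
Qed.

Let num1 : kap0 ^+ 2 * X2 * dg%:R / (16 * n%:R) <= s ^+ 2 * (#|S|%:R * M ^+ 2) / 4.
Proof.
rewrite M_sq /X2 exprD.
have c0 : 0 <= s ^+ 2 * (kap0 ^+ 2 * N%:R * n%:R ^+ (2 * k)) / 4.
  apply: divr_ge0 => //; apply: mulr_ge0; first exact: sqr_ge0.
  by apply: mulr_ge0; [apply: mulr_ge0; [exact: sqr_ge0|] | exact: exprn_ge0].
have h := ler_wpM2r c0 card_S_ge; move: h.
move: (n%:R ^+ (2 * k)) c0 => a _.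
have -> : n%:R * dg%:R / 4 * (s ^+ 2 * (kap0 ^+ 2 * N%:R * a) / 4) =
  kap0 ^+ 2 * (s ^+ 2 * N%:R * (a * n%:R ^+ 2)) * dg%:R / (16 * n%:R).
  by field; rewrite gt_eqF.
by move=> /le_trans; apply; rewrite le_eqVlt; apply/orP; left; apply/eqP; ring.
Qed.

Let mu0 : R := n%:R * dg%:R * kap0 * Num.sqrt N%:R * n%:R ^+ k / 8.

Let mu0_ge0 : 0 <= mu0.
Proof.
apply: divr_ge0 => //; apply: mulr_ge0; last exact: exprn_ge0.
apply: mulr_ge0; last exact: sqrtr_ge0.
by apply: mulr_ge0; [exact: mulr_ge0 | exact: kap0_ge0].
Qed.

Let mu0_le : mu0 <= #|S|%:R * M / 2.
Proof.
have := ler_wpM2r M0 card_S_ge; have -> : mu0 = n%:R * dg%:R / 4 * M / 2.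
  by rewrite /mu0 /M; move: kap0 (Num.sqrt _) (_ ^+ k) => a b c; field.
by lra.
Qed.

Let V00 : 0 < V0.
Proof.
rewrite /V0; apply: mulr_gt0; last by rewrite ltr_wpDl.
apply: mulr_gt0; last by rewrite exprn_gt0.
apply: mulr_gt0; last by rewrite exprn_gt0 ?ltr0n.
by apply: mulr_gt0 => //; rewrite exprn_gt0 ?ltr0n.
Qed.

Let num3 : 2 * (mu0 / (4 * V0)) ^+ 2 * V0 - mu0 / (4 * V0) * mu0 =
  - (kap0 ^+ 2 * n%:R / (64 * 3200 * N%:R * (D0 + 1))).
Proof.
have -> : 2 * (mu0 / (4 * V0)) ^+ 2 * V0 - mu0 / (4 * V0) * mu0 = - (mu0 ^+ 2 / (8 * V0)).
  by move: mu0 V0 V00 => a b b0; field; rewrite gt_eqF.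
congr (- _); have -> : mu0 ^+ 2 =
  n%:R ^+ 2 * dg%:R ^+ 2 * kap0 ^+ 2 * N%:R * n%:R ^+ (2 * k) / 64.
  have NE : N%:R = Num.sqrt N%:R ^+ 2 :> R by rewrite sqr_sqrtr.
  rewrite [in RHS]NE /mu0 mul2n -addnn exprD.
  by move: kap0 (Num.sqrt _) (_ ^+ k) => a b c; field.
rewrite /V0 exprD expr1.
have N1 : 0 < N%:R :> R by rewrite ltr0n.
have dg1 : 0 < dg%:R :> R by rewrite ltr0n.
have D01 : 0 < D0 + 1 by rewrite ltr_wpDl.
move: kap0 (D0 + 1) D01 (N%:R) N1 (dg%:R) dg1 (n%:R) n1.
move=> a c c0 e e0 f f0 g g0.
have b0 : 0 < g ^+ (2 * k) by rewrite exprn_gt0.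
by move: (g ^+ _) b0 => b b0; field; rewrite !gt_eqF.
Qed.

(** [decouple] along the blocks, followed by [charfun_local_sum] on the band. The three terms are
    the decay of the linear phase, the Taylor remainder, and the probability that the derivatives
    are atypically small. *)
Theorem block_bound (J : nat) (eta : R) : 0 < eta ->
  nc (Ex p%:C (fun H => expi (s * cliques R r (mix (inner AA) H0 H)))) ^+ (2 ^ d) <=
  \sum_(j < J) ('C(n, r)%:R * (2 * (`|s| * (1 + 2 * (r ^ 2)%:R)))) ^+ j *
     (expR (- (p * (1 - p) / 16 * (kap0 ^+ 2 * X2 * dg%:R / (16 * n%:R)))) * expR 1 ^+ (j * r ^ 2)) +
  4 * eta ^+ J * expR (2 * (400 * X2 * N%:R * dg%:R ^+ 3 / n%:R ^+ 3) / eta ^+ 2) +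
  expR (- (kap0 ^+ 2 * n%:R / (64 * 3200 * N%:R * (D0 + 1)))).
Proof.
move=> eta0; have sB : size (map (blk AA) Zs) = d by rewrite size_map.
rewrite -[in X in X <= _]sB; apply: decouple => // Gs; rewrite size_map => sG.
rewrite (eq_Ex _ (F2 := fun H => expi (s * \sum_(A : rset n r) tA R AA Zs H0 Gs A H))); last first.
  by move=> H; rewrite -/(blks AA Zs Gs) dls_cliques.
(* This value of lam minimises 2 lam^2 V0 - lam mu0. *)
have lam0 : 0 <= mu0 / (4 * V0).
  by apply: divr_ge0; [exact: mu0_ge0 | apply: mulr_ge0 => //; exact: ltW].
apply: le_trans (raw_bound J sG eta0 lam0) _.
apply: lerD; first apply: lerD.
- apply: ler_sum => j _; apply: ler_wpM2l.
    by apply: exprn_ge0; apply: mulr_ge0 => //; apply: mulr_ge0 => //; apply: mulr_ge0.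
  apply: ler_wpM2r; first by rewrite exprn_ge0 ?expR_ge0.
  rewrite ler_expR lerN2; apply: ler_wpM2l; last exact: num1.
  by apply: divr_ge0 => //; apply: mulr_ge0 => //; rewrite subr_ge0.
- apply: ler_wpM2l; first by apply: mulr_ge0 => //; apply: exprn_ge0; exact: ltW.
  rewrite ler_expR; apply: ler_wpM2r; first by rewrite invr_ge0 exprn_ge0 // ltW.
  by apply: ler_wpM2l => //; exact: cost_S.
rewrite ler_expR -num3; apply: lerB.
  by apply: ler_wpM2l; [apply: mulr_ge0 => //; exact: sqr_ge0 | exact: cost_all].
by apply: ler_wpM2l; [exact: lam0 | exact: mu0_le].
Qed.
End BlockBound.

Lemma subset_of_card (T : finType) (A : {set T}) k : (k <= #|A|)%N ->
  exists2 B : {set T}, B \subset A & #|B| = k.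
Proof.
move=> hk; exists [set x in take k (enum A)].
  by apply/subsetP => x; rewrite inE => /mem_take; rewrite mem_enum.
rewrite cardsE (card_uniqP _) ?take_uniq ?enum_uniq // size_takel //.
by rewrite -cardE.
Qed.

Lemma block_index_le c d a b y :
  (c + a * d <= y)%N -> (y < c + b * d + d)%N -> (a <= b)%N.
Proof.
move=> h1 h2; rewrite leqNgt; apply/negP => ba.
by have := leq_mul ba (leqnn d); rewrite mulSn; lia.
Qed.

(* The blocks [Zs] lie outside [A], and every [C] in [CC] is a clique of [H0] meeting each block once. *)
Definition transversal_family n (A : {set 'I_n}) (H0 : graph n) d N
    (Zs : seq {set 'I_n}) (CC : {set {set 'I_n}}) : Prop :=
  [/\ [/\ all (fun Z : {set 'I_n} => Z \subset ~: A) Zs,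
        pairwise (fun Z Z' : {set 'I_n} => [disjoint Z & Z']) Zs, size Zs = d &
        (\prod_(Z <- Zs) #|Z|)%N = N],
      [/\ forall C : {set 'I_n}, C \in CC -> C \subset ~: A,
        forall C : {set 'I_n}, C \in CC -> #|C| = d,
        forall C : {set 'I_n}, C \in CC -> EE C \subset H0 &
        forall C Z : {set 'I_n}, C \in CC -> Z \in Zs -> #|C :&: Z| = 1%N] & #|CC| = N].

(** * Transversal cliques exist with overwhelming probability *)

Section Transversals.
Variables (R : realType) (p : R) (d n : nat).
Hypotheses (p0 : 0 <= p) (p1 : p <= 1).
Variables (L m : nat).
(* [d.+1] is the number of decoupled blocks; candidate [t]-tuples [tup i], [i < L], and [mid]. *)
Variable n0 : nat.
Hypothesis n0E : (n0 + m + L * d)%N = n.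
Local Notation AA := (@A0 n n0).
Let mid : {set 'I_n} := [set i : 'I_n | (n0 <= i < n0 + m)%N].
Let tup (i : 'I_L) : {set 'I_n} := [set x : 'I_n | (n0 + m + i * d <= x < n0 + m + i * d + d)%N].

Let card_mid : #|mid| = m.
Proof.
apply/eqP; rewrite eqn_leq card_ord_itv_le card_ord_itv_ge //; lia.
Qed.

Let card_tup i : #|tup i| = d.
Proof.
apply/eqP; rewrite eqn_leq card_ord_itv_le card_ord_itv_ge // -n0E -!addnA !leq_add2l.
by rewrite addnC -mulSn leq_mul2r ltn_ord orbT.
Qed.

Let tup_mid i x : x \in tup i -> x \notin mid.
Proof. by rewrite !inE => /andP[h _]; apply/negP => /andP[_]; lia. Qed.

Let tup_disj i j x : x \in tup i -> x \in tup j -> i = j.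
Proof.
rewrite !inE => /andP[h1 h2] /andP[h3 h4]; apply/val_inj/eqP; rewrite eqn_leq.
by rewrite (block_index_le h1 h4) (block_index_le h3 h2).
Qed.

Let tup_out i : tup i \subset ~: AA.
Proof. by apply/subsetP => x; rewrite !inE => /andP[h _]; lia. Qed.

Let mid_out : mid \subset ~: AA.
Proof. by apply/subsetP => x; rewrite !inE; lia. Qed.

(** Counts the cliques formed by a candidate tuple and one vertex of [mid]. A single tuple is a
    clique with constant probability only; [L] disjoint candidates make failure exponentially
    unlikely in [L]. *)
Let X (H : graph n) : R := \sum_(i < L) \sum_(z in mid) mono R (EE (z |: tup i)) H.
Let c (e : edge n) : R := \sum_(i < L) \sum_(z in mid) (val e \subset z |: tup i)%:R.

Let card_zt i z : z \in mid -> #|z |: tup i| = d.+1.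
Proof.
move=> zm; rewrite cardsU1 card_tup; case: (boolP (z \in tup i)) => // /tup_mid.
by rewrite zm.
Qed.

Let EX : Ex p X = L%:R * m%:R * p ^+ 'C(d.+1, 2).
Proof.
rewrite /X Ex_sum (eq_bigr (fun=> m%:R * p ^+ 'C(d.+1, 2))); last first.
  move=> i _; rewrite Ex_sum (eq_bigr (fun=> p ^+ 'C(d.+1, 2))).
    by rewrite sumr_const card_mid -[_ *+ m]mulr_natl.
  by move=> z zm; rewrite Ex_mono card_EE card_zt.
by rewrite sumr_const card_ord -[_ *+ L]mulr_natl mulrA.
Qed.

Let X_diff H e : `|X (e |: H) - X (H :\ e)| <= c e.
Proof.
rewrite /X /c -sumrB; apply: le_trans (ler_norm_sum _ _ _) _; apply: ler_sum => i _.
rewrite -sumrB; apply: le_trans (ler_norm_sum _ _ _) _; apply: ler_sum => z _.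
rewrite -/(incr (mono R (EE (z |: tup i))) e H) incr_mono inE.
by rewrite normrM ger0_norm // ler_piMr // ger0_norm ?mono_ge0 ?mono_le1.
Qed.

(** An edge inside z together with a tuple has an endpoint in that tuple. Tuples are disjoint from
    each other and from [mid], so only one of them is concerned. *)
Let c_le e : c e <= m%:R.
Proof.
rewrite /c.
have one i : \sum_(z in mid) (val e \subset z |: tup i)%:R <= m%:R :> R.
  rewrite -card_mid -sumr_const; apply: ler_sum => z _; by case: (_ \subset _).
case: (boolP [exists i : 'I_L, [exists z in mid, val e \subset z |: tup i]]); last first.
  move=> /existsPn h; rewrite big1 // => i _; rewrite big1 // => z zm.
  by have /existsPn /(_ z) := h i; rewrite zm /= => /negPf ->.
case/existsP => i /existsP[z /andP[zm ez]].
rewrite (bigD1 i) //= [X in _ + X]big1 ?addr0 // => j ji.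
rewrite big1 // => z' zm'; case: (boolP (_ \subset _)) => // ez'.
have : val e :\ z != set0.
  rewrite -card_gt0; have := cardsD1 z (val e); rewrite card_edge.
  by case: (z \in val e); lia.
case/set0Pn => x; rewrite !inE => /andP[xz xe].
have xi : x \in tup i by have := subsetP ez x xe; rewrite in_setU1 (negPf xz).
have := subsetP ez' x xe; rewrite in_setU1 => /orP[/eqP xz'|xj].
  by have := tup_mid xi; rewrite xz' zm'.
by rewrite (tup_disj xi xj) eqxx in ji.
Qed.

Let sum_c : \sum_e c e ^+ 2 <= L%:R * m%:R ^+ 2 * (d.+1 ^ 2)%:R.
Proof.
have c0 e : 0 <= c e by apply: sumr_ge0 => i _; apply: sumr_ge0.
apply: (@le_trans _ _ (\sum_e m%:R * c e)).
  by apply: ler_sum => e _; rewrite expr2 ler_wpM2r.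
rewrite -mulr_sumr (_ : L%:R * m%:R ^+ 2 * _ = m%:R * (L%:R * (m%:R * (d.+1 ^ 2)%:R)));
  last by ring.
rewrite ler_wpM2l // /c exchange_big /= mulr_natl -[L in leRHS]card_ord -sumr_const.
apply: ler_sum => i _; rewrite exchange_big /= mulr_natl -card_mid -sumr_const.
apply: ler_sum => z zm; rewrite -natr_sum ler_nat.
have := bin_le_exp d.+1 2; rewrite -(card_zt i zm) -card_EE; apply: leq_trans.
by rewrite -sum1_card [leqRHS]big_mkcond /=; apply: leq_sum => e _; rewrite inE.
Qed.

Variable N : nat.
Hypothesis N_gt0 : (0 < N)%N.
Hypothesis hN : N%:R <= m%:R * p ^+ 'C(d.+1, 2) / 2 :> R.
Hypothesis L_gt0 : (0 < L)%N.

(** By pigeonhole some tuple has at least half the expected number of extensions z. The blocks are a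
    set of [N] such z and the singletons of the tuple, so the block sizes multiply to [N] and each z
    gives one transversal clique. *)
Let has_transversals H0 : Ex p X / 2 <= X H0 ->
  exists Zs CC, transversal_family AA H0 d.+1 N Zs CC.
Proof.
move=> hX.
have [i hi] : exists i : 'I_L, m%:R * p ^+ 'C(d.+1, 2) / 2 <= \sum_(z in mid) mono R (EE (z |: tup i)) H0.
  apply/existsP; apply: contraT; rewrite negb_exists => /forallP h.
  have : X H0 < Ex p X / 2.
    have -> : Ex p X / 2 = \sum_(i < L) (m%:R * p ^+ 'C(d.+1, 2) / 2).
      by rewrite EX sumr_const card_ord -[RHS]mulr_natl !mulrA.
    rewrite /X; have i0 : 'I_L by exact: (Ordinal L_gt0).
    apply: ltr_sum; last by move=> j _; rewrite ltNge.
    by apply/hasP; exists i0; rewrite ?mem_index_enum.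
  by rewrite ltNge hX.
pose Zc := [set z in mid | EE (z |: tup i) \subset H0].
have hZc : (N <= #|Zc|)%N.
  rewrite -(ler_nat R); apply: le_trans hN _; apply: le_trans hi _.
  rewrite -sum1_card natr_sum.
  rewrite (eq_bigl (fun z => (z \in mid) && (EE (z |: tup i) \subset H0))); last first.
    by move=> z; rewrite inE.
  rewrite big_mkcondr; apply: ler_sum => z _; rewrite /mono; by case: (_ \subset _).
have [Z ZZc cZ] := subset_of_card hZc.
have Zm z : z \in Z -> z \in mid by move=> /(subsetP ZZc); rewrite inE => /andP[].
have Zt z : z \in Z -> z \notin tup i.
  by move=> zZ; apply/negP => /tup_mid; rewrite Zm.
exists (Z :: [seq [set t] | t <- enum (tup i)]), [set z |: tup i | z in Z].
split; [split|split|].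
- rewrite /= (subset_trans _ mid_out) /=; last by apply/subsetP => z /Zm.
  rewrite all_map; apply/allP => t /=; rewrite mem_enum => ti.
  by rewrite sub1set (subsetP (tup_out i)).
- rewrite /= all_map pairwise_map; apply/andP; split.
    apply/allP => t /=; rewrite mem_enum => ti; rewrite disjoint_sym disjoints1.
    by apply/negP => /Zt; rewrite ti.
  have := enum_uniq (mem (tup i)); rewrite uniq_pairwise; apply: sub_pairwise.
  by move=> x y /= xy; rewrite disjoints1 inE.
- by rewrite /= size_map -cardE card_tup.
- rewrite big_cons big_map big1 ?muln1 // => t _; exact: cards1.
- move=> C /imsetP[z /Zm zm ->]; rewrite subUset sub1set (subsetP mid_out) //=.
- by move=> C /imsetP[z /Zm zm ->]; exact: card_zt.
- by move=> C /imsetP[z /(subsetP ZZc)]; rewrite inE => /andP[_ h] ->.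
- move=> C Z' /imsetP[z zZ ->]; rewrite inE => /orP[/eqP ->|].
    rewrite (_ : _ :&: _ = [set z]) ?cards1 //; apply/setP => x; rewrite !inE.
    case: eqP => [->|_] /=; first by rewrite zZ.
    by apply/negP => /andP[h1 /Zt]; rewrite !inE h1.
  case/mapP => t; rewrite mem_enum => ti ->.
  rewrite (_ : _ :&: _ = [set t]) ?cards1 //; apply/setP => x; rewrite in_setI in_setU1 !in_set1.
  by case: (eqVneq x t) => [->|_]; rewrite ?andbF // ti orbT.
rewrite card_in_imset // => x y xZ yZ /setP /(_ x); rewrite !in_setU1 eqxx /= (negPf (Zt x xZ)) orbF.
by move=> /esym/eqP.
Qed.

(** The edges outside [AA] are revealed. Their outcome either supplies a family, or falls in the
    lower tail of [X], where the trivial bound 1 is used. *)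
Theorem transversal_bound (f : graph n -> R) (be : R) : 0 <= be ->
  (forall H0 Zs CC, transversal_family AA H0 d.+1 N Zs CC ->
    nc (Ex p%:C (fun H => expi (f (mix (inner AA) H0 H)))) <= be) ->
  nc (Ex p%:C (fun H => expi (f H))) <=
  be + expR (- (L%:R * (p ^+ 'C(d.+1, 2)) ^+ 2 / (32 * (d.+1 ^ 2)%:R))).
Proof.
move=> be0 hbe.
rewrite (Ex_resample p%:C (inner AA)) Ex_swap; apply: le_trans (normc_Ex p0 p1 _) _.
have m0 : 0 < m%:R :> R.
  have : 0 < N%:R :> R by rewrite ltr0n.
  move=> hN0; have := lt_le_trans hN0 hN; rewrite ltr0n lt0n.
  by case: eqP => // ->; rewrite !mul0r ltxx.
have L0 : 0 < L%:R :> R by rewrite ltr0n.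
set q := p ^+ 'C(d.+1, 2).
have q0 : 0 <= q by rewrite exprn_ge0.
have D0 : 0 < (d.+1 ^ 2)%:R :> R by rewrite ltr0n expn_gt0.
pose V := L%:R * m%:R ^+ 2 * (d.+1 ^ 2)%:R : R.
have V0 : 0 < V by rewrite !mulr_gt0 ?exprn_gt0.
pose lam := L%:R * m%:R * q / (8 * V).
have lam0 : 0 <= lam by rewrite divr_ge0 ?mulr_ge0 // ltW.
have B1 H0 : nc (Ex p%:C (fun H => expi (f (mix (inner AA) H0 H)))) <= 1.
  by apply: le_trans (normc_Ex p0 p1 _) _; apply: Ex_le_cst => // K; rewrite normc_expi.
have hB H0 : Ex p X / 2 <= X H0 -> nc (Ex p%:C (fun H => expi (f (mix (inner AA) H0 H)))) <= be.
  by move=> /has_transversals[Zs [CC h]]; exact: hbe h.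
apply: le_trans (mcdiarmid_lower p0 p1 lam0 be0 X_diff B1 hB) _.
rewrite lerD2l ler_expR EX.
apply: (@le_trans _ _ (2 * lam ^+ 2 * V - lam * (L%:R * m%:R * q / 2))).
  by rewrite lerD2r; apply: ler_wpM2l; [rewrite mulr_ge0 ?sqr_ge0 | exact: sum_c].
rewrite le_eqVlt; apply/orP; left; apply/eqP; rewrite /lam /V; field.
by rewrite !gt_eqF.
Qed.
End Transversals.

(** * Exponentials against powers of w *)

Section Asymptotics.
Variable R : realType.

Lemma nat_above (x : R) : exists w0 : nat, forall w, (w0 <= w)%N -> x <= w%:R.
Proof.
exists (Num.truncn `|x|).+1 => w hw; apply: le_trans (ler_norm x) _.
apply: le_trans (ltW (truncnS_gt _)) _; by rewrite ler_nat.
Qed.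

Lemma poly_exp_small_real (c C : R) E : 0 < c -> exists2 x0 : R, 0 <= x0 & forall x, x0 <= x ->
  C * x ^+ E * expR (- (c * x)) <= 1.
Proof.
move=> c0; exists (`|C| * (E.+1)`!%:R / c ^+ E.+1) => [|x h].
  by rewrite divr_ge0 ?mulr_ge0 ?exprn_ge0 // ltW.
have x0 : 0 <= x by apply: le_trans h; rewrite divr_ge0 ?mulr_ge0 ?exprn_ge0 // ltW.
rewrite expRN ler_pdivrMr ?expR_gt0 // mul1r.
have cw : 0 <= c * x by rewrite mulr_ge0 // ltW.
apply: le_trans (_ : (c * x) ^+ E.+1 / (E.+1)`!%:R <= _); last first.
  by have := expR_ge1Dxn E cw; apply: le_trans; rewrite lerDr.
have f0 : 0 < (E.+1)`!%:R :> R by rewrite ltr0n fact_gt0.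
rewrite ler_pdivlMr // exprMn [x ^+ E.+1]exprSr.
move: h; rewrite ler_pdivrMr ?exprn_gt0 // => h.
have w1 : 0 <= x ^+ E by rewrite exprn_ge0.
have := ler_wpM2l w1 (le_trans (ler_wpM2r (ltW f0) (ler_norm C)) h).
set A := _ ^+ E; set B := c ^+ _; set D := _%:R; nra.
Qed.

Lemma poly_exp_small (c C : R) E : 0 < c -> exists w0 : nat, forall w, (w0 <= w)%N ->
  C * w%:R ^+ E * expR (- (c * w%:R)) <= 1.
Proof.
move=> /(poly_exp_small_real C E)[x0 _ h]; have [w0 hw] := nat_above x0.
by exists w0 => w /hw /h.
Qed.

Lemma pi_le4 : pi <= 4 :> R.
Proof. have := @pihalf_lt2 R; lra. Qed.

(** [B] is polynomial in [w] and [J] is fixed, so the decay e^(-cw) wins. The threshold depends on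
    the constants only, uniformly in [x], [B] and [X]. *)
Lemma main_term_small (c B0 B1 C : R) a E J q : 0 < c -> 1 <= B0 -> 0 <= C ->
  exists w0 : nat, forall w, (w0 <= w)%N -> forall (x B X : R),
    x <= B1 * w%:R ^+ a -> 0 <= B <= B0 * x -> c * w%:R <= X ->
    C * w%:R ^+ E * (\sum_(j < J) B ^+ j * (expR (- X) * expR 1 ^+ (j * q))) <= 1.
Proof.
move=> c0 hB0 C0; pose B2 := B0 * (1 + `|B1|) * expR 1 ^+ q.
have e1 : 1 <= expR 1 ^+ q :> R by rewrite exprn_ege1 // -expR0 ler_expR.
have hB2 : 1 <= B2.
  by apply: mulr_ege1 => //; apply: mulr_ege1 => //; rewrite lerDl.
have [w0 h] := poly_exp_small (J%:R * C * B2 ^+ J) (E + a * J) c0.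
exists (maxn w0 1) => w; rewrite geq_max => /andP[/h {}h w1] x B X hx /andP[B_ge0 hB] hX.
apply: le_trans h.
have w1' : 1 <= w%:R :> R by rewrite ler1n.
pose Y := B2 * w%:R ^+ a.
have Y1 : 1 <= Y by apply: mulr_ege1 => //; exact: exprn_ege1.
have BY : B * expR 1 ^+ q <= Y.
  rewrite /Y /B2 -[leRHS]mulrA [_ ^+ q * _]mulrC mulrA; apply: ler_wpM2r; first exact: le_trans e1.
  apply: le_trans hB _; rewrite -mulrA; apply: ler_wpM2l; first exact: le_trans hB0.
  apply: le_trans hx _; rewrite ler_wpM2r ?exprn_ge0 //.
  by apply: le_trans (ler_norm _) _; rewrite lerDr.
have : \sum_(j < J) B ^+ j * (expR (- X) * expR 1 ^+ (j * q)) <= J%:R * (Y ^+ J * expR (- (c * w%:R))).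
  rewrite mulr_natl -[X in _ *+ X]card_ord -sumr_const; apply: ler_sum => j _.
  rewrite [expR (- X) * _]mulrC mulrA mulnC exprM -exprMn; apply: ler_pM.
  - by apply: exprn_ge0; rewrite mulr_ge0 // exprn_ge0 ?expR_ge0.
  - exact: expR_ge0.
  - apply: (@le_trans _ _ (Y ^+ j)).
      apply: lerXn2r => //; rewrite nnegrE; last exact: le_trans Y1.
      by rewrite mulr_ge0 // exprn_ge0 ?expR_ge0.
    by apply: ler_weXn2l; [exact: Y1 | exact: ltnW (ltn_ord j)].
  by rewrite ler_expR lerN2.
have CE : 0 <= C * w%:R ^+ E by rewrite mulr_ge0 ?exprn_ge0.
move=> /(ler_wpM2l CE) /le_trans; apply; rewrite /Y exprMn -exprM exprD.
rewrite le_eqVlt; apply/orP; left; apply/eqP; ring.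
Qed.

(** With eta = w^(-1/2) the power eta^J is at most w^(-(E+1)), whereas X / eta^2 stays below D. *)
Lemma taylor_term_small (C D : R) E J : 0 <= C -> (E.+1 * 2 <= J)%N ->
  exists w0 : nat, forall w, (w0 <= w)%N -> forall X, X <= D / w%:R ->
    C * w%:R ^+ E * (4 * Num.sqrt (w%:R^-1) ^+ J * expR (2 * X / Num.sqrt (w%:R^-1) ^+ 2)) <= 1.
Proof.
move=> C0 EJ; have [w0 h] := nat_above (C * 4 * expR (2 * D)).
exists (maxn w0 1) => w; rewrite geq_max => /andP[/h {}h w1] X hX.
have w1' : 1 <= w%:R :> R by rewrite ler1n.
have w0' : 0 < w%:R :> R by rewrite ltr0n.
set z := Num.sqrt _; have z2 : z ^+ 2 = w%:R^-1 by rewrite sqr_sqrtr // invr_ge0.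
have z0 : 0 <= z by exact: sqrtr_ge0.
have z1 : z <= 1.
  by rewrite -(@ler_pXn2r _ 2) ?nnegrE // z2 expr1n invf_le1.
have zJ : z ^+ J <= (w%:R ^+ E.+1)^-1.
  apply: (@le_trans _ _ (z ^+ (2 * E.+1))); last by rewrite exprM z2 exprVn.
  by apply: ler_wiXn2l => //; rewrite mulnC.
have ex : expR (2 * X / z ^+ 2) <= expR (2 * D).
  rewrite ler_expR z2 invrK -mulrA ler_wpM2l //.
  by rewrite -ler_pdivlMr.
have : 4 * z ^+ J * expR (2 * X / z ^+ 2) <= 4 * (w%:R ^+ E.+1)^-1 * expR (2 * D).
  apply: ler_pM => //; rewrite ?expR_ge0 ?mulr_ge0 ?exprn_ge0 //.
  by rewrite ler_wpM2l.
have CE : 0 <= C * w%:R ^+ E by rewrite mulr_ge0 ?exprn_ge0.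
move=> /(ler_wpM2l CE) /le_trans; apply.
have -> : C * w%:R ^+ E * (4 * (w%:R ^+ E.+1)^-1 * expR (2 * D)) = C * 4 * expR (2 * D) / w%:R.
  have a0 : w%:R ^+ E != 0 :> R by rewrite expf_neq0 // gt_eqF.
  by rewrite exprSr; move: a0; set A := _ ^+ E => a0; field; rewrite a0 gt_eqF.
by rewrite ler_pdivrMr // mul1r.
Qed.

Lemma deviation_term_small (C c : R) E : 0 <= C -> 0 < c ->
  exists w0 : nat, forall w, (w0 <= w)%N -> forall X, c * w%:R <= X ->
    C * w%:R ^+ E * expR (- X) <= 1.
Proof.
move=> C0 c0; have [w0 h] := poly_exp_small C E c0.
exists w0 => w /h {}h X hX; apply: le_trans h; rewrite ler_wpM2l ?mulr_ge0 ?exprn_ge0 //.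
by rewrite ler_expR lerN2.
Qed.

End Asymptotics.

(** With a = nw/X and (a+1)^3 <= 4(a^3 + 1), the cost splits into w^3 N / X^2 <= 1/w and X N / n^3
    <= 16/w; 68 is 4(1 + 16). *)
Lemma band_cost_le (R : realType) (n w X N g : R) : 1 <= w -> w <= n ->
  w ^+ 4 <= X -> 0 <= N -> N <= w ^+ 4 -> X * N <= 16 * n ^+ 2 -> 0 <= g -> g <= n * w / X + 1 ->
  400 * X * N * g ^+ 3 / n ^+ 3 <= 400 * (68 / w).
Proof.
move=> w1 wn hX N0 hN XN g0 hg.
have w0 : 0 < w by exact: lt_le_trans w1.
have n0 : 0 < n by exact: lt_le_trans wn.
have X0 : 0 < X by apply: lt_le_trans hX; rewrite exprn_gt0.
set a := n * w / X in hg.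
have a0 : 0 <= a by rewrite divr_ge0 ?mulr_ge0 // ltW.
have hg3 : g ^+ 3 <= 4 * (a ^+ 3 + 1).
  apply: (@le_trans _ _ ((a + 1) ^+ 3)).
    by apply: lerXn2r => //; rewrite nnegrE // addr_ge0.
  have : 0 <= (a - 1) ^+ 2 * (a + 1) by rewrite mulr_ge0 ?sqr_ge0 ?addr_ge0.
  by move: a a0 {hg} => a a0 h; lra.
have c0 : 0 <= X * N / n ^+ 3 by rewrite divr_ge0 ?exprn_ge0 ?mulr_ge0 // ltW.
have -> : 400 * X * N * g ^+ 3 / n ^+ 3 = 400 * (X * N / n ^+ 3 * g ^+ 3) by field; rewrite gt_eqF.
rewrite ler_wpM2l //; apply: le_trans (ler_wpM2l c0 hg3) _.
have -> : X * N / n ^+ 3 * (4 * (a ^+ 3 + 1)) = 4 * (w ^+ 3 * N / X ^+ 2 + X * N / n ^+ 3).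
  by rewrite /a; field; rewrite !gt_eqF.
have h1 : w ^+ 3 * N / X ^+ 2 <= w^-1.
  rewrite ler_pdivrMr ?exprn_gt0 // [_^-1 * _]mulrC ler_pdivlMr //.
  apply: (@le_trans _ _ (w ^+ 4 * w ^+ 4)).
    rewrite (_ : w ^+ 3 * N * w = w ^+ 4 * N); last by ring.
    by rewrite ler_wpM2l // exprn_ge0 // ltW.
  by rewrite expr2 ler_pM // exprn_ge0 // ltW.
have h2 : X * N / n ^+ 3 <= 16 / w.
  rewrite ler_pdivrMr ?exprn_gt0 //; apply: le_trans XN _.
  rewrite [16 / w * _]mulrAC ler_pdivlMr // -mulrA [n ^+ 3]exprSr ler_wpM2l //.
  by rewrite ler_wpM2l // exprn_ge0 // ltW.
apply: (@le_trans _ _ (4 * (w^-1 + 16 / w))).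
  by rewrite ler_wpM2l // lerD.
by rewrite le_eqVlt; apply/orP; left; apply/eqP; field; rewrite gt_eqF.
Qed.

Lemma deviation_exponent_le (R : realType) (c K n w N D q : R) : 0 < c -> 0 < K -> 1 <= w ->
  w ^+ 10 <= n -> 0 < N -> N <= w ^+ 4 -> 0 < D -> D <= K * w ^+ 4 -> 0 <= q ->
  q / (c * K) * w <= q * n / (c * N * D).
Proof.
move=> c0 K0 w1 wn N0 Nw D0 Dw q0; have w0 : 0 < w by exact: lt_le_trans w1.
rewrite ler_pdivlMr ?mulr_gt0 // (_ : _ * (c * N * D) = q * (w * (N * D) / K)); last first.
  by field; rewrite !gt_eqF.
apply: ler_wpM2l => //; apply: le_trans wn; rewrite ler_pdivrMr //.
apply: (@le_trans _ _ (w * (w ^+ 4 * (K * w ^+ 4)))).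
  by apply: ler_wpM2l; [exact: ltW | apply: ler_pM => //; exact: ltW].
rewrite (_ : w * _ = w ^+ 9 * K); last by ring.
by apply: ler_wpM2r; [exact: ltW | exact: ler_weXn2l].
Qed.

Lemma main_exponent_le (R : realType) (a q w n X g : R) : 0 <= a -> 0 < n -> 0 < X ->
  n * w / X <= g -> a * (q ^+ 2 / 16) * w <= a * (q ^+ 2 * X * g / (16 * n)).
Proof.
move=> a0 n0 X0; rewrite ler_pdivrMr // => h.
rewrite -mulrA ler_wpM2l //; move: (q ^+ 2) (sqr_ge0 q) => Q Q0.
rewrite -!mulrA; apply: ler_wpM2l => //.
rewrite !mulrA ler_pdivlMr ?mulr_gt0 // (_ : 16^-1 * _ * _ = n * w); last by field.
by rewrite [X * _]mulrC.
Qed.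

Lemma block_size_facts w n K Mex : (8 <= w)%N -> (10 <= Mex)%N -> (w ^ Mex <= n)%N ->
  (2 * K <= w)%N -> [/\ (w <= n)%N, (w ^ 10 <= n)%N & (2 * (K * w ^ 4) <= n)%N].
Proof.
move=> w8 M10 hn hK; have w1 : (0 < w)%N by exact: leq_trans w8.
have hn10 : (w ^ 10 <= n)%N by apply: leq_trans hn; rewrite leq_exp2l //; exact: leq_trans w8.
split=> //; apply: leq_trans hn10; first by rewrite -{1}(expn1 w) leq_pexp2l.
rewrite mulnA; apply: (@leq_trans (w * w ^ 4)); first by rewrite leq_mul2r hK orbT.
by rewrite -expnS leq_pexp2l.
Qed.

Lemma card_A0C n n0 : (#|~: @A0 n n0| <= n - n0)%N.
Proof.
apply: leq_trans (card_ord_itv_le n n0 (n - n0)); apply: subset_leq_card.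
apply/subsetP => i; rewrite !inE -leqNgt => h; rewrite h /=.
by have := ltn_ord i; move: h; clear; lia.
Qed.

(** * Decay for a frozen outcome with a transversal family *)

Section Level.
Variables (R : realType) (p : R) (d k Mex K1 : nat).
Hypotheses (p0 : 0 < p) (p1 : p < 1) (M10 : (10 <= Mex)%N) (K1_gt0 : (0 < K1)%N).
Let r := (d + 2 + k)%N.
Let E := (Mex * r * 2 ^ d)%N.
Let C2 : R := 2 ^+ (2 ^ d) * 2 ^+ E.

Let C2_ge0 : 0 <= C2. Proof. by rewrite mulr_ge0 ?exprn_ge0. Qed.

Lemma kap0_gt0 : 0 < kap0 p d k.
Proof.
have q0 : 0 < 1 - p by rewrite subr_gt0.
rewrite /kap0 divr_gt0 // mulr_gt0 //; first by rewrite mulr_gt0 ?exprn_gt0 // invr_gt0 exprn_gt0.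
by rewrite exprn_gt0 // mulr_gt0 ?exprn_gt0 // divr_gt0 // ltr0n; clear; lia.
Qed.

Let pow_le w n : (n <= (2 * w) ^ Mex)%N -> n%:R ^+ r <= 2 ^+ (Mex * r) * w%:R ^+ (Mex * r) :> R.
Proof.
by move=> h; rewrite -exprMn -natrM -!natrX ler_nat expnM; exact: exp_mono.
Qed.

Let target_le w n : (n <= (2 * w) ^ Mex)%N ->
  (2 * n%:R ^+ r) ^+ (2 ^ d) <= C2 * w%:R ^+ E :> R.
Proof.
move=> /pow_le h; rewrite exprMn /C2 -mulrA ler_wpM2l ?exprn_ge0 //.
rewrite /E !(exprM _ (Mex * r)) -exprMn; apply: lerXn2r => //.
  by rewrite nnegrE exprn_ge0.
by rewrite nnegrE mulr_ge0 ?exprn_ge0.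
Qed.

Lemma root_combine (m : nat) (x y W a b c : R) : (0 < m)%N -> 0 <= x -> 0 < y -> 0 < W ->
  y ^+ m <= W -> 3 * W * a <= 1 -> 3 * W * b <= 1 -> 3 * W * c <= 1 ->
  x ^+ m <= a + b + c -> x <= y^-1.
Proof.
move=> m0 x0 y0 W0 yW ha hb hc hx.
have yi : 0 <= y^-1 by rewrite invr_ge0 ltW.
rewrite -(@ler_pXn2r _ m) // exprVn; apply: le_trans hx _.
apply: (@le_trans _ _ (W^-1)); last by rewrite lef_pV2 // posrE exprn_gt0.
rewrite -div1r ler_pdivlMr //; lra.
Qed.

(** The bandwidth is just large enough for X2 dg / n >= w, so the main term is e^(-cw), while the
    Taylor cost remains O(1/w) with eta = w^(-1/2). Each of the three terms of [block_bound] falls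
    below a third of the target raised to the power 2^d, and [root_combine] extracts the root. *)
Theorem structured_small : exists w0 : nat, forall w n n0 N (s : R) H0 Zs CC,
  (w0 <= w)%N -> (w ^ Mex <= n)%N -> (n <= (2 * w) ^ Mex)%N -> (n0 <= n)%N ->
  (n - n0 + 1 <= K1 * w ^ 4)%N -> (0 < N)%N -> (N <= w ^ 4)%N ->
  `|s| * (N%:R * n%:R ^+ k) <= pi -> w%:R ^+ 4 <= s ^+ 2 * N%:R * n%:R ^+ (2 * k + 2) ->
  transversal_family (@A0 n n0) H0 d N Zs CC ->
  nc (Ex p%:C (fun H => expi (s * cliques R r (mix (inner (@A0 n n0)) H0 H)))) <=
  (2 * n%:R ^+ r)^-1.
Proof.
(* With 2(E + 1) Taylor terms, eta^J beats w^E with a factor w to spare. *)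
pose J := (E.+1 * 2)%N; pose kp := kap0 p d k; have kp0 : 0 < kp by exact: kap0_gt0.
have q0 : 0 < 1 - p by rewrite subr_gt0.
have K1R : 0 < K1%:R :> R by rewrite ltr0n.
have C30 : 0 <= 3 * C2 by rewrite mulr_ge0.
pose c1 := p * (1 - p) / 16 * (kp ^+ 2 / 16).
have c10 : 0 < c1 by rewrite /c1 !(mulr_gt0, divr_gt0, exprn_gt0).
pose c3 := kp ^+ 2 / (64 * 3200 * K1%:R).
have num0 : 0 < 64 * 3200 :> R by rewrite mulr_gt0 ?ltr0n.
have c30 : 0 < c3.
  by apply: divr_gt0; [exact: exprn_gt0 | exact: mulr_gt0].
pose B0 : R := 8 * (1 + 2 * (r ^ 2)%:R).
have B01 : 1 <= B0.
  have : 0 <= (r ^ 2)%:R :> R by []. 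
  by rewrite /B0; lra.
have [w1 h1] := main_term_small (2 ^+ (Mex * r)) (Mex * r) E J (r ^ 2) c10 B01 C30.
have [w2 h2] := taylor_term_small (400 * 68) C30 (leqnn (E.+1 * 2)).
have [w3 h3] := deviation_term_small E C30 c30.
exists (w1 + w2 + w3 + 2 * K1 + 4 * (k + 2) + 8)%N.
move=> w n n0 N s H0 Zs CC hw wn nw n0n hD N0 Nw sN X4 hT.
have [W1 W2 W3 W4 [W5 W6]] : [/\ (w1 <= w)%N, (w2 <= w)%N, (w3 <= w)%N, (2 * K1 <= w)%N &
  (4 * (k + 2) <= w)%N /\ (8 <= w)%N].
  by do !split; move: hw; clear; lia.
have [wn1 wn10 Kn] := block_size_facts W6 M10 wn W4.
have wR : 1 <= w%:R :> R by rewrite ler1n; apply: leq_trans W6.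
have w0 : 0 < w%:R :> R by exact: lt_le_trans wR.
have nR : 0 < n%:R :> R by rewrite ltr0n; apply: leq_trans wn1; exact: leq_trans W6.
have NR : 1 <= N%:R :> R by rewrite ler1n.
have N0R : 0 < N%:R :> R by exact: lt_le_trans NR.
have NwR : N%:R <= w%:R ^+ 4 :> R by rewrite -natrX ler_nat.
have nk0 : 0 < n%:R ^+ k :> R by rewrite exprn_gt0.
have nk1 : 1 <= n%:R ^+ k :> R by rewrite exprn_ege1 // ler1n; apply: leq_trans wn1; exact: leq_trans W6.
set X2 := s ^+ 2 * N%:R * n%:R ^+ (2 * k + 2) in X4.
have X20 : 0 < X2 by apply: lt_le_trans X4; rewrite exprn_gt0.
have s0 : s != 0 by apply: contraTneq X20 => s0; rewrite /X2 s0 expr0n /= !mul0r ltxx.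
have s4 : `|s| <= 4.
  apply: le_trans (pi_le4 R); apply: le_trans sN; rewrite ler_peMr //.
  by apply: mulr_ege1.
have X2N : X2 * N%:R <= 16 * n%:R ^+ 2.
  have -> : X2 * N%:R = (`|s| * (N%:R * n%:R ^+ k)) ^+ 2 * n%:R ^+ 2.
    by rewrite /X2 exprD mulnC exprM exprMn real_normK ?num_real //; ring.
  rewrite ler_wpM2r ?exprn_ge0 // (_ : 16 = 4 ^+ 2); last by rewrite -natrX.
  by apply: lerXn2r; rewrite ?nnegrE //; exact: le_trans sN (pi_le4 R).
pose a := n%:R * w%:R / X2.
have a0 : 0 <= a by apply: divr_ge0; [exact: mulr_ge0 | exact: ltW].
(* The successor makes the bandwidth positive and at least [a], at the price of an additive 1. *)
pose dg := (Num.truncn a).+1.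
have dga : a <= dg%:R by exact: ltW (truncnS_gt a).
have dga1 : dg%:R <= a + 1.
  by rewrite /dg -natr1 lerD2r; have /andP[] := truncn_itv a0.
have w8R : 8 <= w%:R :> R by rewrite ler_nat.
have a8 : a <= n%:R / 8.
  rewrite /a ler_pdivrMr // -mulrA ler_wpM2l // ler_pdivlMl //.
  apply: le_trans X4; rewrite exprSr; apply: ler_wpM2r => //.
  by apply: le_trans w8R _; rewrite -[leLHS]expr1 ler_weXn2l.
have n8R : 8 <= n%:R :> R by apply: le_trans w8R _; rewrite ler_nat.
have dg4 : (4 * dg <= n)%N by rewrite -(ler_nat R) natrM; lra.
have n0_ge : (n <= 2 * n0)%N by move: hD Kn n0n; clear; lia.
have n_large : (4 * (k + 2) <= n)%N by exact: leq_trans W5 wn1.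
case: (hT) => -[subZ disjZ sizeZ NZ] [CC_sub CC_card CC_clique CC_hit] NCC.
have eta0 : 0 < Num.sqrt (w%:R^-1) :> R by rewrite sqrtr_gt0 invr_gt0.
have := block_bound (ltW p0) (ltW p1) subZ disjZ sizeZ CC_sub CC_card CC_clique CC_hit N0 NZ NCC
  s0 sN n0n n0_ge (ltn0Sn _ : (0 < dg)%N) dg4 n_large J eta0.
have W0 : 0 < C2 * w%:R ^+ E by rewrite !mulr_gt0 ?exprn_gt0.
have y0 : 0 < 2 * n%:R ^+ r :> R by rewrite mulr_gt0 ?exprn_gt0.
rewrite -/r -/X2 -/kp.
move=> hb; apply: (root_combine _ (normc_ge0 _) y0 W0 (target_le nw) _ _ _ hb).
- by rewrite expn_gt0.
- rewrite [3 * (C2 * _)]mulrA; apply: h1 W1 _ _ _ (pow_le nw) _ _.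
    apply/andP; split; first by rewrite !mulr_ge0 ?addr_ge0.
    rewrite /B0 [leRHS]mulrC; apply: ler_pM => //.
      by rewrite -natrX ler_nat bin_le_exp.
    rewrite mulrA; apply: ler_wpM2r; first by rewrite addr_ge0.
    by apply: (@le_trans _ _ (2 * 4)); [rewrite ler_wpM2l | rewrite -natrM].
  by apply: main_exponent_le => //; rewrite divr_ge0 ?mulr_ge0 // ltW.
- rewrite [3 * (C2 * _)]mulrA; apply: h2 W2 _ _.
  apply: le_trans (@band_cost_le R n%:R w%:R X2 N%:R dg%:R wR _ X4 _ NwR X2N _ dga1) _ => //.
    by rewrite ler_nat.
  by rewrite mulrA.
rewrite [3 * (C2 * _)]mulrA; apply: h3 W3 _ _.
have D1 : #|~: @A0 n n0|%:R + 1 <= K1%:R * w%:R ^+ 4 :> R.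
  rewrite -natrX -natrM natr1 ler_nat -addn1; apply: leq_trans hD; rewrite leq_add2r.
  exact: card_A0C.
have D00 : 0 < #|~: @A0 n n0|%:R + 1 :> R by apply: ltr_wpDl.
have w10 : w%:R ^+ 10 <= n%:R :> R by rewrite -natrX ler_nat.
exact: (@deviation_exponent_le R (64 * 3200) _ _ _ _ _ (kp ^+ 2) num0 K1R wR w10 N0R NwR D00 D1 (sqr_ge0 kp)).
Qed.
End Level.

(** * Decay at a fixed number of blocks *)

Section LevelBound.
Variables (R : realType) (p : R) (k Mex : nat).
Hypotheses (p0 : 0 < p) (p1 : p < 1) (M10 : (10 <= Mex)%N).

Let half_le (r n : nat) : (0 < n)%N -> (2 * n%:R ^+ r)^-1 <= (n%:R ^+ r)^-1 :> R.
Proof.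
move=> n0; have h : 0 < n%:R ^+ r :> R by rewrite exprn_gt0 // ltr0n.
by rewrite lef_pV2 ?posrE ?mulr_gt0 // ler_peMl ?ler1n // ltW.
Qed.

(** Without blocks, [AA] is the whole vertex set and the only transversal clique is the empty set,
    so N = 1. *)
Lemma level_bound0 : exists w0 : nat, forall w n (s : R),
  (w0 <= w)%N -> (w ^ Mex <= n)%N -> (n <= (2 * w) ^ Mex)%N ->
  `|s| * n%:R ^+ k <= pi -> w%:R ^+ 4 <= s ^+ 2 * n%:R ^+ (2 * k + 2) ->
  nc (Ex p%:C (fun H : graph n => expi (s * cliques R (2 + k) H))) <= (n%:R ^+ (2 + k))^-1.
Proof.
have [w0 h] := structured_small 0 k p0 p1 M10 (ltn0Sn 0).
exists (maxn w0 1) => w n s; rewrite geq_max => /andP[hw w1] wn nw sN X4.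
have n0 : (0 < n)%N by apply: leq_trans wn; rewrite expn_gt0 w1.
rewrite (Ex_resample p%:C (inner (@A0 n n))) Ex_swap.
apply: le_trans (normc_Ex (ltW p0) (ltW p1) _) _.
apply: Ex_le_cst (ltW p0) (ltW p1) _ _ _ => H0.
apply: le_trans (half_le (2 + k) n0).
apply: (h w n n 1%N s H0 [::] [set set0]) => //; rewrite ?mul1r ?mulr1 //.
- by rewrite subnn mul1n expn_gt0 w1.
- by rewrite expn_gt0 w1.
split; last by rewrite cards1.
  by split=> //; rewrite big_nil.
split=> [C|C|C|C Z _]; last by rewrite in_nil.
- by rewrite in_set1 => /eqP ->; exact: sub0set.
- by rewrite in_set1 => /eqP ->; exact: cards0.
rewrite in_set1 => /eqP ->; apply/subsetP => e; rewrite inE subset0 => /eqP he.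
by have := card_edge e; rewrite he cards0.
Qed.

(** [transversal_bound] with [w] candidate tuples and N K0 candidate vertices; K0 >= 2/q makes half
    the expected number of extensions at least N. The target n^(-r) is shared equally by the
    structured outcomes and the exceptional ones. *)
Lemma level_boundS d : exists w0 : nat, forall w n N (s : R),
  (w0 <= w)%N -> (w ^ Mex <= n)%N -> (n <= (2 * w) ^ Mex)%N -> (0 < N)%N -> (N <= w ^ 4)%N ->
  `|s| * (N%:R * n%:R ^+ k) <= pi -> w%:R ^+ 4 <= s ^+ 2 * N%:R * n%:R ^+ (2 * k + 2) ->
  nc (Ex p%:C (fun H : graph n => expi (s * cliques R (d.+1 + 2 + k) H))) <= (n%:R ^+ (d.+1 + 2 + k))^-1.
Proof.
set r := (d.+1 + 2 + k)%N; pose q := p ^+ 'C(d.+1, 2).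
have q0 : 0 < q by rewrite exprn_gt0.
have [K0 hK] := nat_above (2 / q); have {hK} := hK K0 (leqnn _).
rewrite ler_pdivrMr // => hK.
pose K1 := (K0 + d + 1)%N; have K10 : (0 < K1)%N by rewrite /K1 addn1.
have [w1 h1] := structured_small d.+1 k p0 p1 M10 K10.
have c0 : 0 < q ^+ 2 / (32 * (d.+1 ^ 2)%:R).
  by rewrite divr_gt0 ?exprn_gt0 // mulr_gt0 // ltr0n expn_gt0.
have [w2 h2] := poly_exp_small (2 * 2 ^+ (Mex * r)) (Mex * r) c0.
exists (w1 + w2 + 2 * K1 + 8)%N => w n N s hw wn nw N0 Nw sN X4.
have [W1 W2 W3 W4] : [/\ (w1 <= w)%N, (w2 <= w)%N, (2 * K1 <= w)%N & (8 <= w)%N].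
  by split; move: hw; clear; lia.
have [wn1 wn10 Kn] := block_size_facts W4 M10 wn W3.
have n0 : (0 < n)%N by apply: leq_trans wn1; exact: leq_trans W4.
have w4 : (w <= w ^ 4)%N by rewrite -[X in (X <= _)%N]expn1 leq_pexp2l //; exact: leq_trans W4.
have Dw : (N * K0 + w * d + 1 <= K1 * w ^ 4)%N.
  rewrite /K1 !mulnDl mul1n; apply: leq_add; last by rewrite expn_gt0; apply/orP; left; exact: leq_trans W4.
  by apply: leq_add; rewrite mulnC leq_mul2l ?Nw ?w4 orbT.
have Dn : (N * K0 + w * d <= n)%N by move: Dw Kn; clear; lia.
pose n1 := (n - (N * K0 + w * d))%N.
have n1E : (n1 + N * K0 + w * d)%N = n by rewrite /n1; move: Dn; clear; lia.
have hN : N%:R <= (N * K0)%:R * p ^+ 'C(d.+1, 2) / 2 :> R.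
  rewrite -/q natrM ler_pdivlMr // -mulrA ler_wpM2l //.
have be0 : 0 <= (2 * n%:R ^+ r)^-1 :> R by rewrite invr_ge0 mulr_ge0 ?exprn_ge0.
have w0 : (0 < w)%N by exact: leq_trans W4.
apply: le_trans (transversal_bound (ltW p0) (ltW p1) n1E N0 hN w0 be0 _) _.
  move=> H0 Zs CC hT.
  apply: (h1 w n n1 N s H0 Zs CC) => //; rewrite /n1 ?leq_subr //.
  by rewrite subKn.
have nr : 0 < n%:R ^+ r :> R by rewrite exprn_gt0 // ltr0n.
apply: (@le_trans _ _ ((2 * n%:R ^+ r)^-1 + (2 * n%:R ^+ r)^-1)); last first.
  by rewrite le_eqVlt; apply/orP; left; apply/eqP; field; rewrite gt_eqF.
rewrite lerD2l -/q -[leRHS]div1r ler_pdivlMr ?mulr_gt0 //.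
apply: le_trans (h2 w W2); rewrite mulrC [q ^+ 2 / _ * _]mulrAC [q ^+ 2 * _]mulrC mulrA.
apply: ler_wpM2r; first exact: expR_ge0.
rewrite -mulrA ler_wpM2l // -exprMn -natrM -!natrX ler_nat expnM; exact: exp_mono.
Qed.
End LevelBound.

Lemma uniform_threshold (P : nat -> nat -> Prop) m :
  (forall d, exists w0 : nat, forall w, (w0 <= w)%N -> P d w) ->
  exists w0 : nat, forall w, (w0 <= w)%N -> forall d, (d < m)%N -> P d w.
Proof.
move=> h; elim: m => [|m [w0 h0]]; first by exists 0%N.
have [w1 h1] := h m; exists (maxn w0 w1) => w; rewrite geq_max => /andP[a b] d.
by rewrite ltnS leq_eqVlt => /orP[/eqP ->|dm]; [exact: h1 | exact: h0].
Qed.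

(** * Covering all frequencies up to pi *)

Section Cover.
Variables (R : realType) (p : R) (r Mex : nat).
Hypotheses (p0 : 0 < p) (p1 : p < 1) (M10 : (10 <= Mex)%N) (r2 : (2 <= r)%N).

(* Level [d] handles [pi / n^(k+1) < |s| <= pi / n^k] with [d + 2 + k = r], except that
   level 0 goes down to the fluctuation scale [1 / n^(r-1)]. *)
Lemma charfun_small_root : exists w0 : nat, forall w n (s : R),
  (w0 <= w)%N -> (w ^ Mex <= n)%N -> (n <= (2 * w) ^ Mex)%N ->
  `|s| <= pi -> w%:R ^+ 2 <= `|s| * n%:R ^+ (r - 1) ->
  nc (Ex p%:C (fun H : graph n => expi (s * cliques R r H))) <= (n%:R ^+ r)^-1.
Proof.
have [w1 h1] := level_bound0 (r - 2) p0 p1 M10.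
have hS d : exists w0 : nat, forall w, (w0 <= w)%N -> forall n N (s : R) k,
  (d.+1 + 2 + k)%N = r -> (w ^ Mex <= n)%N -> (n <= (2 * w) ^ Mex)%N -> (0 < N)%N -> (N <= w ^ 4)%N ->
  `|s| * (N%:R * n%:R ^+ k) <= pi -> w%:R ^+ 4 <= s ^+ 2 * N%:R * n%:R ^+ (2 * k + 2) ->
  nc (Ex p%:C (fun H : graph n => expi (s * cliques R r H))) <= (n%:R ^+ r)^-1.
  have [w0 h0] := level_boundS (r - d.+1 - 2) p0 p1 M10 d.
  exists w0 => w hw n N s k hk; have kE : k = (r - d.+1 - 2)%N by rewrite -hk; clear; lia.
  by have := h0 w n N s hw; rewrite -kE hk.
have [w2 h2] := uniform_threshold r hS.
exists (w1 + w2 + 2)%N => w n s hw wn nw spi sw.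
have [W1 W2 W3] : [/\ (w1 <= w)%N, (w2 <= w)%N & (2 <= w)%N] by split; move: hw; clear; lia.
have w1R : 1 <= w%:R :> R by rewrite ler1n; exact: ltnW.
have wn10 : (w ^ 10 <= n)%N by apply: leq_trans wn; rewrite leq_exp2l.
have n0 : (0 < n)%N by apply: leq_trans wn10; rewrite expn_gt0; apply/orP; left; exact: ltnW.
have nR : 0 < n%:R :> R by rewrite ltr0n.
have sq (m : nat) (b : R) : 0 <= b -> w%:R ^+ 2 <= `|s| * (b * n%:R ^+ (m + 1)) ->
    w%:R ^+ 4 <= s ^+ 2 * b ^+ 2 * n%:R ^+ (2 * m + 2).
  move=> b0 h; have h2' : 0 <= w%:R ^+ 2 :> R by rewrite exprn_ge0.
  have -> : s ^+ 2 * b ^+ 2 * n%:R ^+ (2 * m + 2) = (`|s| * (b * n%:R ^+ (m + 1))) ^+ 2.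
    rewrite !exprMn real_normK ?num_real // -exprM (_ : ((m + 1) * 2 = 2 * m + 2)%N) ?mulrA //.
    by clear; lia.
  by rewrite (exprM _ 2 2); apply: lerXn2r; rewrite ?nnegrE //; exact: le_trans h.
have [small|big] := leP (`|s| * n%:R ^+ (r - 2)) pi.
  have := h1 w n s W1 wn nw small; rewrite subnKC //; apply.
  have := sq (r - 2)%N 1 ler01; rewrite expr1n mulr1 mul1r; apply.
  by rewrite (_ : (r - 2 + 1 = r - 1)%N) //; move: r2; clear; lia.
have [k [kr hk1 hk2]] : exists k, [/\ (k < r - 2)%N, `|s| * n%:R ^+ k <= pi & pi < `|s| * n%:R ^+ (k + 1)].
  move: big; elim: (r - 2)%N => [|m IH]; first by rewrite expr0 mulr1 ltNge spi.
  have [hm|hm] := leP (`|s| * n%:R ^+ m) pi.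
    by move=> h; exists m; rewrite addn1.
  by move=> _; have [k [km h3 h4]] := IH hm; exists k; split=> //; exact: ltnW.
pose d := (r - 2 - k).-1.
have dE : (d.+1 + 2 + k)%N = r by rewrite /d; move: kr; clear; lia.
have dr : (d < r)%N by rewrite -dE; clear; lia.
(* Between pi and w^2 the phase variance is too small with N = 1. Taking N = w^4 multiplies it by
   w^4, and the phases stay below pi because w^6 <= w^10 <= n. *)
have [lo|hi] := leP (w%:R ^+ 2) (`|s| * n%:R ^+ (k + 1)).
  apply: (h2 w W2 d dr n 1%N s k) => //.
  - by rewrite expn_gt0; apply/orP; left; exact: ltnW.
  - by rewrite mul1r.
  by have := sq k 1 ler01; rewrite expr1n mul1r; apply.
apply: (h2 w W2 d dr n (w ^ 4)%N s k) => //.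
- by rewrite expn_gt0; apply/orP; left; exact: ltnW.
- apply: le_trans (pi_ge2 R); apply: (@le_trans _ _ 1); last by rewrite ler1n.
  rewrite natrX mulrCA -(ler_pM2r nR) mul1r.
  have -> : w%:R ^+ 4 * (`|s| * n%:R ^+ k) * n%:R = w%:R ^+ 4 * (`|s| * n%:R ^+ (k + 1)) :> R.
    by rewrite exprD expr1 -[LHS]mulrA -[X in _ * X]mulrA.
  apply: (@le_trans _ _ (w%:R ^+ 4 * w%:R ^+ 2)).
    by rewrite ler_wpM2l ?exprn_ge0 // ltW.
  rewrite -exprD; apply: (@le_trans _ _ (w ^ 10)%N%:R); last by rewrite ler_nat.
  by rewrite natrX ler_weXn2l.
have := sq k (w%:R ^+ 2) (exprn_ge0 _ (ler0n _ _)).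
rewrite -(exprM w%:R) -[_ ^+ (2 * 2)]natrX; apply; apply: (@le_trans _ _ (w%:R ^+ 2 * pi)).
  by rewrite ler_peMr ?exprn_ge0 //; apply: le_trans (pi_ge2 R); rewrite ler1n.
by rewrite mulrCA ler_wpM2l ?exprn_ge0 // ltW.
Qed.
End Cover.

Lemma integer_root M n : (0 < M)%N -> (0 < n)%N ->
  exists w, [/\ (0 < w)%N, (w ^ M <= n)%N & (n <= (2 * w) ^ M)%N].
Proof.
move=> M0 n0; have ex : exists i, (i ^ M <= n)%N by exists 1%N; rewrite exp1n.
have ub i : (i ^ M <= n)%N -> (i <= n)%N.
  by apply: leq_trans; case: i => // i; rewrite -{1}(expn1 i.+1) leq_pexp2l.
case: (ex_maxnP ex ub) => w wn wmax; have w0 : (0 < w)%N by apply: wmax; rewrite exp1n.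
exists w; split=> //; apply: ltnW; rewrite ltnNge; apply/negP => /wmax.
by move: w0; clear; lia.
Qed.

(** With w the integer part of the M-th root of n and M >= 2/a, one has w^2 <= n^(2/M) <= n^a, so
    the frequency condition of [charfun_small_root] holds. *)
Theorem charfun_small (R : realType) (p : R) (r : nat) (a : R) :
  0 < p -> p < 1 -> (2 <= r)%N -> 0 < a ->
  exists n0 : nat, forall n (s : R), (n0 <= n)%N -> `|s| <= pi ->
    n%:R `^ a <= `|s| * n%:R ^+ (r - 1) ->
    nc (Ex p%:C (fun H : graph n => expi (s * cliques R r H))) <= (n%:R ^+ r)^-1.
Proof.
move=> p0 p1 r2 a0; have [M1 hM1] := nat_above (2 / a).
pose M := (M1 + 10)%N; have M10 : (10 <= M)%N by rewrite /M leq_addl.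
have M0 : (0 < M)%N by exact: leq_trans M10.
have Ma : 2 / M%:R <= a.
  have := hM1 M (leq_addr _ _); rewrite ler_pdivrMr // => h.
  by rewrite ler_pdivrMr ?ltr0n // mulrC.
have [w0 h] := charfun_small_root p0 p1 M10 r2.
exists ((2 * w0) ^ M + 1)%N => n s hn spi hs.
have n0 : (0 < n)%N by move: hn; rewrite addn1; exact: leq_ltn_trans.
have [w [w_gt0 wn nw]] := integer_root M0 n0.
have w0w : (w0 <= w)%N.
  have : ((2 * w0) ^ M <= (2 * w) ^ M)%N by apply: leq_trans nw; apply: leq_trans hn; rewrite leq_addr.
  by rewrite leq_exp2r // leq_mul2l.
apply: (h w n s w0w wn nw spi); apply: le_trans hs.
have M0R : M%:R != 0 :> R by rewrite pnatr_eq0 -lt0n.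
have -> : w%:R ^+ 2 = (w%:R ^+ M) `^ (2 / M%:R) :> R.
  by rewrite -!powR_mulrn // -powRrM mulrCA divff // mulr1.
apply: (@le_trans _ _ (n%:R `^ (2 / M%:R))).
  apply: ge0_ler_powR; rewrite ?nnegrE ?exprn_ge0 ?divr_ge0 //.
  by rewrite -natrX ler_nat.
by apply: ler_powR => //; rewrite ler1n.
Qed.

(** * Hoeffding decomposition of a sum of monomials *)

Section Hoeffding.
Variables (R : realType) (T : finType) (p : R).
Hypotheses (p0 : 0 <= p) (p1 : p <= 1).
Implicit Types (U F G H : {set T}).

Definition chi (e : T) H : R := (e \in H)%:R - p.
(** The monomial without its constant and linear components, that is, its part of degree at least
    two in the centred edge variables. *)
Definition hrem F H : R := mono R F H - p ^+ #|F| - \sum_(e in F) p ^+ #|F|.-1 * chi e H.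

Lemma Ex_mem e : Ex p (fun H => (e \in H)%:R) = p.
Proof.
rewrite (eq_Ex _ (F2 := mono R [set e])); last by move=> H; rewrite /mono sub1set.
by rewrite Ex_mono cards1 expr1.
Qed.

Lemma Ex_chi e : Ex p (chi e) = 0.
Proof. by rewrite ExB Ex_mem Ex_cst subrr. Qed.

Lemma dep_chi e : dep [set e] (chi e).
Proof. by apply: (dep_op1 (fun b : bool => b%:R - p)); apply: dep_mem; rewrite inE. Qed.

Lemma Ex_chi_mix e U H : Ex p (fun G => chi e (mix U G H)) = if e \in U then 0 else chi e H.
Proof.
rewrite (eq_Ex _ (F2 := fun G => if e \in U then chi e G else chi e H)).
  by case: (e \in U); rewrite ?Ex_chi ?Ex_cst.
by move=> G; rewrite /chi in_mix; case: (e \in U).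
Qed.

Lemma norm_chi e H : `|chi e H| <= 1.
Proof. by rewrite /chi ler_norml; case: (e \in H); rewrite ?mulr1n ?mulr0n; apply/andP; split; move: p0 p1; lra. Qed.

Lemma dep_hrem F : dep F (hrem F).
Proof.
move=> G H; rewrite /hrem dep_mono; congr (_ - _); apply: eq_bigr => e eF.
by rewrite /chi in_mix eF.
Qed.

(** Given at most one coordinate of [F], the conditional mean of the monomial is affine in it and
    equals what was subtracted. All orthogonality relations of the remainder come from this. *)
Lemma Ex_hrem_mix F U H : (#|F :\: U| <= 1)%N -> Ex p (fun G => hrem F (mix U G H)) = 0.
Proof.
move=> FU; rewrite /hrem !ExB Ex_cst Ex_sum.
rewrite (eq_bigr (fun e => if e \notin U then p ^+ #|F|.-1 * chi e H else 0)); last first.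
  by move=> e _; rewrite ExZ Ex_chi_mix; case: (e \in U); rewrite ?mulr0.
rewrite (eq_Ex _ (F2 := fun G => mono R (F :&: U) G * mono R (F :\: U) H)); last first.
  by move=> G; exact: mono_mix.
rewrite ExZr Ex_mono -big_mkcondr /= (eq_bigl (mem (F :\: U))); last first.
  by move=> e; rewrite !inE andbC.
have cF : #|F| = (#|F :&: U| + #|F :\: U|)%N by rewrite cardsID.
have [|] := posnP #|F :\: U|.
  move=> FU0; have := FU0 => /eqP; rewrite cards_eq0 => /eqP ->.
  rewrite big_set0 subr0 /mono sub0set mulr1 cF FU0 addn0 subrr //.
move=> FU1; have /cards1P[e eE] : #|F :\: U| == 1%N by rewrite eqn_leq FU FU1.
rewrite eE big_set1 /mono sub1set /chi cF eE cards1 addn1 /= exprS; ring.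
Qed.

Lemma norm_hrem F H : `|hrem F H| <= (1 + #|F|)%:R.
Proof.
have pw m : 0 <= p ^+ m <= 1 by rewrite exprn_ge0 //= exprn_ile1.
rewrite /hrem natrD; apply: le_trans (ler_normB _ _) _; apply: lerD.
  have := mono_ge0 R F H; have := mono_le1 R F H; have /andP[] := pw #|F|.
  by rewrite ler_norml; move=> *; apply/andP; split; lra.
apply: le_trans (ler_norm_sum _ _ _) _; rewrite -[X in _ <= X%:R]sum1_card natr_sum; apply: ler_sum => e _.
have /andP[a0 a1] := pw #|F|.-1; rewrite normrM (ger0_norm a0).
by rewrite -[leRHS]mulr1; apply: ler_pM => //; exact: norm_chi.
Qed.

Variables (I : finType) (F : I -> {set T}).
Let f H : R := \sum_i mono R (F i) H.
Definition lincoef e : R := \sum_i (e \in F i)%:R * p ^+ #|F i|.-1.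
Definition linpart H : R := \sum_e lincoef e * chi e H.
Definition rempart H : R := \sum_i hrem (F i) H.

Lemma linpart_sum H : linpart H = \sum_i \sum_(e in F i) p ^+ #|F i|.-1 * chi e H.
Proof.
rewrite /linpart /lincoef; under eq_bigr do rewrite mulr_suml.
rewrite exchange_big /=; apply: eq_bigr => i _; rewrite [RHS]big_mkcond /=.
by apply: eq_bigr => e _; case: (e \in F i); rewrite ?mul1r ?mul0r.
Qed.

Lemma Ex_sum_mono : Ex p f = \sum_i p ^+ #|F i|.
Proof. by rewrite /f Ex_sum; apply: eq_bigr => i _; exact: Ex_mono. Qed.

Lemma hoeffding H : f H - Ex p f = linpart H + rempart H.
Proof.
rewrite Ex_sum_mono linpart_sum /f /rempart -sumrB -big_split /=; apply: eq_bigr => i _.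
by rewrite /hrem; ring.
Qed.

Lemma Ex_chi_rem e i : Ex p (fun H => hrem (F i) H * chi e H) = 0.
Proof.
apply: (@Ex_avg0 _ _ _ (~: [set e])); last by rewrite setCK; exact: dep_chi.
move=> H; apply: Ex_hrem_mix; rewrite setDE setCK; apply: leq_trans (subset_leq_card (subsetIr _ _)) _.
by rewrite cards1.
Qed.

Lemma Ex_rem_rem i j : (#|F i :&: F j| <= 1)%N -> Ex p (fun H => hrem (F i) H * hrem (F j) H) = 0.
Proof.
move=> h; apply: (@Ex_avg0 _ _ _ (~: F j)); last by rewrite setCK; exact: dep_hrem.
by move=> H; apply: Ex_hrem_mix; rewrite setDE setCK.
Qed.

Lemma Ex_chi_chi e e' : Ex p (fun H => chi e H * chi e' H) = if e == e' then p * (1 - p) else 0.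
Proof.
case: (eqVneq e e') => [<-|ne]; last first.
  apply: (@Ex_avg0 _ _ _ (~: [set e'])); last by rewrite setCK; exact: dep_chi.
  by move=> H; rewrite Ex_chi_mix !inE ne.
rewrite (eq_Ex _ (F2 := fun H => (1 - 2 * p) * (e \in H)%:R + p ^+ 2)).
  by rewrite ExD ExZ Ex_mem Ex_cst; ring.
by move=> H; rewrite /chi; case: (e \in H) => /=; rewrite ?mulr1n ?mulr0n; ring.
Qed.

Lemma Ex_linpart_sq : Ex p (fun H => linpart H ^+ 2) = p * (1 - p) * \sum_e lincoef e ^+ 2.
Proof.
rewrite (eq_Ex _ (F2 := fun H => \sum_e \sum_e' lincoef e * lincoef e' * (chi e H * chi e' H))).
  rewrite Ex_sum mulr_sumr; apply: eq_bigr => e _.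
  rewrite Ex_sum (bigD1 e) //= big1 ?addr0.
    by rewrite ExZ Ex_chi_chi eqxx; ring.
  by move=> e' ne; rewrite ExZ Ex_chi_chi eq_sym (negPf ne) mulr0.
move=> H; rewrite expr2 /linpart mulr_suml; apply: eq_bigr => e _.
by rewrite mulr_sumr; apply: eq_bigr => e' _; ring.
Qed.

Lemma Ex_linpart_rempart : Ex p (fun H => rempart H * linpart H) = 0.
Proof.
rewrite (eq_Ex _ (F2 := fun H => \sum_i \sum_e lincoef e * (hrem (F i) H * chi e H))).
  rewrite Ex_sum big1 // => i _; rewrite Ex_sum big1 // => e _.
  by rewrite ExZ Ex_chi_rem mulr0.
move=> H; rewrite /rempart mulr_suml; apply: eq_bigr => i _.
by rewrite mulr_sumr; apply: eq_bigr => e _; ring.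
Qed.

Lemma variance_hoeffding : Ex p (fun H => (f H - Ex p f) ^+ 2) =
  p * (1 - p) * (\sum_e lincoef e ^+ 2) + Ex p (fun H => rempart H ^+ 2).
Proof.
rewrite -Ex_linpart_sq -[in RHS](addr0 (Ex p (fun H => linpart H ^+ 2))).
rewrite -[X in _ + X + _](mulr0 2) -Ex_linpart_rempart -ExZ -!ExD; apply: eq_Ex => H.
by rewrite hoeffding; ring.
Qed.

(** By orthogonality only pairs sharing at least two edges survive, and each of them is bounded
    trivially. *)
Lemma rempart_sq_le (k : nat) : (forall i, (#|F i| <= k)%N) ->
  Ex p (fun H => rempart H ^+ 2) <=
  (1 + k)%:R ^+ 2 * #|[set ij : I * I | (1 < #|F ij.1 :&: F ij.2|)%N]|%:R.
Proof.
move=> hk; rewrite (eq_Ex _ (F2 := fun H => \sum_(ij : I * I) hrem (F ij.1) H * hrem (F ij.2) H)).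
  rewrite Ex_sum mulr_natr -sumr_const [leRHS]big_mkcond /=; apply: ler_sum => -[i j] _ /=.
  rewrite inE /=; case: ltnP => h; last by rewrite Ex_rem_rem.
  apply: Ex_le_cst => // H; apply: le_trans (ler_norm _) _; rewrite normrM expr2.
  have nr l : `|hrem (F l) H| <= (1 + k)%:R.
    by apply: le_trans (norm_hrem _ _) _; rewrite ler_nat leq_add2l.
  by apply: ler_pM.
move=> H; rewrite expr2 /rempart mulr_suml -(pair_bigA _ (fun i j => hrem (F i) H * hrem (F j) H)) /=.
by apply: eq_bigr => i _; rewrite mulr_sumr.
Qed.
End Hoeffding.

(** * Comparing products, exponentials and Bernoulli factors *)

Section Normc.
Variable R : realType.

Lemma normcD_le (x y : R[i]) : nc (x + y) <= nc x + nc y.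
Proof. exact: le_normcD. Qed.

Lemma normcM_eq (x y : R[i]) : nc (x * y) = nc x * nc y.
Proof. exact: Normc.normcM. Qed.

Lemma normcB_real (a b : R) : nc (a%:C - b%:C) = `|a - b|.
Proof. by rewrite -normc_real rmorphB. Qed.

Lemma normc_dist (x y z : R[i]) : nc (x - z) <= nc (x - y) + nc (y - z).
Proof. by have := normcD_le (x - y) (y - z); rewrite addrA subrK. Qed.

Lemma normc_prod (I : Type) (s : seq I) (a : I -> R[i]) :
  (forall i, nc (a i) <= 1) -> nc (\prod_(i <- s) a i) <= 1.
Proof.
move=> ha; elim: s => [|i s IH]; first by rewrite big_nil (normc_real 1) normr1.
by rewrite big_cons normcM_eq mulr_ile1 ?normc_ge0.
Qed.

Lemma normc_prod_sub (I : Type) (s : seq I) (a b : I -> R[i]) :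
  (forall i, nc (a i) <= 1) -> (forall i, nc (b i) <= 1) ->
  nc (\prod_(i <- s) a i - \prod_(i <- s) b i) <= \sum_(i <- s) nc (a i - b i).
Proof.
move=> ha hb; elim: s => [|i s IH]; first by rewrite !big_nil subrr (normc_real 0) normr0.
rewrite !big_cons; set A := \prod_(j <- s) a j; set B := \prod_(j <- s) b j.
have -> : a i * A - b i * B = (a i - b i) * A + b i * (A - B) by ring.
apply: le_trans (normcD_le _ _) _; rewrite !normcM_eq; apply: lerD.
  by rewrite ler_piMr ?normc_ge0 // normc_prod.
by apply: le_trans IH; rewrite ler_piMl ?normc_ge0.
Qed.

Lemma expi_lipschitz (x y : R) : nc (expi x - expi y) <= 2 * `|x - y|.
Proof.
have -> : expi x - expi y = expi y * (expi (x - y) - 1).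
  by rewrite mulrBr mulr1 -expiD [y + _]addrC subrK.
rewrite normcM_eq normc_expi mul1r; have := expi_taylor 1 (x - y).
by rewrite /expi_poly big_ord1 expr0 expr1 (_ : 0`! = 1)%N // (_ : 1`! = 1)%N // !divr1.
Qed.

Lemma expRN_lipschitz (a b : R) : 0 <= a -> 0 <= b -> `|expR (- a) - expR (- b)| <= `|a - b|.
Proof.
wlog ab : a b / a <= b => [hw a0 b0|a0 b0].
  have [/hw|/ltW/hw] := leP a b; first exact.
  by move=> /(_ b0 a0); rewrite distrC [`|b - a|]distrC.
rewrite [leRHS]distrC ger0_norm; last by rewrite subr_ge0 ler_expR lerN2.
rewrite ger0_norm ?subr_ge0 //.
have -> : expR (- b) = expR (- a) * expR (- (b - a)) by rewrite -expRD; congr expR; ring.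
have h1 : expR (- a) <= 1 by rewrite -expR0 ler_expR oppr_le0.
have h2 := expR_ge1Dx (- (b - a)); have h3 := expR_ge0 (- a).
have h4 : expR (- (b - a)) <= 1 by rewrite -expR0 ler_expR oppr_le0 subr_ge0.
have -> : expR (- a) - expR (- a) * expR (- (b - a)) = expR (- a) * (1 - expR (- (b - a))) by ring.
apply: (@le_trans _ _ (1 * (1 - expR (- (b - a))))); last by lra.
by apply: ler_wpM2r => //; rewrite subr_ge0.
Qed.

Lemma expRN_quadratic (y : R) : 0 <= y -> `|expR (- y) - (1 - y)| <= y ^+ 2.
Proof.
move=> y0; have h1 := expR_ge1Dx (- y); rewrite ger0_norm; last by lra.
have h2 : expR (- y) <= (1 + y)^-1.
  rewrite expRN lef_pV2 ?posrE ?expR_gt0 //; first exact: expR_ge1Dx.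
  by rewrite ltr_wpDr.
have h3 : (1 + y)^-1 <= 1 - y + y ^+ 2.
  rewrite -div1r ler_pdivrMr; last by rewrite ltr_wpDr.
  have : 0 <= y ^+ 3 by rewrite exprn_ge0.
  have -> : (1 - y + y ^+ 2) * (1 + y) = 1 + y ^+ 3 by ring.
  by rewrite lerDl.
by lra.
Qed.

Lemma expi_poly3 (x : R) : expi_poly 3 x = (1 - x ^+ 2 / 2) +i* x.
Proof.
rewrite expi_polyE /PRe /PIm !big_ord_recl !big_ord0 /= !hornerE.
have [f0 f1 f2] : [/\ 0`! = 1%N, (bump 0 0)`! = 1%N & (bump 0 (bump 0 0))`! = 2%N] by [].
by rewrite f0 f1 f2; congr (_ +i* _); rewrite /=; field.
Qed.

(** The centred Bernoulli factor and the Gaussian one share the expansion 1 - v u^2 / 2; the cubic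
    error comes from the former and the quartic one from the latter. *)
Lemma bernoulli_gauss (p u : R) : 0 <= p -> p <= 1 ->
  nc (p%:C * expi (u * (1 - p)) + (1 - p%:C) * expi (u * - p) -
      (expR (- (p * (1 - p) * u ^+ 2 / 2)))%:C) <= `|u| ^+ 3 + u ^+ 4.
Proof.
move=> p0 p1; set v := p * (1 - p).
have v0 : 0 <= v by rewrite mulr_ge0 // subr_ge0.
have v1 : v <= 1 by rewrite /v; nra.
have vu0 : 0 <= v * u ^+ 2 / 2 by apply: divr_ge0 => //; apply: mulr_ge0 v0 (sqr_ge0 u).
have h1 : nc (p%:C * expi (u * (1 - p)) + (1 - p%:C) * expi (u * - p) - (1 - v * u ^+ 2 / 2)%:C) <= `|u| ^+ 3.
  have -> : (1 - v * u ^+ 2 / 2)%:C = p%:C * expi_poly 3 (u * (1 - p)) + (1 - p%:C) * expi_poly 3 (u * - p).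
    rewrite !expi_poly3; apply/eqP; rewrite eq_complex /v /=; apply/andP.
    by split; apply/eqP; field.
  have -> : forall a b c d e g : R[i], a * b + c * d - (a * e + c * g) = a * (b - e) + c * (d - g).
    by move=> *; ring.
  have T x : `|x| <= 1 -> nc (expi (u * x) - expi_poly 3 (u * x)) <= `|u| ^+ 3.
    move=> x1; apply: le_trans (expi_taylor _ _) _; rewrite normrM exprMn.
    have u3 : 0 <= `|u| ^+ 3 by rewrite exprn_ge0.
    have x3 : `|x| ^+ 3 <= 1 by rewrite exprn_ile1.
    have -> : 3`!%:R = 6 :> R by [].
    by move: (`|u| ^+ 3) (`|x| ^+ 3) u3 x3 => a b a0 b1; rewrite mulrA ler_pdivrMr //; nra.
  have -> : 1 - p%:C = (1 - p)%:C by rewrite rmorphB.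
  have p10 : 0 <= 1 - p by rewrite subr_ge0.
  apply: le_trans (normcD_le _ _) _; rewrite !normcM_eq !normc_real (ger0_norm p0) (ger0_norm p10).
  have t1 : `|1 - p| <= 1 by rewrite ger0_norm //; lra.
  have t2 : `|- p| <= 1 by rewrite normrN ger0_norm.
  apply: le_trans (lerD (ler_wpM2l p0 (T _ t1)) (ler_wpM2l p10 (T _ t2))) _.
  by rewrite -mulrDl [p + _]addrC subrK mul1r.
apply: le_trans (normc_dist _ (1 - v * u ^+ 2 / 2)%:C _) _; apply: lerD => //.
rewrite normcB_real distrC; apply: le_trans (expRN_quadratic vu0) _.
have -> : (v * u ^+ 2 / 2) ^+ 2 = (v / 2) ^+ 2 * u ^+ 4 by field.
rewrite ler_piMl ?exprn_even_ge0 // expr_le1 //; last by rewrite divr_ge0.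
by rewrite ler_pdivrMr // mul1r; lra.
Qed.
End Normc.

(** * Gaussian approximation of a sum of monomials *)

Section SmallFrequencies.
Variables (R : realType) (T I : finType) (p : R) (F : I -> {set T}).
Hypotheses (p0 : 0 <= p) (p1 : p <= 1).
Let f (H : {set T}) : R := \sum_i mono R (F i) H.
Local Notation c := (lincoef p F).
Local Notation q := (Ex p (fun H => rempart p F H ^+ 2)).

Lemma charfun_linpart (u : R) :
  Ex p%:C (fun H => expi (u * linpart p F H)) =
  \prod_e (p%:C * expi (u * c e * (1 - p)) + (1 - p%:C) * expi (u * c e * - p)).
Proof.
pose ph e (b : bool) : R[i] := if b then expi (u * c e * (1 - p)) else expi (u * c e * - p).
rewrite (eq_Ex _ (F2 := fun H => \prod_e ph e (e \in H))).
  by rewrite Ex_prod.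
move=> H; rewrite /linpart mulr_sumr expi_sum; apply: eq_bigr => e _.
by rewrite /ph /chi mulrA; case: (e \in H); rewrite /= ?mulr1n ?mulr0n ?sub0r.
Qed.

Lemma Ex_norm_rempart : Ex p (fun H => `|rempart p F H|) <= Num.sqrt q.
Proof.
have q0 : 0 <= q by apply: Ex_ge0 => // H; exact: sqr_ge0.
rewrite -(@ler_pXn2r _ 2) // ?nnegrE ?sqrtr_ge0 //; last by apply: Ex_ge0 => // H.
rewrite sqr_sqrtr //; apply: le_trans (Ex_sqr p0 p1 _) _.
by rewrite (eq_Ex _ (F2 := fun H => rempart p F H ^+ 2)) // => H; rewrite real_normK ?num_real.
Qed.

(** Three comparisons: dropping the remainder costs its L2 norm; the linear form gives a product,
    replaced by Gaussian factors one at a time; the resulting Gaussian lacks the variance [q] of the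
    remainder, a relative defect q / sg^2. *)
Theorem charfun_gauss (t sg : R) : 0 < sg -> Ex p (fun H => (f H - Ex p f) ^+ 2) = sg ^+ 2 ->
  nc (Ex p%:C (fun H => expi (t * ((f H - Ex p f) / sg))) - (expR (- (t ^+ 2 / 2)))%:C) <=
  2 * (`|t| / sg * Num.sqrt q) + \sum_e (`|t / sg * c e| ^+ 3 + (t / sg * c e) ^+ 4) +
  t ^+ 2 / 2 * (q / sg ^+ 2).
Proof.
move=> sg0 var; have q0 : 0 <= q by apply: Ex_ge0 => // H; exact: sqr_ge0.
rewrite variance_hoeffding in var.
have v0 : 0 <= p * (1 - p) by rewrite mulr_ge0 // subr_ge0.
set u := t / sg.
pose b e : R := expR (- (p * (1 - p) * (u * c e) ^+ 2 / 2)).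
have b1 e : nc (b e)%:C <= 1.
  rewrite normc_real ger0_norm ?expR_ge0 // -expR0 ler_expR oppr_le0.
  by rewrite divr_ge0 // mulr_ge0 // sqr_ge0.
have a1 e : nc (p%:C * expi (u * c e * (1 - p)) + (1 - p%:C) * expi (u * c e * - p)) <= 1.
  have -> : 1 - p%:C = (1 - p)%:C by rewrite rmorphB.
  apply: le_trans (normcD_le _ _) _; rewrite !normcM_eq !normc_real !normc_expi !mulr1.
  by rewrite !ger0_norm ?subr_ge0 //; lra.
have prodb : \prod_e (b e)%:C = (expR (- (t ^+ 2 / 2 * (1 - q / sg ^+ 2))))%:C.
  rewrite -rmorph_prod /= -expR_sum; congr (expR _)%:C; rewrite sumrN; congr (- _).
  rewrite (eq_bigr (fun e => u ^+ 2 / 2 * (p * (1 - p)) * c e ^+ 2)); last by move=> e _; ring.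
  rewrite -mulr_sumr -mulrA (_ : p * (1 - p) * _ = sg ^+ 2 - q); last by rewrite -var addrK.
  by rewrite /u; field; rewrite gt_eqF.
apply: le_trans (normc_dist _ (Ex p%:C (fun H => expi (u * linpart p F H))) _) _.
rewrite -addrA; apply: lerD.
  rewrite -ExB; apply: le_trans (normc_Ex p0 p1 _) _.
  apply: (@le_trans _ _ (Ex p (fun H => 2 * (`|t| / sg) * `|rempart p F H|))).
    apply: ler_Ex => // H; apply: le_trans (expi_lipschitz _ _) _.
    rewrite (hoeffding p F) (_ : t * _ - _ = t / sg * rempart p F H); last by rewrite /u; ring.
    by rewrite normrM normrM normfV (gtr0_norm sg0) !mulrA.
  rewrite ExZ -[leLHS]mulrA; apply: ler_wpM2l => //; apply: ler_wpM2l Ex_norm_rempart.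
  by rewrite divr_ge0 // ltW.
rewrite charfun_linpart; apply: le_trans (normc_dist _ (\prod_e (b e)%:C) _) _; apply: lerD.
  apply: le_trans (normc_prod_sub _ a1 b1) _; apply: ler_sum => e _.
  exact: bernoulli_gauss.
rewrite prodb normcB_real.
have sq1 : q / sg ^+ 2 <= 1.
  rewrite ler_pdivrMr ?exprn_gt0 // mul1r -var lerDr mulr_ge0 //.
  by apply: sumr_ge0 => e _; exact: sqr_ge0.
apply: le_trans (expRN_lipschitz _ _) _.
- by rewrite mulr_ge0 ?subr_ge0 // divr_ge0 ?sqr_ge0.
- by rewrite divr_ge0 ?sqr_ge0.
rewrite (_ : _ - _ = - (t ^+ 2 / 2 * (q / sg ^+ 2))); last by ring.
by rewrite normrN ger0_norm // mulr_ge0 ?divr_ge0 ?sqr_ge0 ?exprn_ge0 // ltW.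
Qed.
End SmallFrequencies.

(** * Variance of the clique count *)

Section CliqueVariance.
Variables (R : realType) (p : R) (r n : nat).
Hypotheses (p0 : 0 < p) (p1 : p < 1) (r2 : (2 <= r)%N) (n_gt0 : (0 < n)%N).
Let F (A : rset n r) : {set edge n} := EE (val A).
Let K := 'C(r, 2).
Local Notation c := (lincoef p F).
Local Notation q := (Ex p (fun H => rempart p F H ^+ 2)).
Let n1 : 0 < n%:R :> R. Proof. by rewrite ltr0n. Qed.

Lemma card_F A : #|F A| = K.
Proof. by rewrite card_EE; case: A => A /= /eqP ->. Qed.

Lemma count_superset (Y : {set 'I_n}) :
  \sum_(A : rset n r) (Y \subset val A : nat) = #|[set A : {set 'I_n} | (#|A| == r) && (Y \subset A)]|.
Proof.
rewrite (sum_rset r (fun A => (Y \subset A : nat))) -sum1dep_card big_mkcondr /=.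
by apply: eq_bigr => A _; case: (_ \subset _).
Qed.

Lemma lincoef_cliques_ge0 e : 0 <= c e.
Proof. by apply: sumr_ge0 => A _; rewrite mulr_ge0 // exprn_ge0 // ltW. Qed.

Lemma lincoef_cliques_le e : c e * n%:R ^+ 2 <= n%:R ^+ r.
Proof.
have h := card_superset r (val e); rewrite card_edge in h.
apply: (@le_trans _ _ (#|[set A : {set 'I_n} | (#|A| == r) && (val e \subset A)]|%:R * n%:R ^+ 2)).
  apply: ler_wpM2r; first by rewrite exprn_ge0.
  rewrite -count_superset natr_sum; apply: ler_sum => A _.
  by rewrite inE ler_piMr // exprn_ile1 // ltW.
by rewrite -!natrX -natrM ler_nat.
Qed.

Lemma lincoef_cliques_sum : \sum_e c e = K%:R * p ^+ K.-1 * 'C(n, r)%:R.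
Proof.
rewrite /lincoef exchange_big /= (eq_bigr (fun=> K%:R * p ^+ K.-1)); last first.
  move=> A _; rewrite -mulr_suml card_F; congr (_ * _).
  rewrite -[K in RHS](card_F A) -sum1_card natr_sum [RHS]big_mkcond /=.
  by apply: eq_bigr => e _; case: (e \in F A).
by rewrite sumr_const card_rset mulr_natr.
Qed.

(** Cauchy-Schwarz over at most n^2 edges, obtained by expanding the sum of squares of c e - m at m
    = S/n^2. *)
Lemma lincoef_cliques_sq : (\sum_e c e) ^+ 2 / n%:R ^+ 2 <= \sum_e c e ^+ 2.
Proof.
set S := \sum_e c e; pose m := S / n%:R ^+ 2.
have n2 : 0 < n%:R ^+ 2 :> R by rewrite exprn_gt0.
have h (x : R) : 2 * x * S - x ^+ 2 * #|{: edge n}|%:R <= \sum_e c e ^+ 2.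
  rewrite -subr_ge0 (_ : _ - _ = \sum_e (c e - x) ^+ 2); first by apply: sumr_ge0 => e _; exact: sqr_ge0.
  have -> : x ^+ 2 * #|{: edge n}|%:R = \sum_(e : edge n) x ^+ 2 by rewrite sumr_const mulr_natr.
  rewrite /S mulr_sumr -!sumrB; apply: eq_bigr => e _; move: (c e) => a; ring.
apply: le_trans (h m); have : m ^+ 2 * #|{: edge n}|%:R <= m ^+ 2 * n%:R ^+ 2.
  by rewrite ler_wpM2l ?sqr_ge0 // -natrX ler_nat card_edges_le.
have -> : 2 * m * S = 2 * (S ^+ 2 / n%:R ^+ 2) by rewrite /m; ring.
have -> : m ^+ 2 * n%:R ^+ 2 = S ^+ 2 / n%:R ^+ 2 by rewrite /m; field; rewrite gt_eqF.
by move: (_ / _) (m ^+ 2 * _) => a b; lra.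
Qed.

(** Two r-sets with two common edges share three vertices, and the pairs are counted over such a
    triple [Y]. *)
Lemma card_pairs : (#|[set AB : rset n r * rset n r | (1 < #|F AB.1 :&: F AB.2|)%N]| * n ^ 3 <= n ^ (2 * r))%N.
Proof.
pose N (Y : {set 'I_n}) := #|[set A : rset n r | Y \subset val A]|.
have NE Y : (N Y * n ^ #|Y| <= n ^ r)%N.
  apply: leq_trans (card_superset r Y); rewrite -count_superset leq_mul2r /N -sum1dep_card.
  by rewrite [X in (X <= _)%N]big_mkcond leqnn orbT.
have h : (#|[set AB : rset n r * rset n r | (1 < #|F AB.1 :&: F AB.2|)%N]| <=
  \sum_(Y : {set 'I_n} | #|Y| == 3) N Y * N Y)%N.
  apply: (@leq_trans #|\bigcup_(Y : {set 'I_n} | #|Y| == 3)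
      finset.setX [set A : rset n r | Y \subset val A] [set A : rset n r | Y \subset val A]|).
    apply: subset_leq_card; apply/subsetP => -[A B]; rewrite inE /= => hAB.
    have EI : F A :&: F B = EE (val A :&: val B) by apply/setP => e; rewrite !inE subsetI.
    have c3 : (3 <= #|val A :&: val B|)%N.
      by move: hAB; rewrite EI card_EE; case: #|_| => [|[|[|]]].
    have [Y YAB cY] := subset_of_card c3.
    apply/bigcupP; exists Y; first by rewrite cY.
    by move: YAB; rewrite subsetI inE /= !inE.
  apply: leq_trans (card_bigcup_le _ _) _; apply: leq_sum => Y _.
  by rewrite cardsX.
rewrite -(@leq_pmul2r (n ^ 3)) ?expn_gt0 ?n_gt0 // -mulnA.
apply: leq_trans (leq_mul h (leqnn _)) _; rewrite big_distrl /=.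
apply: (@leq_trans (\sum_(Y : {set 'I_n} | #|Y| == 3) n ^ (2 * r))).
  apply: leq_sum => Y /eqP cY; have := NE Y; rewrite cY => hY.
  by rewrite mulnACA mul2n -addnn expnD; exact: leq_mul.
rewrite sum_nat_const mulnC leq_mul2l; apply/orP; right.
have -> : #|[pred Y : {set 'I_n} | #|Y| == 3]| = 'C(n, 3).
  by rewrite -[n in RHS]card_ord -card_draws; apply: eq_card => Y; rewrite !inE.
exact: bin_le_exp.
Qed.

Lemma rempart_cliques_le : q * n%:R ^+ 3 <= (1 + K)%:R ^+ 2 * n%:R ^+ (2 * r).
Proof.
have hk A : (#|F A| <= K)%N by rewrite card_F.
have := rempart_sq_le (ltW p0) (ltW p1) hk => /(ler_wpM2r (exprn_ge0 3 (ltW n1)))/le_trans; apply.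
by rewrite -mulrA ler_wpM2l ?exprn_ge0 // -!natrX -natrM ler_nat card_pairs.
Qed.

Let f (H : graph n) : R := cliques R r H.
Let Z : R := n%:R ^+ (r - 1).
Let v : R := p * (1 - p).
Let S0 : R := K%:R * p ^+ K.-1 / (2 ^+ r * r`!%:R).
(** Lower constant for sigma / n^(r-1) from the linear part alone; 2^r r! comes from C(n, r) >=
    (n/2)^r / r! when n >= 2r. *)
Definition sd_lower : R := Num.sqrt v * S0.
Local Notation var := (Ex p (fun H => (f H - Ex p f) ^+ 2)).

Let v0 : 0 < v. Proof. by rewrite mulr_gt0 // subr_gt0. Qed.
Let K0 : (0 < K)%N. Proof. by rewrite bin_gt0. Qed.

Lemma sd_lower_gt0 : 0 < sd_lower.
Proof.
by rewrite mulr_gt0 ?sqrtr_gt0 // /S0 divr_gt0 // mulr_gt0 ?exprn_gt0 ?ltr0n ?fact_gt0.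
Qed.

Let ZE : n%:R ^+ r = Z * n%:R :> R.
Proof. by rewrite /Z -exprSr subn1 prednK //; exact: ltnW. Qed.

Let Z0 : 0 < Z. Proof. by rewrite exprn_gt0. Qed.

Let var_eq : var = v * (\sum_e c e ^+ 2) + q.
Proof.
rewrite -variance_hoeffding; have fE : f =1 fun H => \sum_i mono R (F i) H by move=> H; exact: cliquesE.
by rewrite (eq_Ex p fE); apply: eq_Ex => H; rewrite fE.
Qed.

Lemma var_cliques_ge : (2 * r <= n)%N -> sd_lower ^+ 2 * Z ^+ 2 <= var.
Proof.
move=> rn; have q0 : 0 <= q by apply: Ex_ge0 => [||H]; rewrite ?sqr_ge0 // ltW.
rewrite var_eq; apply: (@le_trans _ _ (v * \sum_e c e ^+ 2)); last by rewrite lerDl.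
rewrite /sd_lower exprMn sqr_sqrtr; last exact: ltW.
rewrite -mulrA ler_wpM2l //; first exact: ltW.
apply: le_trans lincoef_cliques_sq; rewrite ler_pdivlMr ?exprn_gt0 // -!exprMn.
have S00 : 0 <= S0 by rewrite divr_ge0 // mulr_ge0 ?exprn_ge0 // ltW.
apply: lerXn2r; rewrite ?nnegrE.
- exact: mulr_ge0 (mulr_ge0 S00 (ltW Z0)) (ltW n1).
- by apply: sumr_ge0 => e _; exact: lincoef_cliques_ge0.
rewrite -mulrA -ZE lincoef_cliques_sum /S0.
rewrite [leLHS](_ : _ = K%:R * p ^+ K.-1 * (n%:R ^+ r / (2 ^+ r * r`!%:R))); last by rewrite mulrAC -mulrA.
apply: ler_wpM2l; first by rewrite mulr_ge0 ?exprn_ge0 // ltW.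
rewrite ler_pdivrMr; last by rewrite mulr_gt0 ?exprn_gt0 // ltr0n fact_gt0.
rewrite mulrCA -natrX -natrM -natrX -natrM ler_nat.
apply: (@leq_trans (2 ^ r * (n - r) ^ r)); last by rewrite leq_mul2l bin_ge_exp orbT.
by rewrite -expnMn; apply: exp_mono; move: rn; clear; lia.
Qed.

Lemma rempart_cliques_leZ : q <= (1 + K)%:R ^+ 2 * Z ^+ 2 / n%:R.
Proof.
have := rempart_cliques_le; rewrite mul2n -addnn exprD ZE => h.
rewrite ler_pdivlMr // -(ler_pM2r (exprn_gt0 2 n1)).
rewrite (_ : q * _ * _ = q * n%:R ^+ 3); last by ring.
by apply: le_trans h _; rewrite le_eqVlt; apply/orP; left; apply/eqP; ring.
Qed.

Lemma lincoef_cliques_leZ e : c e <= Z / n%:R.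
Proof.
have := lincoef_cliques_le e; rewrite ZE => h.
by rewrite ler_pdivlMr // -(ler_pM2r n1) -mulrA.
Qed.

Lemma var_cliques_le : var <= (2 + K)%:R ^+ 2 * Z ^+ 2.
Proof.
rewrite var_eq; have n1' : 1 <= n%:R :> R by rewrite ler1n.
have Z2 : 0 <= Z ^+ 2 by rewrite exprn_ge0 // ltW.
have hq : q <= (1 + K)%:R ^+ 2 * Z ^+ 2.
  apply: le_trans rempart_cliques_leZ _; rewrite ler_pdivrMr // ler_peMr //.
  by rewrite mulr_ge0 ?exprn_ge0.
have v1 : v <= 1 by rewrite mulr_ile1 ?subr_ge0 ?lerBlDr ?lerDl // ltW.
have hc : \sum_e c e ^+ 2 <= Z ^+ 2.
  apply: (@le_trans _ _ (\sum_(e : edge n) (Z / n%:R) ^+ 2)).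
    apply: ler_sum => e _; apply: lerXn2r (lincoef_cliques_leZ e).
      by rewrite nnegrE lincoef_cliques_ge0.
    by rewrite nnegrE divr_ge0 // ltW.
  rewrite sumr_const -[_ *+ _]mulr_natr expr_div_n mulrAC ler_pdivrMr ?exprn_gt0 //.
  by rewrite ler_wpM2l // -natrX ler_nat card_edges_le.
have s0 : 0 <= \sum_e c e ^+ 2 by apply: sumr_ge0 => e _; exact: sqr_ge0.
have h1 : v * \sum_e c e ^+ 2 <= Z ^+ 2 by apply: le_trans hc; rewrite ler_piMl.
apply: le_trans (lerD h1 hq) _.
rewrite -[X in X + _]mul1r -mulrDl ler_wpM2r // -!natrX nat1r ler_nat.
by clear; rewrite !expnS expn0; nia.
Qed.
End CliqueVariance.

(** * Gaussian approximation of the clique count *)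

Section CliqueGauss.
Variables (R : realType) (p : R) (r n : nat).
Hypotheses (p0 : 0 < p) (p1 : p < 1) (r2 : (2 <= r)%N) (n_gt0 : (0 < n)%N) (rn : (2 * r <= n)%N).
Let f (H : graph n) : R := cliques R r H.
Local Notation sg := (Num.sqrt (Ex p (fun H => (f H - Ex p f) ^+ 2))).
Let K := 'C(r, 2).
Let k1 : R := sd_lower p r.
Let Z : R := n%:R ^+ (r - 1).
Definition gauss_constant : R :=
  2 * ((1 + K)%:R / k1) + ((k1^-1) ^+ 3 + (k1^-1) ^+ 4) + ((1 + K)%:R / k1) ^+ 2.

Let n1 : 0 < n%:R :> R. Proof. by rewrite ltr0n. Qed.
Let Z0 : 0 < Z. Proof. by rewrite exprn_gt0. Qed.
Let k10 : 0 < k1. Proof. exact: sd_lower_gt0. Qed.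

Lemma sd_cliques_ge : k1 * Z <= sg.
Proof.
rewrite -[k1 * Z]ger0_norm; last by rewrite mulr_ge0 // ltW.
by rewrite -sqrtr_sqr ler_wsqrtr // exprMn var_cliques_ge.
Qed.

Lemma sd_cliques_le : sg <= (2 + K)%:R * Z.
Proof.
rewrite -[_ * Z]ger0_norm; last by rewrite mulr_ge0 // ltW.
by rewrite -sqrtr_sqr ler_wsqrtr // exprMn var_cliques_le.
Qed.

Let sg0 : 0 < sg. Proof. by apply: lt_le_trans sd_cliques_ge; rewrite mulr_gt0. Qed.

(** After division by [sg] the remainder has L2 norm O(n^(-1/2)) and each linear coefficient is
    O(1/n). Over at most n^2 edges the cubic terms add up to O(|t|^3 / n), which is O(|t| / sqrt n)
    because t^4 <= n. *)
Lemma charfun_cliques_gauss t : t ^+ 4 <= n%:R ->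
  nc (Ex p%:C (fun H => expi (t * ((f H - Ex p f) / sg))) - (expR (- (t ^+ 2 / 2)))%:C) <=
  gauss_constant * (`|t| / Num.sqrt n%:R).
Proof.
move=> t4; pose F (A : rset n r) := EE (val A).
have fE : f =1 fun H => \sum_i mono R (F i) H by move=> H; exact: cliquesE.
set W := Num.sqrt n%:R; have W2 : W ^+ 2 = n%:R by rewrite sqr_sqrtr // ltW.
have W1 : 1 <= W by rewrite -[1]sqrtr1 ler_wsqrtr // ler1n.
have W0 : 0 < W by exact: lt_le_trans W1.
have W0' := ltW W0.
have a0 : 0 <= `|t| by [].
have aW : `|t| ^+ 2 <= W.
  rewrite -(@ler_pXn2r _ 2) ?nnegrE ?exprn_ge0 // W2 -exprM.
  by rewrite -normrX ger0_norm ?exprn_even_ge0.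
set x := `|t| / W; have x0 : 0 <= x by rewrite divr_ge0 // ltW.
have x1 : x <= 1.
  rewrite ler_pdivrMr // mul1r -(@ler_pXn2r _ 2) ?nnegrE //; apply: le_trans aW _.
  by rewrite expr2 ler_peMr // ltW.
set sd := sg; have hsd := sd_cliques_ge; rewrite -/sd in hsd.
have sd0 : 0 < sd by exact: sg0.
have ieq : sd^-1 <= (k1 * Z)^-1 by rewrite lef_pV2 ?posrE // mulr_gt0.
have sq : Num.sqrt (Ex p (fun H => rempart p F H ^+ 2)) <= (1 + K)%:R * Z / W.
  have h := rempart_cliques_leZ p0 p1 r2 n_gt0; rewrite -/K -/Z in h.
  rewrite -[leRHS]ger0_norm; last by rewrite divr_ge0 ?mulr_ge0 // ltW.
  rewrite -sqrtr_sqr ler_wsqrtr //; apply: le_trans h _.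
  by rewrite expr_div_n W2 exprMn.
have varE : Ex p (fun H => (\sum_i mono R (F i) H - Ex p (fun H => \sum_i mono R (F i) H)) ^+ 2) = sd ^+ 2.
  rewrite sqr_sqrtr; last by apply: Ex_ge0 => [||H]; rewrite ?sqr_ge0 // ltW.
  by rewrite (eq_Ex p fE); apply: eq_Ex => H; rewrite fE.
have := charfun_gauss (ltW p0) (ltW p1) t sd0 varE.
rewrite (eq_Ex p%:C (F2 := fun H => expi (t * ((f H - Ex p f) / sd)))); last first.
  by move=> H; rewrite -(eq_Ex p fE) -fE.
move=> /le_trans; apply.
have q0 : 0 <= Ex p (fun H => rempart p F H ^+ 2) by apply: Ex_ge0 => [||H]; rewrite ?sqr_ge0 // ltW.
have T1 : `|t| / sd * Num.sqrt (Ex p (fun H => rempart p F H ^+ 2)) <= (1 + K)%:R / k1 * x.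
  apply: (@le_trans _ _ (`|t| / (k1 * Z) * ((1 + K)%:R * Z / W))).
    by apply: (ler_pM _ (sqrtr_ge0 _) _ sq); [rewrite divr_ge0 // ltW | exact: ler_wpM2l].
  by rewrite le_eqVlt; apply/orP; left; apply/eqP; rewrite /x; field; rewrite !gt_eqF.
have ce e : `|t / sd * lincoef p F e| <= x / (k1 * W).
  rewrite normrM normrM normfV (gtr0_norm sd0) (ger0_norm (lincoef_cliques_ge0 r p0 e)).
  apply: (@le_trans _ _ (`|t| / (k1 * Z) * (Z / n%:R))).
    apply: ler_pM; [by rewrite divr_ge0 // ltW | exact: lincoef_cliques_ge0 | exact: ler_wpM2l |].
    exact: lincoef_cliques_leZ.
  by rewrite -W2 le_eqVlt; apply/orP; left; apply/eqP; rewrite /x; field; rewrite !gt_eqF.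
have y0 : 0 <= x / (k1 * W) by rewrite divr_ge0 // mulr_ge0 // ltW.
have T2 : \sum_e (`|t / sd * lincoef p F e| ^+ 3 + (t / sd * lincoef p F e) ^+ 4) <=
    (k1^-1) ^+ 3 * x + (k1^-1) ^+ 4 * x.
  apply: (@le_trans _ _ (n%:R ^+ 2 * ((x / (k1 * W)) ^+ 3 + (x / (k1 * W)) ^+ 4))).
    apply: (@le_trans _ _ (\sum_(e : edge n) ((x / (k1 * W)) ^+ 3 + (x / (k1 * W)) ^+ 4))).
      apply: ler_sum => e _; apply: lerD; first by apply: lerXn2r; rewrite ?nnegrE.
      rewrite -[leLHS]ger0_norm ?exprn_even_ge0 // normrX.
      by apply: lerXn2r; rewrite ?nnegrE.
    rewrite sumr_const -[_ *+ _]mulr_natl; apply: ler_wpM2r.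
      by rewrite addr_ge0 // exprn_ge0.
    by rewrite -natrX ler_nat card_edges_le.
  have k3 : 0 <= (k1^-1) ^+ 3 by rewrite exprn_ge0 // invr_ge0 ltW.
  have k4 : 0 <= (k1^-1) ^+ 4 by rewrite exprn_ge0 // invr_ge0 ltW.
  have xa : x * `|t| <= 1 by rewrite /x mulrAC ler_pdivrMr // mul1r.
  rewrite mulrDr; apply: lerD.
    rewrite [leLHS](_ : _ = (k1^-1) ^+ 3 * (x * (x * `|t|))); last first.
      by rewrite -W2 /x; field; rewrite !gt_eqF.
    by rewrite ler_wpM2l // ler_piMr.
  rewrite [leLHS](_ : _ = (k1^-1) ^+ 4 * (x * (x ^+ 3))); last by rewrite -W2; field; rewrite !gt_eqF.
  by rewrite ler_wpM2l // ler_piMr // exprn_ile1.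
have T3 : t ^+ 2 / 2 * (Ex p (fun H => rempart p F H ^+ 2) / sd ^+ 2) <= ((1 + K)%:R / k1) ^+ 2 * x.
  have -> : t ^+ 2 / 2 * (Ex p (fun H => rempart p F H ^+ 2) / sd ^+ 2) =
     (`|t| / sd * Num.sqrt (Ex p (fun H => rempart p F H ^+ 2))) ^+ 2 / 2.
    rewrite -{1}(sqr_sqrtr q0) -(real_normK (num_real t)).
    by move: (Num.sqrt (Ex p _)) => z; field; rewrite gt_eqF.
  have B0 : 0 <= (1 + K)%:R / k1 :> R by rewrite divr_ge0 // ltW.
  apply: (@le_trans _ _ (((1 + K)%:R / k1 * x) ^+ 2)).
    apply: (@le_trans _ _ ((`|t| / sd * Num.sqrt (Ex p (fun H => rempart p F H ^+ 2))) ^+ 2)).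
      by rewrite ler_pdivrMr // ler_peMr ?sqr_ge0 // ler1n.
    apply: lerXn2r T1; rewrite nnegrE ?mulr_ge0 ?sqrtr_ge0 // ?invr_ge0 ?ltW //.
  by rewrite exprMn ler_wpM2l ?sqr_ge0 // expr2 ler_piMr.
have -> : gauss_constant * x = 2 * ((1 + K)%:R / k1 * x) + ((k1^-1) ^+ 3 * x + (k1^-1) ^+ 4 * x) +
    ((1 + K)%:R / k1) ^+ 2 * x by rewrite /gauss_constant; ring.
apply: lerD T3; apply: lerD T2; by rewrite ler_wpM2l.
Qed.
End CliqueGauss.

(** * Integral bound from two pointwise bounds *)

Section IntegralBound.
Variable R : realType.
Local Notation mu := (@lebesgue_measure R).
Implicit Types (g : R -> R).

Lemma measurable_charfun_diff (I : finType) (w k : I -> R) (h : R -> R) : measurable_fun [set: R]%classic h ->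
  measurable_fun [set: R]%classic (fun t : R => nc (\sum_i (w i)%:C * expi (t * k i) - (h t)%:C)).
Proof.
move=> mh.
pose re (t : R) := \sum_i w i * cos (t * k i) - h t.
pose im (t : R) := \sum_i w i * sin (t * k i).
have E : (fun t : R => nc (\sum_i (w i)%:C * expi (t * k i) - (h t)%:C)) =
    fun t => Num.sqrt (re t ^+ 2 + im t ^+ 2).
  apply/boolp.funext => t.
  have -> : \sum_i (w i)%:C * expi (t * k i) = (\sum_i w i * cos (t * k i)) +i* im t.
    rewrite /im; elim/big_rec3: _ => [|i a b z _ ->]; first by [].
    by apply/eqP; rewrite eq_complex /=; apply/andP; split; apply/eqP; ring.
  by rewrite /= subr0.
have lin i : measurable_fun [set: R]%classic (fun t : R => t * k i).
  by apply: measurable_realfun.measurable_funM; [exact: measurable_id | exact: measurable_cst].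
rewrite E; apply: measurableT_comp.
  by apply: measurable_realfun.continuous_measurable_fun; exact: sqrt_continuous.
apply: measurable_realfun.measurable_funD; apply: measurable_realfun.measurable_funX.
  apply: measurable_realfun.measurable_funB => //; apply: measurable_sum => i; apply: measurable_realfun.measurable_funM; first exact: measurable_cst.
  apply: measurableT_comp (lin i); apply: measurable_realfun.continuous_measurable_fun; exact: continuous_cos.
apply: measurable_sum => i; apply: measurable_realfun.measurable_funM; first exact: measurable_cst.
apply: measurableT_comp (lin i); apply: measurable_realfun.continuous_measurable_fun; exact: continuous_sin.
Qed.

(** The integrand is dominated by [A] times the indicator of [-T, T] plus the constant [B], which
    avoids splitting the domain and comparing [T] with [b]. *)
Lemma Rintegral_le_two_levels g (b T A B : R) : measurable_fun [set: R]%classic g -> 0 <= b -> 0 <= T ->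
  0 <= A -> 0 <= B -> (forall t, 0 <= g t) ->
  (forall t, `|t| <= b -> `|t| <= T -> g t <= A) ->
  (forall t, `|t| <= b -> T <= `|t| -> g t <= B) ->
  `|\int[mu]_(t in `[- b, b]%classic) g t| <= A * (2 * T) + B * (2 * b).
Proof.
move=> mg b0 T0 A0 B0 g0 hA hB; rewrite /Rintegral.
set D : set R := `[- b, b]%classic; set J : set R := `[- T, T]%classic.
have mD : measurable D by exact: measurable_itv.
have mJ : measurable J by exact: measurable_itv.
have len (c : R) : 0 <= c -> mu `[- c, c]%classic = (2 * c)%:E.
  move=> c0; rewrite lebesgue_measure_itv /= lte_fin.
  case: ltP => h; first by rewrite -EFinB; congr (_%:E); ring.
  by rewrite (_ : c = 0) ?mulr0 //; lra.
have i0 : (0 <= \int[mu]_(t in D) (g t)%:E)%E.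
  by apply: integral_ge0 => t _; rewrite lee_fin.
have ile : (\int[mu]_(t in D) (g t)%:E <= (A * (2 * T) + B * (2 * b))%:E)%E.
  apply: (@le_trans _ _ (\int[mu]_(t in D) (A%:E * (\1_J t)%:E + (cst B%:E) t))%E).
    apply: ge0_le_integral => //.
    - by move=> t _; rewrite lee_fin.
    - by apply/measurable_realfun.measurable_EFinP; apply: measurable_funTS.
    - apply: emeasurable_funD; last exact: measurable_cst.
      apply/measurable_realfun.measurable_EFinP; apply: measurable_realfun.measurable_funM.
        exact: measurable_cst.
      by apply: measurable_realfun.measurable_indic.
    move=> t; rewrite /D /= in_itv /= -ler_norml => tb.
    rewrite -EFinM -EFinD lee_fin indicE.
    have [tT|tT] := leP `|t| T.
      have -> : t \in J by apply: mem_set; rewrite /J /= in_itv /= -ler_norml.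
      by rewrite mulr1; apply: le_trans (hA t tb tT) _; rewrite lerDl.
    by apply: le_trans (hB t tb (ltW tT)) _; rewrite lerDr mulr_ge0.
  rewrite ge0_integralD //=.
    rewrite integral_cst // [X in (B%:E * X)%E](len b b0 : _ = _) ge0_integralZl_EFin //.
    + rewrite integral_indic // EFinD; apply: leeD; last by rewrite -EFinM.
      rewrite EFinM; apply: lee_wpmul2l; first by rewrite lee_fin.
      rewrite -(len T T0); apply: le_measure; rewrite ?inE //.
        by apply: mem_set; exact: measurableI.
      by apply: mem_set.
    + by apply/measurable_realfun.measurable_EFinP; apply: measurable_realfun.measurable_indic.
  - by move=> t _; rewrite mule_ge0 // lee_fin indicE.
  - apply/measurable_realfun.measurable_EFinP; apply: measurable_realfun.measurable_funM.
      exact: measurable_cst.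
    by apply: measurable_realfun.measurable_indic.
have ifin : (\int[mu]_(t in D) (g t)%:E)%E \is a fin_num.
  by rewrite ge0_fin_numE //; apply: le_lt_trans ile _; rewrite ltry.
rewrite ger0_norm; last exact: fine_ge0.
by rewrite -lee_fin fineK.
Qed.
End IntegralBound.

(** * Large frequencies *)

Section Tails.
Variables (R : realType) (p tau : R) (r : nat).
Hypotheses (p0 : 0 < p) (p1 : p < 1) (r2 : (2 <= r)%N) (tau0 : 0 < tau).

Lemma powR_above (a M : R) : 0 < a -> exists n0 : nat, forall n, (n0 <= n)%N -> M <= n%:R `^ a.
Proof.
move=> a0; have [n0 h] := nat_above (`|M| `^ a^-1).
exists n0 => n /h hn; apply: le_trans (ler_norm M) _.
have -> : `|M| = (`|M| `^ a^-1) `^ a by rewrite -powRrM mulVf ?gt_eqF // powRr1.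
by apply: ge0_ler_powR => //; rewrite ?nnegrE ?powR_ge0 // ltW.
Qed.

Lemma gauss_tail : exists n0 : nat, forall n (t : R), (n0 <= n)%N -> n%:R `^ tau <= `|t| ->
  expR (- (t ^+ 2 / 2)) <= (n%:R ^+ r)^-1.
Proof.
have [E hE] := nat_above (r%:R / tau); have {}hE := hE E (leqnn _).
have h0 : 0 < 1 / 2 :> R by rewrite divr_gt0.
have [x0 _ h] := poly_exp_small_real 1 E h0.
have [n0 hn] := powR_above (x0 + 1) tau0.
exists n0.+1 => n t nn nt; have n_gt0 : (0 < n)%N by exact: leq_ltn_trans nn.
have n1 : 1 <= n%:R :> R by rewrite ler1n.
have hx := hn n (ltnW nn).
set y := n%:R `^ tau in nt hx.
have y1 : 1 <= y.
  apply: (@le_trans _ _ (n%:R `^ 0)); first by rewrite powRr0.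
  by apply: ler_powR => //; exact: ltW.
have nr : n%:R ^+ r <= y ^+ E.
  rewrite -!powR_mulrn //; last exact: le_trans y1.
  rewrite /y -powRrM; apply: ler_powR => //.
  by move: hE; rewrite ler_pdivrMr // mulrC.
have nr0 : 0 < n%:R ^+ r :> R by rewrite exprn_gt0 // ltr0n.
rewrite -[leRHS]div1r ler_pdivlMr // mulrC.
have xy : x0 <= y by move: hx; lra.
apply: le_trans (h y xy); rewrite mul1r; apply: ler_pM => //.
rewrite ler_expR lerN2 mulrAC mul1r ler_wpM2r //.
rewrite -(real_normK (num_real t)); apply: (le_trans nt).
by rewrite expr2 ler_peMr //; exact: le_trans y1 nt.
Qed.

(** Centring contributes a factor of modulus 1 and leaves the frequency s = t/sg. As sg =
    O(n^(r-1)), the condition |t| >= n^tau gives |s| n^(r-1) >= n^(tau/2), half of the exponent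
    absorbing the constant. *)
Lemma charfun_cliques_tail : exists n0 : nat, forall n (t : R), (n0 <= n)%N ->
  let f (H : graph n) : R := cliques R r H in
  let sg := Num.sqrt (Ex p (fun H => (f H - Ex p f) ^+ 2)) in
  n%:R `^ tau <= `|t| -> `|t| <= pi * sg ->
  nc (Ex p%:C (fun H => expi (t * ((f H - Ex p f) / sg)))) <= (n%:R ^+ r)^-1.
Proof.
have t2 : 0 < tau / 2 by rewrite divr_gt0.
have [n1 h1] := charfun_small p0 p1 r2 t2.
have [n2 h2] := powR_above (2 + 'C(r, 2))%:R t2.
exists (n1 + n2 + 2 * r)%N => n t hn f sg nt tsg.
have rn : (2 * r <= n)%N by move: hn; clear; lia.
have n_gt0 : (0 < n)%N by apply: leq_trans rn; rewrite muln_gt0 /=; exact: ltnW.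
have Z0 : 0 < n%:R ^+ (r - 1) :> R by rewrite exprn_gt0 // ltr0n.
have sgl := sd_cliques_ge p0 p1 r2 n_gt0 rn.
have sgu := sd_cliques_le p0 p1 r2 n_gt0.
have sg0 : 0 < sg by apply: lt_le_trans sgl; rewrite mulr_gt0 // sd_lower_gt0.
have -> : Ex p%:C (fun H => expi (t * ((f H - Ex p f) / sg))) =
    expi (- (t * (Ex p f / sg))) * Ex p%:C (fun H : graph n => expi (t / sg * cliques R r H)).
  rewrite -ExZ; apply: eq_Ex => H; rewrite -expiD; congr expi.
  by rewrite -/(f H); ring.
rewrite normcM_eq normc_expi mul1r; apply: h1.
- by move: hn; clear; lia.
- by rewrite normrM normfV (gtr0_norm sg0) ler_pdivrMr.
rewrite normrM normfV (gtr0_norm sg0) mulrAC ler_pdivlMr //.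
have hy : (2 + 'C(r, 2))%:R <= n%:R `^ (tau / 2) by apply: h2; move: hn; clear; lia.
have y0 : 0 <= n%:R `^ (tau / 2) by exact: powR_ge0.
apply: (@le_trans _ _ (n%:R `^ (tau / 2) * (n%:R `^ (tau / 2) * n%:R ^+ (r - 1)))).
  rewrite ler_wpM2l //; apply: le_trans sgu _; rewrite ler_wpM2r //; exact: ltW.
rewrite mulrA -powRD; last by apply/implyP => _; rewrite pnatr_eq0 -lt0n.
by rewrite -splitr ler_wpM2r // ltW.
Qed.
End Tails.

(** * The integral over the whole range *)

Section CltIntegral.
Variables (R : realType) (p tau : R) (r : nat).
Hypotheses (p0 : 0 < p) (p1 : p < 1) (r2 : (2 <= r)%N) (tau0 : 0 < tau) (tau4 : 4 * tau <= 1).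

Lemma gnp_charfunE n (X : graph n -> R) t :
  gnp_charfun p (gnp_standardize p X) t =
  Ex p%:C (fun H => expi (t * ((X H - Ex p X) / Num.sqrt (Ex p (fun H => (X H - Ex p X) ^+ 2))))).
Proof. by apply: eq_bigr => H _; rewrite bw_real. Qed.

(** The inner range, of length 2 n^tau, carries an error O(n^(tau - 1/2)). On the outer range the
    integrand is at most 2 n^(-r) and the length is O(n^(r-1)), which gives O(1/n). *)
Theorem clt_integral_bound : exists2 C : R, 0 < C & exists n0 : nat, forall n, (n0 <= n)%N ->
  forall f sigma, f = @cliques R r n -> sigma = gnp_stddev p f ->
  `|\int[@lebesgue_measure R]_(t in `[- (pi * sigma), pi * sigma]%classic)
     nc (gnp_charfun p (gnp_standardize p f) t - (expR (- (t ^+ 2 / 2)))%:C)| <=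
  C * n%:R `^ (- (1 / 2) + 2 * tau).
Proof.
have [n1 h1] := charfun_cliques_tail p0 p1 r2 tau0.
have [n2 h2] := gauss_tail r tau0.
pose Cg := gauss_constant p r; pose K := 'C(r, 2).
have k1 : 0 < sd_lower p r by exact: sd_lower_gt0.
have Cg0 : 0 <= Cg.
  have k1i : 0 <= (sd_lower p r)^-1 by rewrite invr_ge0 ltW.
  by rewrite /Cg /gauss_constant !addr_ge0 ?exprn_ge0 ?mulr_ge0.
exists (2 * Cg + 16 * (2 + K)%:R); first by rewrite ltr_wpDl ?mulr_ge0 ?mulr_gt0 // ltr0n.
exists (n1 + n2 + 2 * r)%N => n hn f sigma -> ->; clear f sigma; set f := @cliques R r n; set sigma := gnp_stddev p f.
have rn : (2 * r <= n)%N by move: hn; clear; lia.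
have n_gt0 : (0 < n)%N by apply: leq_trans rn; rewrite muln_gt0 /=; exact: ltnW.
have nR : 0 < n%:R :> R by rewrite ltr0n.
have nR1 : 1 <= n%:R :> R by rewrite ler1n.
have nN : n%:R != 0 :> R by rewrite gt_eqF.
have sgl := sd_cliques_ge p0 p1 r2 n_gt0 rn.
have sgu := sd_cliques_le p0 p1 r2 n_gt0.
have Z0 : 0 < n%:R ^+ (r - 1) :> R by rewrite exprn_gt0.
have sg0 : 0 < sigma by apply: lt_le_trans sgl; rewrite mulr_gt0.
have pi0 : 0 < pi :> R := pi_gt0 R.
pose T := n%:R `^ tau : R; have T0 : 0 <= T by exact: powR_ge0.
pose A := Cg * (T / Num.sqrt n%:R); pose B := 2 * (n%:R ^+ r)^-1 : R.
have A0 : 0 <= A by rewrite mulr_ge0 // divr_ge0 ?sqrtr_ge0.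
have B0 : 0 <= B by rewrite mulr_ge0 // invr_ge0 exprn_ge0 // ltW.
have b0 : 0 <= pi * sigma by rewrite mulr_ge0 // ltW.
have mg : measurable_fun [set: R]%classic
    (fun t => nc (gnp_charfun p (gnp_standardize p f) t - (expR (- (t ^+ 2 / 2)))%:C)).
  apply: measurable_charfun_diff; apply: measurableT_comp; first exact: measurable_realfun.measurable_expR.
  apply: (measurableT_comp (@measurable_realfun.oppr_measurable R _)).
  apply: measurable_realfun.measurable_funM; last exact: measurable_cst.
  by apply: measurable_realfun.measurable_funX; exact: measurable_id.
apply: le_trans (Rintegral_le_two_levels mg b0 T0 A0 B0 _ _ _) _.
- by move=> t; exact: normc_ge0.
- move=> t _ tT; rewrite gnp_charfunE.
  have t4 : t ^+ 4 <= n%:R.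
    rewrite -[leLHS]ger0_norm ?exprn_even_ge0 // normrX.
    apply: (@le_trans _ _ (T ^+ 4)); first by apply: lerXn2r; rewrite ?nnegrE.
    rewrite -powR_mulrn // /T -powRrM -[leRHS]powRr1; last exact: ltW.
    by apply: ler_powR => //; rewrite mulrC.
  apply: le_trans (charfun_cliques_gauss p0 p1 r2 n_gt0 rn t4) _.
  rewrite /A ler_wpM2l // ler_wpM2r // invr_ge0 sqrtr_ge0 //.
- move=> t tb Tt; rewrite gnp_charfunE /B.
  have g1 : nc (Ex p%:C (fun H => expi (t * ((f H - Ex p f) / sigma)))) <= (n%:R ^+ r)^-1.
    by apply: h1 => //; move: hn; clear; lia.
  have g2 : expR (- (t ^+ 2 / 2)) <= (n%:R ^+ r)^-1 by apply: h2 Tt; move: hn; clear; lia.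
  apply: le_trans (normcD_le _ _) _; rewrite normcN normc_real ger0_norm ?expR_ge0 //.
  by apply: le_trans (lerD g1 g2) _; rewrite -mulr2n mulr_natl.
set P := n%:R `^ _.
have hA : A * (2 * T) = 2 * Cg * P.
  rewrite /A /P powRD; last by apply/implyP.
  rewrite (_ : 2 * tau = tau + tau); last by ring.
  rewrite powRD; last by apply/implyP.
  rewrite -/T (_ : n%:R `^ (- (1 / 2)) = (Num.sqrt n%:R)^-1); first by ring.
  by rewrite powRN div1r powR12_sqrt // ltW.
have hB : B * (2 * (pi * sigma)) <= 16 * (2 + K)%:R * P.
  have e1 : n%:R ^-1 <= P.
    rewrite -powR_inv1; last exact: ltW.
    by apply: ler_powR => //; move: tau0; lra.
  apply: (@le_trans _ _ (B * (2 * (4 * ((2 + K)%:R * n%:R ^+ (r - 1)))))).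
    rewrite ler_wpM2l // ler_wpM2l //; apply: ler_pM => //; [exact: ltW | exact: ltW | exact: pi_le4].
  have -> : B * (2 * (4 * ((2 + K)%:R * n%:R ^+ (r - 1)))) = 16 * (2 + K)%:R * n%:R^-1.
    have -> : B = 2 * (n%:R ^+ (r - 1) * n%:R)^-1.
      by rewrite /B -exprSr subn1 prednK //; exact: ltnW.
    by move: (n%:R ^+ (r - 1)) Z0 => z z0; field; rewrite nN gt_eqF.
  by rewrite ler_wpM2l // mulr_ge0.
by rewrite hA [leRHS]mulrDl lerD2l.
Qed.
End CltIntegral.

From mathcomp Require Import all_boot all_order all_algebra complex.
From mathcomp Require Import all_classical all_reals all_analysis.
Local Open Scope classical_set_scope.
Local Open Scope ring_scope.
Local Open Scope complex_scope.

Theorem mainTheorem4 (R : realType) (r : nat) (p tau : R)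
  (hr : (3 <= r)%N) (hp0 : 0 < p) (hp1 : p < 1)
  (htau0 : 0 < tau) (htau1 : tau < Num.min (1 / (2 * r%:R)) (1 / 12)) :
  (fun n : nat =>
     let f : graph n -> R := @cliques R r n in
     let sigma : R := gnp_stddev p f in
     let K : graph n -> R := gnp_standardize p f in
     \int[lebesgue_measure]_(t in `[- (pi * sigma), pi * sigma])
       ComplexField.Normc.normc
         (gnp_charfun p K t - (expR (- (t ^+ 2 / 2)))%:C))
  =O_\oo (fun n : nat => n%:R `^ (- (1 / 2) + 2 * tau)).
Proof.
(* This places the cut |t| = n^tau within the range t^4 <= n of the Gaussian approximation. *)
have tau4 : 4 * tau <= 1 by move: htau1; rewrite lt_min => /andP[_]; lra.
have [C C0 [n0 h]] := clt_integral_bound hp0 hp1 (ltnW hr) htau0 tau4.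
apply/eqO_exP; exists C => //; exists n0 => // n /= hn.
by rewrite [X in _ <= C * X]ger0_norm ?powR_ge0 //; exact: h.
Qed.
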